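(* Let $p\in\mathbb{N}=\{0,1,2,\dots\}$. Let $q$ be a sub-critical offspring distribution ($\mu<1$) with generating function $f$, and suppose that there exists a unique $\kappa>1$ such that $f(\kappa)=\kappa$ and $f^{(p\vee 1)}(\kappa)<+\infty$. Then for every $n\in\mathbb{N}$ and every $\Lambda_n\in\mathscr{F}_n$: (1) For every $s\in[0,\kappa)$, $$\lim_{m\to+\infty}\frac{\mathbb{E}\left[H_p(Z_{m+n})s^{Z_{m+n}}\mathbf{1}_{\Lambda_n}\right]}{\mathbb{E}\left[H_p(Z_{m+n})s^{Z_{m+n}}\right]}=\begin{cases}\mathbb{E}[\mathbf{1}_{\Lambda_n}] & \text{if }p=0,\\ \mathbb{E}\left[\frac{Z_n}{\mu^n}\mathbf{1}_{\Lambda_n}\right] & \text{if }p\ge 1.\end{cases}$$ (2) For every $a\ge 0$, $$\lim_{m\to+\infty}\frac{\mathbb{E}\left[H_p(Z_{m+n})\kappa^{Z_{m+n}}e^{-aZ_{m+n}/f'(\kappa)^{m+n}}\mathbf{1}_{\Lambda_n}\right]}{\mathbb{E}\left[H_p(Z_{m+n})\kappa^{Z_{m+n}}e^{-aZ_{m+n}/f'(\kappa)^{m+n}}\right]}=\mathbb{E}\left[\bar M_n^{(p)}\mathbf{1}_{\Lambda_n}\right],\qquad \bar M_n^{(p)}=\frac{1}{f'(\kappa)^{pn}}\kappa^{Z_n-1}\bar G_{n,0}^{(p)}(Z_n).$$ Moreover, for every $n_0\ge 0$, the probability measure $\mathbb{Q}_{n_0}^{(p)}$ on trees defined by $$\frac{d\mathbb{Q}_{n_0}^{(p)}}{d\mathbb{P}_{n_0}}\Big|_{\mathscr{F}_n}=\bar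 M_{n,n_0}^{(p)}:=\frac{1}{f'(\kappa)^{p(n-n_0)}}\kappa^{Z_n-1}\bar G_{n,n_0}^{(p)}(Z_n)\qquad (n\ge n_0)$$ is the probability measure $\bar{\mathbf{Q}}_{n_0}^{(p)}$ (the law of the multi-type Galton-Watson tree built from $\bar q$, defined in the context).
   Context: **Trees.** $\mathscr{U}=\bigcup_{n\ge0}(\mathbb{N}^* )^n$ is the set of finite words of positive integers, with $(\mathbb{N}^* )^0=\{\partial\}$ and $|u|$ the length of $u$; for $u\neq\partial$, $\bar u$ is $u$ with its last letter removed. A tree $\mathbf{t}$ rooted at $u\in\mathscr{U}$ is a subset of $\mathscr{U}$ such that $u\in\mathbf{t}$; $|v|<|u|$ implies $v\notin\mathbf{t}$; $v\in\mathbf{t}\setminus\{u\}$ implies $\bar v\in\mathbf{t}$; and for all $v\in\mathbf{t}$ there is $k_v(\mathbf{t})\in\mathbb{N}$ with $vi\in\mathbf{t}\iff i\le k_v(\mathbf{t})$ for all $i\in\mathbb{N}^*$. Let $\mathbf{1}_n=(1,\dots,1)\in(\mathbb{N}^* )^n$ ($\mathbf{1}_0=\partial$), $r_n(\mathbf{t})=\{u\in\mathbf{t}:|u|\le n\}$, $z_n(\mathbf{t})=\mathrm{Card}\{u\in\mathbf{t}:|u|=n\}$. **Galton-Watson trees.** $q=(q_n)_{n\in\mathbb{N}}$ is a probability on $\mathbb{N}$ with mean $\mu$ and generating function $f(s)=\sum_nq_ns^n$. Under $\mathbb{P}_k$, $\tau$ is the Galton-Watson tree with offspring distribution $q$ rooted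 at $\mathbf{1}_k$: for $h>k$ and every tree $\mathbf{t}$ rooted at $\mathbf{1}_k$ of height at most $h$, $\mathbb{P}_k(r_h(\tau)=\mathbf{t})=\prod_{u\in r_{h-1}(\mathbf{t})}q_{k_u(\mathbf{t})}$. $\mathbb{P}=\mathbb{P}_0$ (with expectation $\mathbb{E}$), $Z_n=z_n(\tau)$ (so $Z_0=1$ under $\mathbb{P}$); $\mathscr{F}_n$ is the $\sigma$-field generated by $r_n(\tau)$. Convention: $0^0=1$. **Objects attached to $\bar q$.** $\bar f(t)=f(\kappa t)/\kappa$, $t\in[0,1]$, is the generating function of the super-critical offspring distribution $\bar q_n=\kappa^{n-1}q_n$, whose mean is $\bar\mu=f'(\kappa)>1$. Let $\bar Z$ be the Galton-Watson process with offspring distribution $\bar q$ started from one individual, $\bar W$ the a.s. limit of $\bar Z_n/\bar\mu^n$, and $\bar\phi(b)=\mathbb{E}[e^{-b\bar W}]$, $b\ge0$, with derivatives $\bar\phi^{(k)}$ (one-sided at $0$), $\bar\phi^{(0)}=\bar\phi$. Let $H_0(x)=1$, $H_k(x)=\frac1{k!}\prod_{j=0}^{k-1}(x-j)$ for $k\ge1$; $S_{i,p}=\{(n_1,\dots,n_i)\in(\mathbb{N}^* )^i:\ n_1+\cdots+n_i=p\}$; $\bar a_i^{(p)}(n)=\sum_{(n_1,\ldots,n_i)\in S_{i,p}}\prod_{r=1}^i\frac{\bar\phi^{(n_r)}(a/\bar\mu^n)}{n_r!}$. For $n\ge n_0\ge0$, $$\bar G_{n,n_0}^{(0)}(x)=\frac{\bar\phi(a/\bar\mu^n)^x}{\bar\phi(a/\bar\mu^{n_0})},\qquad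 \bar G_{n,n_0}^{(p)}(x)=\frac{p!}{\bar\phi^{(p)}(a/\bar\mu^{n_0})}\sum_{i=1}^p\bar a_i^{(p)}(n)H_i(x)\bar\phi(a/\bar\mu^n)^{x-i}\quad(p\ge1).$$ **The measure $\bar{\mathbf{Q}}_{n_0}^{(p)}$.** Under it, $\tau$ is (the tree, types forgotten, of) an inhomogeneous multi-type Galton-Watson tree with types in $\{0,\dots,p\}$ such that: the root is $\mathbf{1}_{n_0}$ (height $n_0$) and has type $p$; a node of type $\ell$ at height $n$ gives, independently of the other nodes, $k$ offspring with respective types $(\ell_1,\dots,\ell_k)\in\mathbb{N}^k$ satisfying $\ell_1+\cdots+\ell_k=\ell$ with probability $$\bar q_k\,\frac{1}{\bar\mu^\ell}\,\frac{\ell!}{\bar\phi^{(\ell)}(a/\bar\mu^n)}\prod_{j=1}^k\frac{\bar\phi^{(\ell_j)}(a/\bar\mu^{n+1})}{\ell_j!}.$$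
   Formalization: In (1) the case s=0 with p≥1 is excluded, since the quotient is 0/0 for every m; in (2) and the ''moreover'' part, for p=1 it is assumed that W̄ is not a.s. 0, since otherwise φ̄'≡0 and M̄^{(1)}, Q̄^{(1)} contain 0/0. *)

(* Defs.v *)
Set Warnings "-notation-overridden,-notation-incompatible-prefix,-ambiguous-paths,-redundant-canonical-projection".
From HB Require Import structures.
From mathcomp Require Import all_boot all_order all_algebra.
From mathcomp Require Import finmap.
From mathcomp Require Import all_classical all_reals all_analysis.
Set Implicit Arguments.
Unset Strict Implicit.
Unset Printing Implicit Defensive.
Import Order.TTheory GRing.Theory Num.Theory.
Import numFieldNormedType.Exports.
Local Open Scope classical_set_scope.
Local Open Scope ring_scope.

(* Letters are positive: see [words]. The empty word is [::]. *)
Definition word := seq nat.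
Definition words : set word := [set u | all (leq 1) u].
Definition ones (k : nat) : word := nseq k 1%N.

Definition rooted_tree (u : word) (t : set word) : Prop :=
  [/\ t `<=` words, t u,
      forall v, (size v < size u)%N -> ~ t v,
      forall v i, t (rcons v i) -> rcons v i <> u -> t v
    & forall v, t v ->
        exists k, forall i, (0 < i)%N -> (t (rcons v i) <-> (i <= k)%N)].

Definition nkids (t : set word) (v : word) : nat :=
  xget 0%N [set k | forall i, (0 < i)%N -> (t (rcons v i) <-> (i <= k)%N)].

Definition restr (n : nat) (t : set word) : set word :=
  [set u | t u /\ (size u <= n)%N].

Definition gen_size (n : nat) (t : set word) : nat :=
  #|` fset_set [set u | t u /\ size u = n] |%fset.

Record tree := Tree { nodes :> set word ; _ : exists u, rooted_tree u nodes }.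

Lemma rooted_tree_empty : exists u, rooted_tree u [set [::]].
Proof.
exists [::]; split.
- by move=> u /= ->.
- by [].
- by [].
- by move=> [|x v].
- by move=> v /= ->; exists 0%N => -[|i] //= _; split.
Qed.

HB.instance Definition _ := gen_eqMixin tree.
HB.instance Definition _ := gen_choiceMixin tree.
HB.instance Definition _ := isPointed.Build tree (Tree rooted_tree_empty).

(* The sigma-field generated by r_n. All sets of values are allowed on the
   right because r_n takes only countably many values. *)
Definition filtr (n : nat) : set (set tree) :=
  preimage_set_system setT (fun t : tree => restr n t) setT.

Definition cylinders : set (set tree) := \bigcup_n filtr n.

HB.instance Definition _ := @isMeasurable.Build (sigma_display cylinders) tree
  <<s cylinders >> (@sigma_algebra0 _ setT cylinders)
  (@sigma_algebraC _ cylinders) (@sigma_algebra_bigcup _ setT cylinders).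

Section GaltonWatson.
Variable R : realType.
Implicit Types (q : nat -> R) (phi : R -> R) (a s kappa mu : R).

Definition is_distribution q : Prop :=
  (forall n, 0 <= q n) /\ (\sum_(n <oo) (q n)%:E = 1)%E.

Definition mean q : \bar R := (\sum_(n <oo) (n%:R * q n)%:E)%E.

Definition genfun q s : \bar R := (\sum_(n <oo) (q n * s ^+ n)%:E)%E.

(* The k-th derivative of the power series f at s >= 0, with values in
   [0, +oo]; at the radius of convergence this is the left derivative. *)
Definition genfunD q (k : nat) s : \bar R :=
  (\sum_(n <oo) ((n ^_ k)%:R * q n * s ^+ (n - k))%:E)%E.

Definition qbar q kappa (n : nat) : R := kappa ^ (n%:Z - 1) * q n.

Definition GW_law q (k : nat) (P : probability tree R) : Prop :=
  forall (h : nat) (t : set word), (k < h)%N -> rooted_tree (ones k) t ->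
    (forall u, t u -> (size u <= h)%N) ->
    P [set x : tree | restr h x = t] =
      (\big[*%R/1]_(u \in restr h.-1 t) q (nkids t u))%:E.

(* [rho n l s] is the probability that a node of type l at height n has
   [size s] children, of respective types s. Q is the law of the tree obtained
   by forgetting the types, starting from a root of type l0 at height n0. The
   values of [typ w] off the tree [tau w] are irrelevant. *)
Definition multitype_GW_law (rho : nat -> nat -> seq nat -> R) (n0 l0 : nat)
    (Q : probability tree R) : Prop :=
  exists (d : measure_display) (Om : measurableType d) (Pr : probability Om R)
         (tau : Om -> tree) (typ : Om -> word -> nat),
  [/\ measurable_fun setT tau,
      forall u, measurable_fun setT (fun w => typ w u),
      forall (h : nat) (t : set word) (c : word -> nat),
        (n0 < h)%N -> rooted_tree (ones n0) t ->
        (forall u, t u -> (size u <= h)%N) ->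
        Pr [set w | restr h (tau w) = t /\ forall u, t u -> typ w u = c u] =
          ((c (ones n0) == l0)%:R *
           \big[*%R/1]_(u \in restr h.-1 t)
             rho (size u) (c u)
               [seq c (rcons u i) | i <- iota 1 (nkids t u)])%:E
    & forall A, measurable A -> Q A = Pr (tau @^-1` A)].

Definition laplace (P : probability tree R) (W : tree -> R) (b : R) : R :=
  fine ('E_P[fun t => expR (- (b * W t))])%E.

(* Derivative of a function on [0, +oo[, one-sided at 0. *)
Definition der0 phi (b : R) : R :=
  if b == 0 then lim ((phi h - phi 0) / h @[h --> 0^'+]) else derive1 phi b.

Definition der0n (k : nat) phi : R -> R := iter k der0 phi.

Definition Hpol (k : nat) (x : R) : R :=
  (k`!%:R)^-1 * \prod_(j < k) (x - j%:R).

(* A composition of p has parts at most p, so S_{i,p} is a set of functions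
   from 'I_i to 'I_p.+1. *)
Definition acoef phi mu a (i p n : nat) : R :=
  \sum_(s : {ffun 'I_i -> 'I_p.+1} |
        [forall r, (0 < s r)%N] && ((\sum_r s r)%N == p))
    \prod_(r < i) (der0n (s r) phi (a / mu ^+ n) / ((s r)`!)%:R).

Definition Gfun phi mu a (p n n0 x : nat) : R :=
  if p is 0 then phi (a / mu ^+ n) ^+ x / phi (a / mu ^+ n0)
  else p`!%:R / der0n p phi (a / mu ^+ n0) *
       \sum_(1 <= i < p.+1) acoef phi mu a i p n * Hpol i x%:R *
                            phi (a / mu ^+ n) ^ (x%:Z - i%:Z).

Definition Mfun phi mu a kappa (p n n0 x : nat) : R :=
  (mu ^+ (p * (n - n0)))^-1 * kappa ^ (x%:Z - 1) * Gfun phi mu a p n n0 x.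

Definition rhobar q phi mu a (n l : nat) (s : seq nat) : R :=
  if sumn s == l then
    q (size s) * (mu ^+ l)^-1 * (l`!%:R / der0n l phi (a / mu ^+ n)) *
    \prod_(j <- s) (der0n j phi (a / mu ^+ n.+1) / j`!%:R)
  else 0.

End GaltonWatson.

(* Main.v *)
Require Import Defs.
From HB Require Import structures.
Set Warnings "-notation-overridden,-notation-incompatible-prefix,-ambiguous-paths".
From mathcomp Require Import all_boot all_order all_algebra.
From mathcomp Require Import finmap.
From mathcomp Require Import all_classical all_reals all_analysis.
From mathcomp Require Import measurable_realfun simple_functions lebesgue_integral_under.
From mathcomp Require Import ring lra.
Import Order.TTheory GRing.Theory Num.Theory.
Import numFieldNormedType.Exports.
Local Open Scope classical_set_scope.
Local Open Scope ring_scope.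
Set Implicit Arguments.
Unset Strict Implicit.
Unset Printing Implicit Defensive.

(** Everything is computed on atoms, the sets of trees with the same first
    generations: an event of [filtr n] is a countable union of atoms, and the
    probability of an atom is a finite product of offspring probabilities
    ([GW_atom]). The weights [H_l(z) s ^ z], for [l <= p], are the coefficients of
    the [z]-th power of the jet [s (1 + 'X)], a polynomial taken up to degree [p].
    The Markov property then says that taking means over one generation composes
    the jet with the offspring generating function [f] ([GW_jet]), so that weights
    put on generation [m + n] become, on generation [n], a power of the [m]-th
    iterate of the jet.

    Below the fixed point [kappa], the constant coefficients of the iterates [T m]
    tend to 1, and the other ones tend to 0 at the speed of the linear
    coefficient ([T_le]). Hence the coefficient of degree [p] of [T m ^ z] is
    [z (T m)`_p] up to a quadratic error, and the ratio of means tends to the mean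
    of [Z_n] normalised by [mu ^ n] ([weighted_cvg]). For [p = 0] only the constant
    coefficient is left, and the limit is the probability of the event.

    At [kappa], the weight [kappa ^ Z_n] turns the law of the tree into the one
    with offspring law [qbar] ([tilted_integral]), which is super-critical by
    convexity of [f] ([qbar_mean_gt1]). There, factorial moments normalised by
    [mubar ^ (l m)] are bounded uniformly in [m], for all orders up to [p], by a
    polynomial [G] with [f(G(t)) <= G(mubar t)] ([dominating_jet]). With weights
    [exp (- b Z_m / mubar ^ m)], [0 < b], they converge to the moments
    [E[W ^ l exp (- b W)] / l!] of the limit, and [b -> 0] gives the moments of [W]
    and the functional equation [limit_momentD]. The ratio of means converges by
    domination by [G] ([supercritical_cvg]). The moments are the derivatives of
    the Laplace transform of [W] up to sign ([der0n_laplace]), and the sum over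
    compositions that defines the martingale is a coefficient of a power of the
    jet of these moments ([Gfun_jet]).

    The functional equation, read at the first generation, says that the offspring
    weights of the multi-type tree sum to 1. The tree is built from independent
    offspring sequences, one for each node and type, which are read off the digits
    of a uniform variable ([coin_indep], [multitype_law]). The probability of its
    first generations telescopes, as the factor of a type appears once for the
    node as a child and once for the node as a parent ([prod_rho]); what is left is
    a product over the last generation, and its sum over the types of that
    generation is the coefficient that appears in the martingale ([tau_atom],
    [multitype_density]). *)

(** * Rooted trees, generation by generation *)

Lemma nkids_unique (t : set word) v k :
  (forall i, (0 < i)%N -> (t (rcons v i) <-> (i <= k)%N)) -> nkids t v = k.
Proof.
move=> tk; rewrite /nkids; case: xgetP => [m _ /= tm|/(_ k)//].
have H i : (0 < i)%N -> (i <= m)%N = (i <= k)%N.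
  by move=> i0; apply/idP/idP; rewrite -tm// -tk.
apply/eqP; rewrite eqn_leq; apply/andP; split.
- by case: (posnP m) => [->//|m0]; rewrite -H.
- by case: (posnP k) => [->//|k0]; rewrite H.
Qed.

(** Generations are lists, so that a product over the nodes of a tree is a big
    operator that splits off its last generation. The definition makes sense for
    any set of words, which avoids carrying a proof that [t] is a tree. *)
Section Generations.
Variables (r : word) (t : set word).

Fixpoint lev (j : nat) : seq word :=
  if j is j'.+1 then
    flatten [seq [seq rcons v i | i <- iota 1 (nkids t v)] | v <- lev j']
  else [:: r].

Fixpoint upto (j : nat) : seq word :=
  if j is j'.+1 then upto j' ++ lev j' else [::].

Lemma size_lev j v : v \in lev j -> size v = (size r + j)%N.
Proof.
elim: j v => [|j IH] v /=; first by rewrite inE => /eqP ->; rewrite addn0.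
case/flattenP => s /mapP[w wj ->] /mapP[i _ ->].
by rewrite size_rcons (IH _ wj) addnS.
Qed.

Lemma lev_uniq j : uniq (lev j).
Proof.
elim: j => //= j; elim: (lev j) => //= w s IHs /andP[ws /IHs us].
rewrite cat_uniq us andbT map_inj_uniq ?iota_uniq//=; last first.
  by move=> a b /rcons_inj[].
apply/hasPn => v /flattenP[_ /mapP[w' w's ->]] /mapP[i _ ->].
apply: contra ws => /mapP[i' _ /rcons_inj[<- _]] //.
Qed.

Lemma mem_uptoP j v : reflect (exists2 i, (i < j)%N & v \in lev i) (v \in upto j).
Proof.
elim: j => [|j IH]; first by rewrite in_nil; constructor => -[].
rewrite /= mem_cat; apply: (iffP orP) => [[/IH[i ij vi]|vj]|[i]].
- by exists i => //; exact: ltnW.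
- by exists j.
- rewrite ltnS leq_eqVlt => /predU1P[->|ij vi]; first by right.
  by left; apply/IH; exists i.
Qed.

Lemma upto_uniq j : uniq (upto j).
Proof.
elim: j => //= j IH; rewrite cat_uniq IH lev_uniq andbT /=.
apply/hasPn => v /size_lev sv; apply/negP => /mem_uptoP[i ij /size_lev].
by rewrite sv => /addnI ji; rewrite ji ltnn in ij.
Qed.

End Generations.

Section RootedTree.
Variables (r : word) (t : set word).
Hypothesis rt : rooted_tree r t.

Lemma rooted_words v : t v -> all (leq 1) v.
Proof. by case: rt => h _ _ _ _ /h. Qed.

Lemma rooted_root : t r. Proof. by case: rt. Qed.

Lemma rooted_size v : t v -> (size r <= size v)%N.
Proof.
by move=> tv; rewrite leqNgt; apply/negP => sv; case: rt => _ _ /(_ v sv).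
Qed.

Lemma nkidsP v i : t v -> (0 < i)%N -> t (rcons v i) <-> (i <= nkids t v)%N.
Proof.
move=> tv i0; case: rt => _ _ _ _ /(_ v tv) [k kP].
by rewrite (nkids_unique kP); exact: kP.
Qed.

Lemma rooted_parent v i : t (rcons v i) -> rcons v i <> r -> t v.
Proof. by case: rt => _ _ _ + _; exact. Qed.

Lemma rooted_letter v i : t (rcons v i) -> (0 < i)%N.
Proof. by move=> /rooted_words; rewrite all_rcons => /andP[]. Qed.

Lemma rooted_min v : t v -> size v = size r -> v = r.
Proof.
elim/last_ind: v => [|v i _] tv sv; first exact/esym/size0nil.
apply: contrapT => vr; have /rooted_size := rooted_parent tv vr.
by rewrite -sv size_rcons ltnn.
Qed.

Lemma mem_lev j v : v \in lev r t j <-> t v /\ size v = (size r + j)%N.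
Proof.
split=> [vj|[]].
  split; last exact: size_lev vj.
  elim: j v vj => [|j IH] v /=; first by rewrite inE => /eqP ->; exact: rooted_root.
  case/flattenP => s /mapP[w wj ->] /mapP[i].
  rewrite mem_iota add1n ltnS => /andP[i0 ik] ->.
  by apply/nkidsP => //; exact: IH.
elim: j v => [|j IH] v /= tv.
  by rewrite addn0 inE => /(rooted_min tv) ->.
elim/last_ind: v tv => [|v i _] tv; first by rewrite addnS.
rewrite size_rcons addnS => -[sv].
have vr : rcons v i <> r.
  by move=> /(congr1 size)/eqP; rewrite size_rcons sv -addnS -{2}[size r]addn0 eqn_add2l.
have tv' := rooted_parent tv vr; have i0 := rooted_letter tv.
apply/flattenP; exists [seq rcons v i | i <- iota 1 (nkids t v)].
  by apply/mapP; exists v => //; exact: IH.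
by apply/mapP; exists i => //; rewrite mem_iota add1n ltnS i0/=; apply/nkidsP.
Qed.

Lemma mem_upto j v : v \in upto r t j <-> t v /\ (size v < size r + j)%N.
Proof.
split=> [/mem_uptoP[i ij /mem_lev[tv ->]]|[tv vj]].
  by rewrite ltn_add2l.
have rv := rooted_size tv.
apply/mem_uptoP; exists (size v - size r)%N; first by rewrite ltn_subLR.
by apply/mem_lev; split => //; rewrite subnKC.
Qed.

Lemma restr_upto j : restr (size r + j) t = [set` upto r t j.+1].
Proof.
by apply/seteqP; split => v; have := mem_upto j.+1 v; rewrite addnS ltnS => -[].
Qed.

Lemma restr_finite n : finite_set (restr n t).
Proof.
apply: (@sub_finite_set _ _ [set` upto r t n.+1]); last exact: finite_seq.
move=> v [tv vn]; apply/(mem_upto n.+1 v); split=> //.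
by rewrite addnS ltnS (leq_trans vn)// leq_addl.
Qed.

Lemma gen_sizeE j : gen_size (size r + j) t = size (lev r t j).
Proof.
rewrite /gen_size (_ : [set u | _] = [set` [fset v in lev r t j]%fset]); last first.
  by apply/seteqP; split => v /=; rewrite inE/=; move/mem_lev.
by rewrite set_fsetK card_fseq undup_id// lev_uniq.
Qed.

End RootedTree.

Lemma nkids_restr n t v : (size v < n)%N -> nkids (restr n t) v = nkids t v.
Proof.
move=> vn; rewrite /nkids; congr xget; apply/seteqP; split=> k /= kP i i0.
  by rewrite -kP//; split => [tv|[]//]; split; rewrite // size_rcons.
by rewrite -kP//; split => [[]//|tv]; split; rewrite // size_rcons.
Qed.

Lemma restr_restr m n t : (m <= n)%N -> restr m (restr n t) = restr m t.
Proof.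
move=> mn; apply/seteqP; split => v /=; first by move=> [[]].
by move=> [tv vm]; split => //; split => //; exact: leq_trans mn.
Qed.

Lemma restr_le m n (s t : set word) : (m <= n)%N -> restr n s = restr n t ->
  restr m s = restr m t.
Proof. by move=> mn st; rewrite -(restr_restr s mn) st restr_restr. Qed.

Lemma eq_nkids n (s t : set word) v : restr n s = restr n t -> (size v < n)%N ->
  nkids s v = nkids t v.
Proof. by move=> st vn; rewrite -(nkids_restr s vn) st nkids_restr. Qed.

Lemma eq_lev r n (s t : set word) j : restr n s = restr n t -> (size r + j <= n)%N ->
  lev r s j = lev r t j.
Proof.
move=> st; elim: j => //= j IH jn; rewrite IH; last first.
  by rewrite (leq_trans _ jn)// leq_add2l.
congr flatten; apply/eq_in_map => v /size_lev sv.
by rewrite (eq_nkids st)// sv -addnS.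
Qed.

Lemma eq_upto r n (s t : set word) j : restr n s = restr n t -> (size r + j <= n.+1)%N ->
  upto r s j = upto r t j.
Proof.
move=> st; elim: j => //= j IH jn; rewrite IH; last first.
  by rewrite (leq_trans _ jn)// leq_add2l.
by rewrite (eq_lev st)// -ltnS -addnS.
Qed.

Lemma eq_gen_size n (s t : set word) : restr n s = restr n t -> gen_size n s = gen_size n t.
Proof.
move=> st; rewrite /gen_size; congr (#|` fset_set _|)%fset.
have H (x : set word) u : (x u /\ size u = n) <-> (restr n x u /\ size u = n).
  by split => [[xu un]|[[xu _] un]]; split => //; split => //; rewrite un.
apply/seteqP; split => u /= /H[xu un]; apply/H; split => //.
  by rewrite -st.
by rewrite st.
Qed.

(** * The sigma-field of trees *)

(** The form in which membership in the sigma-field is used: an event of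
    [filtr n] does not see beyond generation [n]. *)
Lemma filtrP n (A : set tree) :
  filtr n A <-> (forall x y : tree, restr n x = restr n y -> A x -> A y).
Proof.
split=> [[B _ <-] x y xy [_ /= Bx]|hA].
  by split => //=; rewrite -xy.
exists [set restr n x | x in A] => //; apply/seteqP; split => x /=.
  by move=> [_ [y Ay yx]]; exact: hA yx Ay.
by move=> Ax; split => //; exists x.
Qed.

Lemma filtr_le m n (A : set tree) : (m <= n)%N -> filtr m A -> filtr n A.
Proof. by move=> mn /filtrP hA; apply/filtrP => x y /(restr_le mn); exact: hA. Qed.

Lemma filtr_measurable n (A : set tree) : filtr n A -> measurable A.
Proof. by move=> nA; apply: sub_sigma_algebra; exists n. Qed.

Lemma filtrI n A B : filtr n A -> filtr n B -> filtr n (A `&` B).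
Proof.
move=> /filtrP hA /filtrP hB; apply/filtrP => x y xy [/(hA _ _ xy) ? /(hB _ _ xy) ?] //.
Qed.

Lemma filtrT n : filtr n setT.
Proof. by apply/filtrP. Qed.

Lemma cylindersI : setI_closed cylinders.
Proof.
move=> A B [m _ mA] [n _ nB]; exists (maxn m n) => //; apply: filtrI.
- by apply: filtr_le mA; rewrite leq_maxl.
- by apply: filtr_le nB; rewrite leq_maxr.
Qed.

Lemma filtr_measurable_fun n d (T : measurableType d) (g : tree -> T) :
  (forall x y : tree, restr n x = restr n y -> g x = g y) ->
  measurable_fun setT g.
Proof.
move=> gn _ B mB; rewrite setTI; apply: (@filtr_measurable n).
by apply/filtrP => x y /gn; rewrite /preimage /= => ->.
Qed.

Lemma tree_rooted (x : tree) : exists u, rooted_tree u x.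
Proof. by case: x. Qed.

Lemma tree_restr_finite n (x : tree) : finite_set (restr n x).
Proof. by have [u ux] := tree_rooted x; exact: (restr_finite ux n). Qed.

Definition atom n (x0 : tree) : set tree := [set x | restr n x = restr n x0].

Lemma atom_filtr n x0 : filtr n (atom n x0).
Proof. by apply/filtrP => x y xy; rewrite /atom/= -xy. Qed.

Lemma measurable_atom n x0 : measurable (atom n x0).
Proof. exact: filtr_measurable (atom_filtr n x0). Qed.

(** A tree restricted to finitely many generations is a finite set of words,
    hence can be numbered: [Lambda] splits into countably many atoms. *)
Definition code n (x : tree) : nat := @choice.pickle (seq (seq nat) : countType) (fset_set (restr n x)).

Lemma code_eq n (x y : tree) : code n x = code n y -> restr n x = restr n y.
Proof.
by move=> /(pcan_inj choice.pickleK) /val_inj /fset_set_inj; apply; exact: tree_restr_finite.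
Qed.

Lemma filtr_bigcup n (A : set tree) :
  A = \bigcup_i (A `&` [set x | code n x = i]).
Proof.
by apply/seteqP; split => x; [move=> Ax; exists (code n x)|move=> [i _ []]].
Qed.

Lemma filtr_code n i : filtr n [set x | code n x = i].
Proof. by apply/filtrP => x y xy; rewrite /code /= xy. Qed.

Lemma code_atom n (A : set tree) i : filtr n A ->
  (exists x0, A x0 /\ A `&` [set x | code n x = i] = atom n x0) \/
  A `&` [set x | code n x = i] = set0.
Proof.
move=> /filtrP hA; have [->|/set0P[x0 [Ax0 /= x0i]]] := eqVneq (A `&` [set x | code n x = i]) set0.
  by right.
left; exists x0; split => //; apply/seteqP; split => x.
  by move=> [Ax /= xi]; apply: code_eq; rewrite xi x0i.
rewrite /atom/= => xx0; split; first exact: hA (esym xx0) Ax0.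
by rewrite /= /code xx0 -x0i.
Qed.

Section FiltrIntegral.
Context {R : realType}.
Local Open Scope ereal_scope.

Lemma filtr_integral_sum (m : probability tree R) n (A : set tree) (g : tree -> \bar R) :
  filtr n A -> measurable_fun setT g -> (forall x, 0 <= g x) ->
  \int[m]_(x in A) g x =
  \sum_(i <oo) \int[m]_(x in A `&` [set x | code n x = i]) g x.
Proof.
move=> nA mg g0; rewrite {1}(filtr_bigcup n A) ge0_integral_bigcup//.
- move=> i; apply: filtr_measurable; apply: filtrI nA (filtr_code n i).
- exact: measurable_funTS.
- by apply/trivIsetP => i j _ _ ij; apply/seteqP; split => x //= [[_ xi] [_ xj]];
    move/eqP: ij; rewrite -xi xj.
Qed.

(** As the atoms are countably many, laws and densities need only be compared on
    atoms, where they are finite products. *)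
Lemma eq_filtr_integral (m m' : probability tree R) n (A : set tree)
    (g g' : tree -> \bar R) :
  filtr n A -> measurable_fun setT g -> (forall x, 0 <= g x) ->
  measurable_fun setT g' -> (forall x, 0 <= g' x) ->
  (forall x0, A x0 -> \int[m]_(x in atom n x0) g x = \int[m']_(x in atom n x0) g' x) ->
  \int[m]_(x in A) g x = \int[m']_(x in A) g' x.
Proof.
move=> nA mg g0 mg' g'0 gg'; rewrite !(filtr_integral_sum _ nA)//.
apply: eq_eseriesr => i _.
by have [[x0 [Ax0 ->]]|->] := code_atom i nA; rewrite ?gg'// !integral_set0.
Qed.

Lemma atom_integral (m : probability tree R) n (x0 : tree) (g : tree -> \bar R) :
  (forall x : tree, atom n x0 x -> g x = g x0) ->
  \int[m]_(x in atom n x0) g x = g x0 * m (atom n x0).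
Proof.
move=> gn; rewrite -integral_cst; last exact: measurable_atom.
by apply: eq_integral => x; rewrite inE => /(gn x).
Qed.

End FiltrIntegral.

(** * Probabilities of the atoms of a Galton-Watson tree *)

Section Extension.
Variables (r : word).
Hypothesis r_word : all (leq 1) r.

Lemma rooted_restr t n : rooted_tree r t -> (size r <= n)%N -> rooted_tree r (restr n t).
Proof.
move=> rt rn; split.
- by move=> v [/(rooted_words rt)].
- by split => //; exact: rooted_root rt.
- by move=> v vr [/(rooted_size rt)]; rewrite leqNgt vr.
- move=> v i [tvi]; rewrite size_rcons => vn /(rooted_parent rt tvi) tv.
  by split => //; exact: ltnW.
move=> v [tv vn]; have [vn'|nv] := ltnP (size v) n.
  exists (nkids t v) => i i0; rewrite -(nkidsP rt tv i0).
  by split => [[]//|tvi]; split => //; rewrite size_rcons.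
exists 0%N => i i0; split => [[_]|]; last by rewrite leqNgt i0.
by rewrite size_rcons ltnNge nv.
Qed.

Definition tree_of t (rt : rooted_tree r t) : tree :=
  Tree (ex_intro (fun u => rooted_tree u t) r rt).

(** The law of one more generation is a sum over all the families that the nodes
    of generation [n] can have, so each of them has to be exhibited as a tree. *)
Lemma rooted_extension t n (kap : word -> nat) : rooted_tree r t -> (size r <= n)%N ->
  exists t', [/\ rooted_tree r t', restr n t' = restr n t &
    forall v, t v -> size v = n -> nkids t' v = kap v].
Proof.
move=> rt rn.
pose t' := [set w | (t w /\ (size w <= n)%N) \/
  exists v i, [/\ w = rcons v i, t v, size v = n & (0 < i <= kap v)%N]].
have t'n w : t' w -> (size w <= n)%N -> t w.
  by move=> [[]//|[v [i [-> _ vn _]]]]; rewrite size_rcons vn ltnn.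
have kids v : t v -> size v = n -> forall i, (0 < i)%N -> (t' (rcons v i) <-> (i <= kap v)%N).
  move=> tv vn i i0; split => [[[_]|[w [a [/rcons_inj[<- <-] _ _ /andP[]//]]]]|ik].
    by rewrite size_rcons vn ltnn.
  by right; exists v, i; rewrite i0.
exists t'; split; last by move=> v tv vn; apply: nkids_unique; exact: kids.
- split.
  + move=> v [[/(rooted_words rt)]//|[w [i [-> /(rooted_words rt) aw _ /andP[i0 _]]]]].
    by rewrite /words/= all_rcons i0.
  + by left; split => //; exact: rooted_root rt.
  + move=> v vr [[/(rooted_size rt)]|]; first by rewrite leqNgt vr.
    move=> [w [i [wE tw _ _]]]; have := rooted_size rt tw.
    by move: vr; rewrite wE size_rcons => /ltnW; rewrite ltnNge => /negbTE ->.
  + move=> v i [[tvi vn]|[w [a [/rcons_inj[<- <-] tv vn _]]]] vr.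
      rewrite size_rcons in vn; left; split; last exact: ltnW.
      exact: rooted_parent tvi vr.
    by left; split => //; rewrite vn.
  + move=> v t'v; have [vn|vn|vn] := ltngtP (size v) n.
    * have tv := t'n _ t'v (ltnW vn).
      exists (nkids t v) => i i0; rewrite -(nkidsP rt tv i0); split.
        by move=> /t'n; apply; rewrite size_rcons.
      by move=> tvi; left; rewrite size_rcons.
    * exists 0%N => i i0; rewrite leqNgt i0; split => // -[[_]|].
        by rewrite size_rcons ltnNge ltnW.
      by move=> [w [a [/rcons_inj[<- _] _ wn]]]; rewrite wn ltnn in vn.
    * exists (kap v); by apply: (kids v _ vn); apply: (t'n _ t'v); rewrite vn.
- apply/seteqP; split => v; first by move=> [/t'n h vn]; split => //; exact: h.
  by move=> [tv vn]; split => //; left.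
Qed.

Lemma rooted_singleton : rooted_tree r [set r].
Proof.
split => //.
- by move=> v /= ->.
- by move=> v /= vr vE; rewrite vE ltnn in vr.
- by move=> v /= ->; exists 0%N => i i0; split;
    [move=> /(congr1 size)/eqP; rewrite size_rcons gtn_eqF|rewrite leqNgt i0].
Qed.

End Extension.

Lemma size_ones k : size (ones k) = k. Proof. exact: size_nseq. Qed.

Lemma ones_word k : all (leq 1) (ones k).
Proof. by rewrite all_nseq orbT. Qed.

Lemma rooted_filtr k : filtr k [set x : tree | rooted_tree (ones k) x].
Proof.
apply/filtrP => x y xy /= rx; have [u ru] := tree_rooted y.
suff -> : ones k = u by [].
have xk := rooted_root rx.
have [yk _] : restr k y (ones k) by rewrite -xy; split => //; rewrite size_ones.
have uk : (size u <= k)%N by rewrite -(size_ones k); exact: (rooted_size ru yk).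
have [xu _] : restr k x u by rewrite xy; split => //; exact: rooted_root ru.
apply/esym/(rooted_min rx xu)/eqP; rewrite eqn_leq size_ones uk/=.
by have := rooted_size rx xu; rewrite size_ones.
Qed.

Section GaltonWatsonAtoms.
Context {R : realType}.
Variables (q : nat -> R) (k : nat) (P : probability tree R).
Hypotheses (q_dist : is_distribution q) (hP : GW_law q k P).

Lemma GW_atom_lt j (x0 : tree) : rooted_tree (ones k) x0 -> (0 < j)%N ->
  P (atom (k + j) x0) = (\prod_(v <- upto (ones k) x0 j) q (nkids x0 v))%:E.
Proof.
move=> rx j0; have kj : (k < k + j)%N by rewrite -addn1 leq_add2l.
have := hP kj (rooted_restr (n := k + j) rx _); rewrite size_ones leq_addr => /(_ isT).
rewrite /atom => ->; last by move=> v [].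
have -> : restr (k + j).-1 (restr (k + j) x0) = [set` upto (ones k) x0 j].
  rewrite restr_restr ?leq_pred// -(prednK j0) addnS/=.
  by have := restr_upto rx j.-1; rewrite size_ones.
rewrite -fsbig_seq ?upto_uniq//; congr EFin; apply: eq_big_seq => v /(mem_upto rx)[_ vj].
by rewrite nkids_restr//; rewrite size_ones in vj.
Qed.

(** The law is given on trees rooted at [ones k] only; the root having some
    number [i] of children has total probability [\sum_i q i = 1], which leaves
    nothing for the other trees. *)
Lemma GW_rooted : P [set x : tree | rooted_tree (ones k) x] = 1%E.
Proof.
have ex i : exists x : tree, rooted_tree (ones k) x /\ nkids x (ones k) = i.
  have [t' [rt' _ kt']] := rooted_extension (n := k) (fun=> i)
    (rooted_singleton (ones_word k)) (eq_leq (size_ones k)).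
  exists (tree_of rt'); split => //.
  by apply: kt' => //; rewrite size_ones.
have [x xP] := choice ex.
have PE i : P (atom (k + 1) (x i)) = (q i)%:E.
  by rewrite GW_atom_lt//= ?big_seq1; case: (xP i) => // _ ->.
apply/eqP; rewrite eq_le; apply/andP; split.
  by apply: probability_le1; exact: filtr_measurable (rooted_filtr k).
have mE i : measurable (atom (k + 1) (x i)) by exact: measurable_atom.
have tE : trivIset setT (fun i => atom (k + 1) (x i)).
  apply/trivIsetP => i j _ _ ij; apply/seteqP; split => // y [yi yj].
  move/eqP: ij; apply; case: (xP i) => _ <-; case: (xP j) => _ <-.
  by apply: (eq_nkids (etrans (esym yi) yj)); rewrite size_ones addn1.
rewrite -q_dist.2 (eq_eseriesr (fun i _ => esym (PE i))) -measure_semi_bigcup//; last first.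
  exact: bigcup_measurable.
apply: le_measure; rewrite ?inE.
- exact: bigcup_measurable.
- exact: filtr_measurable (rooted_filtr k).
- move=> y [i _ yi]; have [rx _] := xP i.
  have /filtrP := filtr_le (leq_addr 1 k) (rooted_filtr k).
  by apply; [exact: (esym yi)|].
Qed.

Lemma GW_notrooted n (x0 : tree) : (k <= n)%N -> ~ rooted_tree (ones k) x0 ->
  P (atom n x0) = 0%E.
Proof.
move=> kn nr; have mr := filtr_measurable (rooted_filtr k).
apply: (@subset_measure0 _ _ _ P _ (~` [set x : tree | rooted_tree (ones k) x])).
- exact: measurable_atom.
- exact: measurableC.
- move=> x xx0 rx; apply: nr; have /filtrP := filtr_le kn (rooted_filtr k).
  by apply; first exact: xx0.
- by apply: etrans (probability_setC P mr) _; rewrite GW_rooted subee.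
Qed.

Lemma GW_atom j (x0 : tree) : rooted_tree (ones k) x0 ->
  P (atom (k + j) x0) = (\prod_(v <- upto (ones k) x0 j) q (nkids x0 v))%:E.
Proof.
move=> rx; case: j => [|j]; last exact: GW_atom_lt.
rewrite big_nil addn0; apply/eqP; rewrite eq_le; apply/andP; split.
  by apply: probability_le1; exact: measurable_atom.
rewrite -GW_rooted; apply: le_measure; rewrite ?inE.
- exact: filtr_measurable (rooted_filtr k).
- exact: measurable_atom.
- have restr1 (x : tree) : rooted_tree (ones k) x -> restr k x = [set ones k].
    move=> {}rx; have := restr_upto rx 0.
    rewrite addn0 size_ones => ->; apply/seteqP.
    by split => v /=; rewrite inE => /eqP.
  by move=> x /restr1 xk; rewrite /atom/= xk restr1.
Qed.

End GaltonWatsonAtoms.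

(** * The Markov property of the generation sizes *)

Section Step.
Context {R : realType}.
Variables (q : nat -> R) (k : nat) (P : probability tree R).
Hypotheses (q_dist : is_distribution q) (hP : GW_law q k P).
Local Open Scope ereal_scope.

(** [offspring_mean x F y] is the mean of [F (y + S)], where [S] is the sum of
    [x] independent variables with law [q]. *)
Fixpoint offspring_mean (x : nat) (F : nat -> \bar R) (y : nat) : \bar R :=
  if x is x'.+1 then \sum_(i <oo) (q i)%:E * offspring_mean x' F (y + i) else F y.

Lemma offspring_mean_ge0 x F y : (forall z, 0 <= F z) -> 0 <= offspring_mean x F y.
Proof.
move=> F0; elim: x y => [|x IH] y //=; apply: nneseries_ge0 => i _ _.
by rewrite mule_ge0// lee_fin q_dist.1.
Qed.

Lemma gen_size_mfun n (g : nat -> \bar R) :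
  measurable_fun setT (fun x : tree => g (gen_size n x)).
Proof. by apply: (@filtr_measurable_fun n) => x y /eq_gen_size ->. Qed.

Lemma restr_succ (x y : tree) j : rooted_tree (ones k) y ->
  restr (k + j) x = restr (k + j) y ->
  {in lev (ones k) y j, forall v, nkids x v = nkids y v} ->
  restr (k + j).+1 x = restr (k + j).+1 y.
Proof.
move=> ry xy kids.
have rx : rooted_tree (ones k) x.
  have /filtrP := filtr_le (leq_addr j k) (rooted_filtr k).
  by apply; [exact: (esym xy)|].
have := restr_upto rx j.+1; have := restr_upto ry j.+1.
rewrite !size_ones !addnS => -> ->.
suff -> : upto (ones k) x j.+2 = upto (ones k) y j.+2 by [].
have ll : lev (ones k) x j = lev (ones k) y j by apply: (eq_lev xy); rewrite size_ones.
rewrite /= ll; congr (_ ++ flatten _); last by apply/eq_in_map => v /kids ->.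
by rewrite (eq_upto xy)// size_ones.
Qed.

Lemma gen_size_succ (x : tree) j : rooted_tree (ones k) x ->
  gen_size (k + j).+1 x = (\sum_(v <- lev (ones k) x j) nkids x v)%N.
Proof.
move=> rx; have := gen_sizeE rx j.+1; rewrite size_ones addnS => ->.
rewrite /= size_flatten sumnE !big_map; apply: eq_bigr => v _.
by rewrite size_map size_iota.
Qed.

(** The children of the nodes of one generation are revealed one node after the
    other: [l1] lists the nodes already processed, [l2] those to come. *)
Lemma GW_step_leaves j (x0 : tree) (F : nat -> \bar R) : (forall z, 0 <= F z) ->
  rooted_tree (ones k) x0 ->
  forall l2 l1 (kap : word -> nat), lev (ones k) x0 j = l1 ++ l2 ->
  \int[P]_(x in atom (k + j) x0 `&` [set x | {in l1, forall v, nkids x v = kap v}])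
     F (gen_size (k + j).+1 x) =
  P (atom (k + j) x0) * (\prod_(v <- l1) q (kap v))%:E
    * offspring_mean (size l2) F (\sum_(v <- l1) kap v).
Proof.
move=> F0 rx0; elim=> [|v l2 IH] l1 kap lE.
  rewrite cats0 in lE; subst l1.
  have kj : (size (ones k) <= k + j)%N by rewrite size_ones leq_addr.
  have [t' [rt' tx0 kt']] := rooted_extension kap rx0 kj.
  pose x1 := tree_of rt'; have rx1 : rooted_tree (ones k) x1 := rt'.
  have x01 : restr (k + j) x0 = restr (k + j) x1 by rewrite tx0.
  have kx1 : {in lev (ones k) x0 j, forall v, nkids x1 v = kap v}.
    by move=> v /(mem_lev rx0)[x0v vj]; apply: kt' => //; rewrite vj size_ones.
  have l01 : lev (ones k) x0 j = lev (ones k) x1 j.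
    by apply: (eq_lev x01); rewrite size_ones.
  have -> : atom (k + j) x0 `&` [set x : tree | {in lev (ones k) x0 j, forall v, nkids x v = kap v}]
      = atom (k + j).+1 x1.
    apply/seteqP; split => x.
      move=> [xx0 xk]; apply: restr_succ => //; first by rewrite -x01.
      by rewrite -l01 => v vl; rewrite kx1// xk.
    move=> xx1; split; first by rewrite /atom/= x01; exact: restr_le xx1.
    move=> v vl; rewrite -kx1//; apply: (eq_nkids xx1).
    by have := size_lev vl; rewrite size_ones => ->.
  rewrite atom_integral; last by move=> x /eq_gen_size ->.
  rewrite gen_size_succ// -l01 -addnS (GW_atom q_dist hP)// (GW_atom q_dist hP)// -EFinM [in RHS]muleC /=.
  congr (F _ * _%:E); first by apply: eq_big_seq => v /kx1.
  rewrite big_cat/= -l01 -(eq_upto x01); last by rewrite size_ones.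
  congr (_ * _)%R; last by apply: eq_big_seq => v /kx1 ->.
  apply: eq_big_seq => v /(mem_upto rx0)[_]; rewrite size_ones => vk.
  by rewrite -(eq_nkids x01).
have vl1 : v \notin l1.
  have := lev_uniq (ones k) x0 j; rewrite lE -cat_rcons cat_uniq rcons_uniq.
  by case/andP => /andP[].
pose kap' i := fun w => if w == v then i else kap w.
have kap'E i : {in l1, kap' i =1 kap}.
  by move=> w wl1; rewrite /kap'; case: eqP => // wv; rewrite -wv wl1 in vl1.
pose A i := atom (k + j) x0 `&` [set x : tree | {in rcons l1 v, forall v, nkids x v = kap' i v}].
have AE : atom (k + j) x0 `&` [set x : tree | {in l1, forall v, nkids x v = kap v}] = \bigcup_i A i.
  apply/seteqP; split => x.
    move=> [xx0 xk]; exists (nkids x v) => //; split => // w.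
    rewrite mem_rcons inE => /predU1P[->|wl1]; first by rewrite /kap' eqxx.
    by rewrite kap'E// xk.
  move=> [i _ [xx0 xk]]; split => // w wl1.
  by rewrite xk ?kap'E// mem_rcons inE wl1 orbT.
have mA i : measurable (A i).
  apply: (@filtr_measurable (k + j).+1); apply/filtrP => x y xy [xx0 xk]; split.
    rewrite /atom /= -xx0; apply/esym; exact: restr_le xy.
  move=> w wl; rewrite -xk//; apply/esym; apply: (eq_nkids xy).
  have : w \in lev (ones k) x0 j by rewrite lE -cat_rcons mem_cat wl.
  by move/size_lev; rewrite size_ones => ->.
rewrite AE ge0_integral_bigcup//; last 2 first.
- by apply: measurable_funTS; exact: (gen_size_mfun _ F).
- apply/trivIsetP => i i' _ _ ii'; apply/seteqP; split => x // [[_ xi] [_ xi']].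
  move/eqP: ii'; apply; have vl : v \in rcons l1 v by rewrite mem_rcons inE eqxx.
  by have := xi v vl; rewrite (xi' v vl) /kap' eqxx.
rewrite (GW_atom q_dist hP)// -EFinM -nneseriesZl; last first.
  by move=> i _; rewrite mule_ge0// ?lee_fin ?q_dist.1// offspring_mean_ge0.
apply: eq_eseriesr => i _; rewrite IH ?cat_rcons// (GW_atom q_dist hP)// -EFinM.
have kv : kap' i v = i by rewrite /kap' eqxx.
rewrite -!cats1 !big_cat/= !big_seq1 kv.
have -> : (\prod_(w <- l1) q (kap' i w) = \prod_(w <- l1) q (kap w))%R.
  by apply: eq_big_seq => w wl; rewrite (kap'E i w wl).
have -> : (\sum_(w <- l1) kap' i w = \sum_(w <- l1) kap w)%N.
  by apply: eq_big_seq => w wl; rewrite (kap'E i w wl).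
by rewrite mulrA [X in X * _ = _]EFinM -muleA.
Qed.

(** On an atom of generation [h] the size of that generation is a constant, and
    the families of its nodes are revealed by [GW_step_leaves]. *)
Lemma GW_step h (A : set tree) (F : nat -> \bar R) : (forall z, 0 <= F z) ->
  (k <= h)%N -> filtr h A ->
  \int[P]_(x in A) F (gen_size h.+1 x) =
  \int[P]_(x in A) offspring_mean (gen_size h x) F 0.
Proof.
move=> F0 kh hA; apply: (eq_filtr_integral hA).
- by apply: (gen_size_mfun _ F).
- by [].
- by apply: (gen_size_mfun _ (fun z => offspring_mean z F 0)).
- by move=> x; exact: offspring_mean_ge0.
move=> x0 _; have [rx0|nr] := pselect (rooted_tree (ones k) x0); last first.
  have mF := measurable_funTS (gen_size_mfun h.+1 F).
  have mG := measurable_funTS (gen_size_mfun h (fun z => offspring_mean z F 0)).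
  have A0 := GW_notrooted q_dist hP kh nr.
  by apply: etrans (null_set_integral _ (mF _) A0) (esym (null_set_integral _ (mG _) A0));
    exact: measurable_atom.
rewrite -(subnKC kh); set j := (h - k)%N.
have := GW_step_leaves F0 rx0 (j := j) (l2 := lev (ones k) x0 j) (l1 := [::]) (fun=> 0%N) erefl.
rewrite !big_nil mule1 [X in _ `&` X](_ : _ = setT) ?setIT => [->|]; last first.
  by apply/seteqP; split.
rewrite atom_integral; last by move=> x /eq_gen_size ->.
by have := gen_sizeE rx0 j; rewrite size_ones muleC => ->.
Qed.

End Step.

(** * Coefficients of powers of a polynomial *)

Section CoefExp.
Variable R : comNzRingType.
Implicit Types A B : {poly R}.

Lemma eq_coefM p A A' B B' : (forall l, (l <= p)%N -> A`_l = A'`_l) ->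
  (forall l, (l <= p)%N -> B`_l = B'`_l) ->
  forall l, (l <= p)%N -> (A * B)`_l = (A' * B')`_l.
Proof.
move=> AA' BB' l lp; rewrite !coefM; apply: eq_bigr => i _.
by rewrite AA' ?BB'// (leq_trans _ lp)// ?leq_subr// -ltnS.
Qed.

Lemma eq_coef_exp p A B x : (forall l, (l <= p)%N -> A`_l = B`_l) ->
  forall l, (l <= p)%N -> (A ^+ x)`_l = (B ^+ x)`_l.
Proof.
move=> AB; elim: x => [//|x IH] l lp.
by rewrite !exprS; apply: (eq_coefM AB IH).
Qed.

Lemma coef_exp_scale p c A B x : (forall l, (l <= p)%N -> B`_l = c ^+ l * A`_l) ->
  forall l, (l <= p)%N -> (B ^+ x)`_l = c ^+ l * (A ^+ x)`_l.
Proof.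
move=> AB; elim: x => [|x IH] l lp.
  by rewrite !expr0 coef1; case: l lp => [|l] lp; rewrite ?expr0 ?mulr1// !mulr0.
rewrite !exprS !coefM mulr_sumr; apply: eq_bigr => -[i] /=; rewrite ltnS => il _.
rewrite AB ?IH ?(leq_trans _ lp) ?leq_subr// mulrACA -exprD subnKC//.
Qed.

Lemma coef_expXn0 B i l : B`_0 = 0 -> (l < i)%N -> (B ^+ i)`_l = 0.
Proof.
move=> B0; elim: i l => // i IH l li; rewrite exprS coefM big1// => -[[|j]] /= jl _.
  by rewrite B0 mul0r.
rewrite IH ?mulr0//; move: li jl; rewrite !ltnS => li jl.
by rewrite (leq_trans _ li)// ltn_subrL (leq_ltn_trans _ jl).
Qed.

Lemma sum_ord_tail n m (F : nat -> R) : (n <= m)%N -> (forall i, (n <= i)%N -> F i = 0) ->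
  \sum_(i < m) F i = \sum_(i < n) F i.
Proof.
move=> nm F0; rewrite (big_ord_widen m F nm) [RHS]big_mkcond; apply: eq_bigr => i _.
by case: ltnP => // /F0.
Qed.

(** The constant coefficient is set apart because the powers of the rest have no
    coefficient of low index: only finitely many terms remain. *)
Lemma coef_exp_binomial A x l :
  (A ^+ x)`_l = \sum_(i < l.+1) 'C(x, i)%:R * A`_0 ^+ (x - i) * ((A - (A`_0)%:P) ^+ i)`_l.
Proof.
set B := A - _; have B0 : B`_0 = 0 by rewrite coefB coefC subrr.
rewrite -{1}(subrK (A`_0)%:P A) -/B addrC exprDn coef_sum.
pose F i := 'C(x, i)%:R * A`_0 ^+ (x - i) * (B ^+ i)`_l.
rewrite (eq_bigr (fun i : 'I_ _ => F i)); last first.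
  by move=> i _; rewrite -polyC_exp mul_polyC coefMn coefZ /F -mulrA mulr_natl.
rewrite -(@sum_ord_tail _ (x + l).+1) ?ltnS ?leq_addr//; last first.
  by move=> i xi; rewrite /F bin_small// mul0r mul0r.
rewrite -[RHS](@sum_ord_tail _ (x + l).+1 F) ?ltnS ?leq_addl// => i li.
by rewrite /F coef_expXn0// mulr0.
Qed.

(** Choosing one monomial in each factor. The indices are bounded by [p] to make
    the index set finite. *)
Lemma coef_exp_ffun p A i l : (l <= p)%N ->
  (A ^+ i)`_l = \sum_(s : {ffun 'I_i -> 'I_p.+1} | (\sum_r s r)%N == l) \prod_r A`_(s r).
Proof.
move=> lp.
have -> : (A ^+ i)`_l = ((\poly_(j < p.+1) A`_j) ^+ i)`_l.
  by apply: (@eq_coef_exp p) => // j jp; rewrite coef_poly ltnS jp.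
rewrite poly_def -[in LHS](card_ord i) -prodr_const bigA_distr_bigA coef_sum.
rewrite [RHS]big_mkcond; apply: eq_bigr => s _.
rewrite (eq_bigr (fun r => (A`_(s r))%:P * 'X^(s r))); last by move=> r _; rewrite mul_polyC.
rewrite big_split/= -rmorph_prod/= mul_polyC coefZ.
have -> : \prod_(r < i) 'X^(s r) = 'X^(\sum_r s r) :> {poly R}.
  by rewrite -(big_morph (fun k => 'X^k : {poly R}) (exprD _) (expr0 _)).
by rewrite coefXn eq_sym; case: eqP => _; rewrite ?mulr1 ?mulr0.
Qed.

(** The weights of order up to [p] are thus the coefficients of powers of a
    single jet, and a single recursion handles all of them. *)
Lemma coef_exp_affine (s : R) z l : ((s *: (1 + 'X)) ^+ z)`_l = 'C(z, l)%:R * s ^+ z.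
Proof.
rewrite exprZn coefZ addrC exprD1n coef_sum mulrC; congr (_ * _).
have [lz|zl] := leqP l z.
  rewrite (bigD1 (inord l))//= big1 ?addr0 => [|i].
    by rewrite inordK// coefMn coefXn eqxx.
  rewrite -val_eqE/= inordK// coefMn coefXn eq_sym => /negbTE ->.
  by rewrite mul0rn.
rewrite bin_small// big1// => i _; rewrite coefMn coefXn gtn_eqF ?mul0rn//.
by rewrite (leq_trans (ltn_ord i)).
Qed.

End CoefExp.

Section CoefExpOrder.
Variable R : numDomainType.
Implicit Types A B : {poly R}.

Definition poly_nneg A := forall l, 0 <= A`_l.

Lemma poly_nnegM A B : poly_nneg A -> poly_nneg B -> poly_nneg (A * B).
Proof. by move=> A0 B0 l; rewrite coefM sumr_ge0// => i _; rewrite mulr_ge0. Qed.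

Lemma poly_nnegX A x : poly_nneg A -> poly_nneg (A ^+ x).
Proof.
move=> A0; elim: x => [|x IH]; last by rewrite exprS; exact: poly_nnegM.
by move=> l; rewrite expr0 coef1 ler0n.
Qed.

Lemma le_coef_exp p A B x : poly_nneg A -> poly_nneg B ->
  (forall l, (l <= p)%N -> A`_l <= B`_l) ->
  forall l, (l <= p)%N -> (A ^+ x)`_l <= (B ^+ x)`_l.
Proof.
move=> A0 B0 AB; elim: x => [//|x IH] l lp; rewrite !exprS !coefM.
apply: ler_sum => -[i]/=; rewrite ltnS => il _.
rewrite ler_pM ?AB ?IH ?(leq_trans _ lp) ?leq_subr//; exact: poly_nnegX.
Qed.

Lemma horner_nneg A c : poly_nneg A -> 0 <= c -> 0 <= A.[c].
Proof.
by move=> A0 c0; rewrite horner_coef sumr_ge0// => i _; rewrite mulr_ge0// exprn_ge0.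
Qed.

Lemma sum_coef_le_horner A c n : poly_nneg A -> 0 <= c ->
  \sum_(l < n) A`_l * c ^+ l <= A.[c].
Proof.
move=> A0 c0; rewrite (@horner_coef_wide _ (maxn n (size A))) ?leq_maxr//.
rewrite (big_ord_widen (maxn n (size A)) (fun l => A`_l * c ^+ l)) ?leq_maxl//.
rewrite [leRHS](bigID (fun i : 'I_ _ => (i < n)%N))/= lerDl sumr_ge0// => i _.
by rewrite mulr_ge0// exprn_ge0.
Qed.

End CoefExpOrder.

Lemma cvg_sum (R : realType) I (r : seq I) (P : pred I) (f : I -> nat -> R) (l : I -> R) :
  (forall i, P i -> f i m @[m --> \oo] --> l i) ->
  \sum_(i <- r | P i) f i m @[m --> \oo] --> \sum_(i <- r | P i) l i.
Proof.
move=> fl; elim: r => [|i r IH].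
  by under eq_fun do rewrite big_nil; rewrite big_nil; exact: cvg_cst.
under eq_fun do rewrite big_cons; rewrite big_cons; case: ifP => // Pi.
by apply: cvgD => //; exact: fl.
Qed.

Lemma cvg_coef_exp (R : realType) p (A : nat -> {poly R}) (B : {poly R}) x :
  (forall l, (l <= p)%N -> (A m)`_l @[m --> \oo] --> B`_l) ->
  forall l, (l <= p)%N -> ((A m) ^+ x)`_l @[m --> \oo] --> (B ^+ x)`_l.
Proof.
move=> AB; elim: x => [|x IH] l lp.
  by under eq_fun do rewrite expr0; rewrite expr0; exact: cvg_cst.
under eq_fun do rewrite exprS coefM; rewrite exprS coefM.
apply: cvg_sum => -[i]/=; rewrite ltnS => il _; apply: cvgM.
  by apply: AB; exact: leq_trans lp.
by apply: IH; rewrite (leq_trans _ lp)// leq_subr.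
Qed.

(** * Composition with the offspring generating function *)

Lemma nneseries_sum_EFin (R : realType) n (f : nat -> nat -> R) :
  (forall i j, 0 <= f i j) ->
  (\sum_(i < n) \sum_(j <oo) (f i j)%:E = \sum_(j <oo) (\sum_(i < n) f i j)%:E)%E.
Proof.
move=> f0; rewrite -nneseries_sum; last by move=> i j _; rewrite lee_fin.
by apply: eq_eseriesr => j _; exact: sumEFin.
Qed.

Section GenfunJet.
Context {R : realType}.
Variables (q : nat -> R) (p : nat).
Hypothesis q0 : forall n, 0 <= q n.
Implicit Types D : {poly R}.

Definition jet_series D l : \bar R := (\sum_(j <oo) (q j * (D ^+ j)`_l)%:E)%E.

(** The jet of order [p] of [f \o D], for [f] the generating function of [q]. *)
Definition genfun_jet D : {poly R} := \poly_(l < p.+1) fine (jet_series D l).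

Definition jet_ok D := poly_nneg D /\ forall l, (l <= p)%N -> (jet_series D l < +oo)%E.

Lemma jet_series_ge0 D l : poly_nneg D -> (0 <= jet_series D l)%E.
Proof.
by move=> D0; apply: nneseries_ge0 => j _ _; rewrite lee_fin mulr_ge0// poly_nnegX.
Qed.

Lemma genfun_jetE D l : jet_ok D -> (l <= p)%N -> ((genfun_jet D)`_l)%:E = jet_series D l.
Proof.
move=> [D0 Dy] lp; rewrite /genfun_jet coef_poly ltnS lp fineK// ge0_fin_numE ?Dy//.
exact: jet_series_ge0.
Qed.

Lemma genfun_jet_nneg D : poly_nneg D -> poly_nneg (genfun_jet D).
Proof.
by move=> D0 l; rewrite coef_poly; case: ifP => // _; rewrite fine_ge0// jet_series_ge0.
Qed.

Lemma offspring_mean_jet D x y l : jet_ok D -> (l <= p)%N ->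
  offspring_mean q x (fun z => ((D ^+ z)`_l)%:E) y = ((D ^+ y * genfun_jet D ^+ x)`_l)%:E.
Proof.
move=> Dok lp; have [D0 _] := Dok; elim: x y => [|x IH] y /=; first by rewrite mulr1.
set B := D ^+ y * genfun_jet D ^+ x.
have B0 : poly_nneg B by apply: poly_nnegM; apply: poly_nnegX => //; exact: genfun_jet_nneg.
transitivity (\sum_(i <oo) \sum_(a < l.+1) (B`_a)%:E * (q i * (D ^+ i)`_(l - a))%:E)%E.
  apply: eq_eseriesr => i _; rewrite IH -EFinM exprD mulrAC coefM mulr_sumr -sumEFin.
  by apply: eq_bigr => a _; rewrite -EFinM mulrCA.
rewrite nneseries_sum; last first.
  by move=> a i _; rewrite mule_ge0// lee_fin ?mulr_ge0// poly_nnegX.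
rewrite exprSr mulrA coefM -sumEFin; apply: eq_bigr => a _.
rewrite nneseriesZl; last by move=> i _; rewrite lee_fin mulr_ge0// poly_nnegX.
by rewrite EFinM genfun_jetE// (leq_trans (leq_subr _ _)).
Qed.

End GenfunJet.

Section JetIteration.
Context {R : realType}.
Variables (q : nat -> R) (p k : nat) (P : probability tree R).
Hypotheses (q_dist : is_distribution q) (hP : GW_law q k P).
Implicit Types D : {poly R}.
Local Notation J := (genfun_jet q p).

(** Branching property: taking means over [m] generations composes the
    generating function [m] times. *)
Lemma GW_jet D h m A l : (forall i, jet_ok q p (iter i J D)) -> (l <= p)%N ->
  (k <= h)%N -> filtr h A ->
  (\int[P]_(x in A) ((D ^+ gen_size (h + m) x)`_l)%:E =
   \int[P]_(x in A) ((iter m J D ^+ gen_size h x)`_l)%:E)%E.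
Proof.
move=> ok lp kh hA; elim: m D ok => [|m IH] D ok; first by rewrite addn0.
have [D0 _] := ok 0%N.
rewrite addnS (GW_step q_dist hP (F := fun z => ((D ^+ z)`_l)%:E)); last first.
- by apply: filtr_le hA; exact: leq_addr.
- by rewrite (leq_trans kh)// leq_addr.
- by move=> z; rewrite lee_fin poly_nnegX.
rewrite iterSr -IH; last by move=> i; rewrite -iterSr.
apply: eq_integral => x _.
by rewrite (offspring_mean_jet q_dist.1 _ _ (ok 0%N) lp) expr0 mul1r.
Qed.

End JetIteration.

Lemma gen_size0_rooted (x : tree) : rooted_tree (ones 0) x -> gen_size 0 x = 1%N.
Proof. by move=> rx; have := gen_sizeE rx 0. Qed.

Section JetFiniteness.
Context {R : realType}.
Variables (q : nat -> R) (p : nat).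
Hypothesis q0 : forall n, 0 <= q n.
Implicit Types D : {poly R}.
Local Notation J := (genfun_jet q p).

Lemma size_genfun_jet D : (size (J D) <= p.+1)%N.
Proof. exact: size_poly. Qed.

Lemma jet_ok_horner D eta kappa : poly_nneg D -> 0 < eta -> D.[eta] <= kappa ->
  genfun q kappa = kappa%:E -> jet_ok q p D /\ (J D).[eta] <= kappa.
Proof.
move=> D0 eta0 Dk fk; have eta0' := ltW eta0.
have Dle j n : \sum_(l < n) (D ^+ j)`_l * eta ^+ l <= kappa ^+ j.
  apply: le_trans (sum_coef_le_horner _ (poly_nnegX _ D0) eta0') _.
  by rewrite horner_exp lerXn2r// nnegrE ?horner_nneg// (le_trans _ Dk)// horner_nneg.
have ok : jet_ok q p D.
  split=> // l _; apply: (@le_lt_trans _ _ ((eta ^- l)%:E * genfun q kappa)%E); last first.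
    by rewrite fk ltry.
  rewrite /genfun -nneseriesZl; last first.
    move=> j _; rewrite lee_fin mulr_ge0// (le_trans _ (Dle j 0%N))// big_ord0 //.
  apply: lee_nneseries => [j _ _|j _]; first by rewrite lee_fin mulr_ge0// poly_nnegX.
  rewrite -EFinM lee_fin mulrCA ler_wpM2l// ler_pdivlMl ?exprn_gt0//.
  have := Dle j l.+1; rewrite big_ord_recr/= mulrC; apply: le_trans.
  by rewrite lerDr sumr_ge0// => i _; rewrite mulr_ge0 ?exprn_ge0// poly_nnegX.
split => //; rewrite (horner_coef_wide _ (size_genfun_jet D)) -lee_fin -fk -sumEFin.
rewrite (eq_bigr (fun l : 'I_p.+1 => \sum_(j <oo) (q j * ((D ^+ j)`_l * eta ^+ l))%:E)%E); last first.
  move=> l _; have lp : (l <= p)%N by rewrite -ltnS ltn_ord.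
  rewrite EFinM (genfun_jetE q0 ok lp) [LHS]muleC -nneseriesZl; last first.
    by move=> j _; rewrite lee_fin mulr_ge0// poly_nnegX.
  by apply: eq_eseriesr => j _; rewrite -EFinM mulrCA [eta ^+ _ * _]mulrC.
rewrite (@nneseries_sum_EFin _ p.+1 (fun l j => q j * ((D ^+ j)`_l * eta ^+ l))); last first.
  by move=> l j; rewrite !mulr_ge0 ?exprn_ge0// poly_nnegX.
apply: lee_nneseries => [j _ _|j _]; rewrite lee_fin.
  by rewrite sumr_ge0// => l _; rewrite !mulr_ge0 ?exprn_ge0// poly_nnegX.
by rewrite -mulr_sumr ler_wpM2l.
Qed.

Lemma jet_ok_iter_horner D eta kappa : poly_nneg D -> 0 < eta -> D.[eta] <= kappa ->
  genfun q kappa = kappa%:E ->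
  forall m, jet_ok q p (iter m J D) /\ (iter m J D).[eta] <= kappa.
Proof.
move=> D0 eta0 Dk fk m.
suff H : poly_nneg (iter m J D) /\ (iter m J D).[eta] <= kappa.
  by split; [exact: (jet_ok_horner H.1 eta0 H.2 fk).1|exact: H.2].
elim: m => //= m [Dm0 Dmk]; split; first exact: genfun_jet_nneg.
exact: (jet_ok_horner Dm0 eta0 Dmk fk).2.
Qed.

(** At the boundary [D`_0 <= 1], finiteness rests on the moments of [q]. *)
Lemma jet_ok_moment D : (\sum_(n <oo) (q n)%:E = 1)%E ->
  (forall i, (i <= p)%N -> (\sum_(n <oo) ('C(n, i)%:R * q n)%:E < +oo)%E) ->
  poly_nneg D -> D`_0 <= 1 -> jet_ok q p D /\ (J D)`_0 <= 1.
Proof.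
move=> q1 qp D0 D1; have D00 := D0 0%N.
have ok : jet_ok q p D.
  split => // l lp; pose B := D - (D`_0)%:P.
  have B0 : poly_nneg B.
    by move=> j; rewrite coefB coefC; case: eqP => [->|_]; rewrite ?subrr ?subr0.
  apply: (@le_lt_trans _ _ (\sum_(n <oo) \sum_(i < l.+1)
       ((B ^+ i)`_l)%:E * ('C(n, i)%:R * q n)%:E))%E.
    apply: lee_nneseries => [j _ _|j _]; first by rewrite lee_fin mulr_ge0// poly_nnegX.
    rewrite coef_exp_binomial mulr_sumr -sumEFin; apply: lee_sum => i _.
    rewrite -EFinM lee_fin [leRHS](_ : _ = q j * ('C(j, i)%:R * (B ^+ i)`_l)); last by ring.
    rewrite ler_wpM2l// -mulrA ler_wpM2l// ler_piMl ?poly_nnegX//.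
    by rewrite exprn_ile1.
  rewrite nneseries_sum; last first.
    by move=> i j _; rewrite mule_ge0// lee_fin ?mulr_ge0// poly_nnegX.
  apply: lte_sum_pinfty => i _.
  rewrite nneseriesZl; last by move=> j _; rewrite lee_fin mulr_ge0.
  rewrite lte_mul_pinfty ?lee_fin ?poly_nnegX// qp// (leq_trans _ lp)// -ltnS.
  exact: ltn_ord.
split => //; rewrite -lee_fin (genfun_jetE q0 ok)// -q1.
apply: lee_nneseries => [j _ _|j _]; first by rewrite lee_fin mulr_ge0// poly_nnegX.
rewrite lee_fin -[leRHS]mulr1 ler_wpM2l// -!horner_coef0 horner_exp exprn_ile1//.
all: by rewrite horner_coef0.
Qed.

Lemma jet_ok_iter_moment D : (\sum_(n <oo) (q n)%:E = 1)%E ->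
  (forall i, (i <= p)%N -> (\sum_(n <oo) ('C(n, i)%:R * q n)%:E < +oo)%E) ->
  poly_nneg D -> D`_0 <= 1 -> forall m, jet_ok q p (iter m J D).
Proof.
move=> q1 qp D0 D1 m.
suff H : poly_nneg (iter m J D) /\ (iter m J D)`_0 <= 1.
  exact: (jet_ok_moment q1 qp H.1 H.2).1.
elim: m => //= m [Dm0 Dm1]; split; first exact: genfun_jet_nneg.
exact: (jet_ok_moment q1 qp Dm0 Dm1).2.
Qed.

End JetFiniteness.

(** * Means of functions of the generation sizes *)

Section RintegralTools.
Context d (T : measurableType d) {R : realType} (P : probability T R).

Lemma ae_imp (A B : T -> Prop) : (forall x, A x -> B x) ->
  {ae P, forall x, A x} -> {ae P, forall x, B x}.
Proof.
move=> AB [N [mN N0 sN]]; exists N; split => // x nBx; apply: sN => /AB.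
exact: nBx.
Qed.

Lemma Rintegral_dominated_cvg (D : set T) (f_ : nat -> T -> R) (f g : T -> R) :
  measurable D -> (forall m, measurable_fun D (f_ m)) -> measurable_fun D f ->
  {ae P, forall x, D x -> f_ m x @[m --> \oo] --> f x} ->
  P.-integrable D (EFin \o g) ->
  {ae P, forall x m, D x -> `|f_ m x| <= g x} ->
  P.-integrable D (EFin \o f) /\
  \int[P]_(x in D) f_ m x @[m --> \oo] --> \int[P]_(x in D) f x.
Proof.
move=> mD mf_ mf ff ig fg.
have mf_' m : measurable_fun D (EFin \o f_ m) by exact/measurable_EFinP.
have mf' : measurable_fun D (EFin \o f) by exact/measurable_EFinP.
have ff' : {ae P, forall x, D x -> (EFin \o f_ m) x @[m --> \oo] --> (EFin \o f) x}.
  apply: ae_imp ff => x fx Dx; apply/cvg_EFin; last exact: fx.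
  exact: nearW.
have fg' : {ae P, forall x m, D x -> (`|(EFin \o f_ m) x| <= (EFin \o g) x)%E}.
  by apply: ae_imp fg => x fx m Dx; rewrite /= lee_fin; exact: fx.
have [intf _ cv] := dominated_convergence mD mf_' mf' ff' ig fg'.
split => //; have := fine_cvg; apply.
by rewrite fineK// integrable_fin_num.
Qed.

Lemma expectation_indicE (f : T -> R) (A : set T) : measurable A ->
  P.-integrable A (EFin \o f) ->
  ('E_P[(fun t => f t * \1_A t)%R] = (\int[P]_(t in A) f t)%:E)%E.
Proof.
move=> mA intf; rewrite unlock /Rintegral fineK ?integrable_fin_num//.
rewrite [RHS]integral_mkcond; apply: eq_integral => t _.
rewrite patchE indicE; case: (t \in A) => /=.
  by rewrite mulr1.
by rewrite mulr0.
Qed.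

Lemma expectationE (f : T -> R) : P.-integrable setT (EFin \o f) ->
  ('E_P[f] = (\int[P]_t f t)%:E)%E.
Proof. by move=> intf; rewrite unlock /Rintegral fineK ?integrable_fin_num. Qed.

Lemma integrable_le (D : set T) (f g : T -> R) : measurable D ->
  measurable_fun D f -> P.-integrable D (EFin \o g) ->
  (forall x, D x -> `|f x| <= g x) -> P.-integrable D (EFin \o f).
Proof.
move=> mD mf ig fg; apply: le_integrable ig => //; first exact/measurable_EFinP.
by move=> x Dx /=; rewrite lee_fin (le_trans (fg x Dx))// ler_norm.
Qed.

Lemma Rintegral_probability_cst (c : R) : \int[P]_(x in setT) c = c.
Proof.
rewrite Rintegral_cst//; apply: etrans (congr1 (fun z => c * fine z) (probability_setT P)) _.
exact: mulr1.
Qed.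

Lemma integrable_cst (D : set T) (c : R) : measurable D -> P.-integrable D (EFin \o (fun=> c)).
Proof. by move=> mD; exact: (finite_measure_integrable_cst P c). Qed.

Lemma Rintegral_sum n (f : 'I_n -> T -> R) :
  (forall i, P.-integrable setT (EFin \o f i)) ->
  P.-integrable setT (EFin \o (fun x => \sum_(i < n) f i x)) /\
  \int[P]_x (\sum_(i < n) f i x) = \sum_(i < n) \int[P]_x f i x.
Proof.
elim: n f => [|n IH] f intf.
  rewrite big_ord0; under eq_Rintegral do rewrite big_ord0.
  split; last exact: Rintegral_probability_cst.
  have -> : (fun x => \sum_(i < 0) f i x) = (fun=> 0) by apply/funext => x; rewrite big_ord0.
  exact: integrable_cst.
have [i1 e1] := IH (fun i => f (widen_ord (leqnSn n) i)) (fun i => intf _).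
have -> : (fun x => \sum_(i < n.+1) f i x) =
    (fun x => \sum_(i < n) f (widen_ord (leqnSn n) i) x + f ord_max x).
  by apply/funext => x; rewrite big_ord_recr.
split; first exact: (integrableD _ i1 (intf ord_max)).
by rewrite (RintegralD measurableT i1 (intf ord_max)) e1 big_ord_recr.
Qed.

End RintegralTools.

Lemma coef0_exp (R : comNzRingType) (A : {poly R}) j : (A ^+ j)`_0 = A`_0 ^+ j.
Proof. by rewrite -!horner_coef0 horner_exp. Qed.

Lemma coef1_exp (R : comNzRingType) (A : {poly R}) j :
  (A ^+ j)`_1 = j%:R * A`_0 ^+ j.-1 * A`_1.
Proof.
rewrite coef_exp_binomial !big_ord_recl big_ord0 /= expr0 coef1 mulr0 add0r addr0.
by rewrite bin1 expr1 coefB coefC subr0 subn1.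
Qed.

Section JetMeans.
Context {R : realType}.
Variables (q : nat -> R) (p : nat) (P : probability tree R).
Hypotheses (q_dist : is_distribution q) (hP : GW_law q 0 P).
Implicit Types D : {poly R}.
Local Notation J := (genfun_jet q p).

Lemma integral_gen_size0 (g : nat -> \bar R) : (forall z, 0 <= g z)%E ->
  (\int[P]_x g (gen_size 0 x) = g 1%N)%E.
Proof.
move=> g0; pose A := [set x : tree | rooted_tree (ones 0) x].
have mA : measurable A by exact: filtr_measurable (rooted_filtr 0).
have PA : P (~` A) = 0%E.
  by apply: etrans (probability_setC P mA) _; rewrite (GW_rooted q_dist hP) subee.
rewrite (@ge0_negligible_integral _ _ _ P setT (~` A))//; last 2 first.
- exact: measurableC.
- exact: (gen_size_mfun _ g).
rewrite setTD setCK (eq_integral (fun=> g 1%N)); last first.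
  by move=> x; rewrite inE => /gen_size0_rooted ->.
rewrite integral_cst//; apply: etrans (congr1 (mule _) (GW_rooted q_dist hP)) _.
exact: mule1.
Qed.

Lemma measurable_gen_size n (g : nat -> R) (D : set tree) :
  measurable_fun D (fun x : tree => g (gen_size n x)).
Proof.
by apply: measurable_funTS; apply: (@filtr_measurable_fun n) => x y /eq_gen_size ->.
Qed.

Lemma jet_mean D m l : (forall i, jet_ok q p (iter i J D)) -> (l <= p)%N ->
  P.-integrable setT (EFin \o (fun x : tree => (D ^+ gen_size m x)`_l)) /\
  \int[P]_x (D ^+ gen_size m x)`_l = (iter m J D)`_l.
Proof.
move=> ok lp; have D0 := (ok 0%N).1.
have H : (\int[P]_x ((D ^+ gen_size m x)`_l)%:E = ((iter m J D)`_l)%:E)%E.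
  have /= := GW_jet q_dist hP m ok lp (leqnn 0) (filtrT 0).
  rewrite add0n => ->; rewrite (@integral_gen_size0 (fun z => ((iter m J D ^+ z)`_l)%:E)) ?expr1//.
  by move=> z; rewrite lee_fin poly_nnegX//; exact: (ok m).1.
split; last by rewrite /Rintegral H.
apply/integrableP; split.
  apply/measurable_EFinP; exact: (@measurable_gen_size m (fun z => (D ^+ z)`_l)).
under eq_integral => x _ do rewrite gee0_abs ?lee_fin ?poly_nnegX//.
by rewrite H ltry.
Qed.

Lemma GW_jet_Rintegral D n m A l : (forall i, jet_ok q p (iter i J D)) -> (l <= p)%N ->
  filtr n A ->
  \int[P]_(x in A) (D ^+ gen_size (n + m) x)`_l =
  \int[P]_(x in A) (iter m J D ^+ gen_size n x)`_l.
Proof. by move=> ok lp nA; rewrite /Rintegral (GW_jet q_dist hP m ok lp (leq0n n) nA). Qed.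

End JetMeans.

Section FixpointMeans.
Context {R : realType}.
Variables (q : nat -> R) (P : probability tree R).
Hypotheses (q_dist : is_distribution q) (hP : GW_law q 0 P).

(** A jet [c + d X] with [c] a fixed point of [f] is mapped to
    [c + f'(c) d X]. *)
Lemma fixpoint_mean c lam n : 0 <= c -> genfun q c = c%:E -> genfunD q 1 c = lam%:E ->
  [/\ P.-integrable setT (EFin \o (fun x : tree => c ^+ gen_size n x)),
      \int[P]_x c ^+ gen_size n x = c,
      P.-integrable setT (EFin \o (fun x : tree => (gen_size n x)%:R * c ^+ (gen_size n x).-1)) &
      \int[P]_x ((gen_size n x)%:R * c ^+ (gen_size n x).-1) = lam ^+ n].
Proof.
move=> c0 fc fDc.
have lam0 : 0 <= lam.
  rewrite -lee_fin -fDc; apply: nneseries_ge0 => j _ _.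
  by rewrite lee_fin !mulr_ge0 ?exprn_ge0//; exact: q_dist.1.
pose D0 : {poly R} := c%:P + 'X.
have D00 : D0`_0 = c by rewrite coefD coefC coefX addr0.
have D01 : D0`_1 = 1 by rewrite coefD coefC coefX add0r.
pose D m := iter m (genfun_jet q 1) D0.
have H m : [/\ poly_nneg (D m), (D m)`_0 = c & (D m)`_1 = lam ^+ m] ->
    [/\ jet_ok q 1 (D m), (D m.+1)`_0 = c & (D m.+1)`_1 = lam ^+ m.+1].
  move=> [Dm Dm0 Dm1].
  have s0 : jet_series q (D m) 0 = c%:E.
    by rewrite -fc; apply: eq_eseriesr => j _; rewrite coef0_exp Dm0.
  have s1 : jet_series q (D m) 1 = (lam ^+ m.+1)%:E.
    rewrite exprSr EFinM -fDc -nneseriesZl; last first.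
      by move=> j _; rewrite lee_fin !mulr_ge0 ?exprn_ge0//; exact: q_dist.1.
    apply: eq_eseriesr => j _; rewrite coef1_exp Dm0 Dm1 ffactn1 subn1 -EFinM.
    by congr EFin; ring.
  have ok : jet_ok q 1 (D m) by split => // -[|[|//]] _; rewrite ?s0 ?s1 ltry.
  split => //; apply: EFin_inj; rewrite /D iterS (genfun_jetE q_dist.1 ok)//.
have DP m : [/\ poly_nneg (D m), (D m)`_0 = c & (D m)`_1 = lam ^+ m].
  elim: m => [|m IH].
    split=> // l; rewrite coefD coefC coefX addr_ge0//; first by case: eqP.
  have [[Dm _] ? ?] := H _ IH; split => //.
  exact: (genfun_jet_nneg _ q_dist.1).
have ok m : jet_ok q 1 (D m) by case: (H m (DP m)).
have [i0 e0] := jet_mean q_dist hP n ok (leq0n 1).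
have [i1 e1] := jet_mean q_dist hP n ok (leqnn 1).
have f0E : (fun x : tree => (D0 ^+ gen_size n x)`_0) = (fun x : tree => c ^+ gen_size n x).
  by apply/funext => x; rewrite coef0_exp D00.
have f1E : (fun x : tree => (D0 ^+ gen_size n x)`_1) =
    (fun x : tree => (gen_size n x)%:R * c ^+ (gen_size n x).-1).
  by apply/funext => x; rewrite coef1_exp D00 D01 mulr1.
have [_ Dn0 Dn1] := DP n.
by rewrite -f0E -f1E e0 e1; split.
Qed.

End FixpointMeans.

Lemma Hpol_bin (R : realType) k z : Hpol k z%:R = 'C(z, k)%:R :> R.
Proof.
have H : \prod_(j < k) (z%:R - j%:R) = (z ^_ k)%:R :> R.
  elim: k => [|k IH]; first by rewrite big_ord0 ffactn0.
  rewrite big_ord_recr/= IH ffactnSr natrM; have [kz|zk] := leqP k z.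
    by rewrite natrB.
  by rewrite ffact_small// !mul0r.
by rewrite /Hpol H -bin_ffact natrM mulrC mulfK// pnatr_eq0 -lt0n fact_gt0.
Qed.

(** * Sub-critical limit: evaluation below the fixed point *)

Section CoefExpBounds.
Variable R : realFieldType.
Implicit Types A B : {poly R}.

Lemma coefM_ge A B l m : poly_nneg A -> poly_nneg B -> A`_l * B`_m <= (A * B)`_(l + m).
Proof.
move=> A0 B0; rewrite coefM; have lm : (l < (l + m).+1)%N by rewrite ltnS leq_addr.
rewrite (bigD1 (Ordinal lm))//= addKn lerDl sumr_ge0// => i _.
by rewrite mulr_ge0.
Qed.

Lemma coef_exp_ge A j l : poly_nneg A -> A`_0 ^+ j * A`_l <= (A ^+ j.+1)`_l.
Proof.
move=> A0; rewrite exprSr -coef0_exp.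
by have := coefM_ge 0 l (poly_nnegX j A0) A0; rewrite add0n.
Qed.

Lemma coef_exp_ge2 A j l : poly_nneg A -> A`_0 ^+ j * (A`_1 * A`_l) <= (A ^+ j.+2)`_l.+1.
Proof.
move=> A0; rewrite -addn2 exprD -coef0_exp expr2.
have A2 := poly_nnegM A0 A0.
apply: le_trans (ler_wpM2l _ (coefM_ge 1 l A0 A0)) _; first exact: poly_nnegX.
by have := coefM_ge 0 (1 + l) (poly_nnegX j A0) A2; rewrite !add0n add1n.
Qed.

(** For an [i]-th power with [i >= 2] and no constant term, only the coefficients
    of index less than [l] contribute to the one of index [l]. *)
Lemma le_coef_exp_below A B i l : A`_0 = 0 -> B`_0 = 0 -> poly_nneg A -> poly_nneg B ->
  (forall m, (m < l)%N -> A`_m <= B`_m) -> (A ^+ i.+2)`_l <= (B ^+ i.+2)`_l.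
Proof.
move=> A00 B00 A0 B0 AB; rewrite !(exprS _ i.+1) !coefM; apply: ler_sum => -[[|j] /= jl] _.
  by rewrite A00 B00 !mul0r.
have [jl'|lj] := ltnP j.+1 l; last first.
  rewrite ltnS in jl; have -> : (l - j.+1 = 0)%N by apply/eqP; rewrite subn_eq0.
  by rewrite !coef0_exp A00 B00 expr0n/= !mulr0.
rewrite ler_pM ?poly_nnegX// ?AB//.
apply: (@le_coef_exp _ (l - j.+1)) => // m ml; apply: AB.
by rewrite (leq_ltn_trans ml)// ltn_subrL/= (leq_ltn_trans _ jl').
Qed.

Lemma coef_le_horner A l (c : R) : poly_nneg A -> 0 <= c -> A`_l * c ^+ l <= A.[c].
Proof.
move=> A0 c0; apply: le_trans (sum_coef_le_horner l.+1 A0 c0).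
by rewrite big_ord_recr/= lerDr sumr_ge0// => i _; rewrite mulr_ge0// exprn_ge0.
Qed.

(** Isolates the linear term of [(T ^+ x)`_l]; the remainder is quadratic in
    the size [eps] of the non-constant coefficients. *)
Lemma coef_exp_linear_part T B (x l : nat) (eps S eta kappa : R) :
  poly_nneg T -> poly_nneg B -> B`_0 = 0 -> 0 <= eps <= 1 -> T`_0 <= S -> 0 < eta ->
  (forall i, (0 < i < l)%N -> T`_i <= eps * B`_i) -> S + B.[eta] <= kappa -> (0 < l)%N ->
  x%:R * T`_0 ^+ x.-1 * T`_l <= (T ^+ x)`_l /\
  (T ^+ x)`_l <= x%:R * T`_0 ^+ x.-1 * T`_l + eps ^+ 2 * (eta ^- l * kappa ^+ x).
Proof.
move=> T0 B0 B00 /andP[e0 e1] TS eta0 TB SB l0.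
have S0 : 0 <= S := le_trans (T0 0%N) TS.
set U := T - (T`_0)%:P.
have U0 : poly_nneg U by move=> j; rewrite coefB coefC; case: eqP => [->|_]; rewrite ?subrr ?subr0.
have U00 : U`_0 = 0 by rewrite coefB coefC subrr.
have Ul : U`_l = T`_l by rewrite coefB coefC eqn0Ngt l0 subr0.
case: l => // l in l0 TB Ul *.
rewrite coef_exp_binomial !big_ord_recl/= expr0 coef1 mulr0 add0r.
rewrite /bump /= !add1n bin1 expr1 subn1 -/U Ul; split.
  by rewrite lerDl sumr_ge0// => i _; rewrite !mulr_ge0 ?exprn_ge0// poly_nnegX.
rewrite lerD2l.
have SB0 : poly_nneg (S%:P + B) by move=> j; rewrite coefD coefC addr_ge0//; case: eqP.
apply: (@le_trans _ _ (eps ^+ 2 * ((S%:P + B) ^+ x)`_l.+1)); last first.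
  rewrite ler_wpM2l ?exprn_ge0// ler_pdivlMl ?exprn_gt0// mulrC.
  apply: le_trans (coef_le_horner _ (poly_nnegX x SB0) (ltW eta0)) _.
  rewrite horner_exp hornerD hornerC lerXn2r// nnegrE ?addr_ge0 ?horner_nneg ?(ltW eta0)//.
  by rewrite (le_trans _ SB)// addr_ge0// horner_nneg// ltW.
rewrite [in leRHS]coef_exp_binomial !big_ord_recl/= expr0 coef1 mulr0 add0r.
have -> : (S%:P + B)`_0 = S by rewrite coefD coefC B00 addr0.
rewrite [S%:P + B]addrC addrK mulrDr; apply: ler_wpDl.
  by rewrite !mulr_ge0 ?exprn_ge0// poly_nnegX.
rewrite mulr_sumr; apply: ler_sum => i _; rewrite /bump /= !add1n.
rewrite [leRHS]mulrCA ler_pM//.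
- by rewrite mulr_ge0// exprn_ge0.
- exact: poly_nnegX.
- by rewrite ler_wpM2l// lerXn2r// nnegrE.
apply: (@le_trans _ _ (((eps *: B) ^+ i.+2)`_l.+1)).
  apply: le_coef_exp_below => //; first by rewrite coefZ B00 mulr0.
    by move=> j; rewrite coefZ mulr_ge0.
  case=> [|m] ml; first by rewrite U00 coefZ mulr_ge0.
  by rewrite coefB coefC subr0 coefZ TB.
rewrite exprZn coefZ ler_wpM2r ?poly_nnegX//.
by rewrite ler_wiXn2l.
Qed.

(** Near [0] a polynomial without constant term fits below any margin. *)
Lemma small_horner B (S kappa : R) : poly_nneg B -> B`_0 = 0 -> S < kappa ->
  exists2 eta, 0 < eta & S + B.[eta] <= kappa.
Proof.
move=> B0 B00 Sk; have b0 : 0 <= B.[1] by rewrite horner_nneg.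
have d0 : 0 < kappa - S by rewrite subr_gt0.
pose eta := Num.min 1 ((kappa - S) / (B.[1] + 1)).
have eta0 : 0 < eta by rewrite lt_min ltr01 divr_gt0// ltr_wpDl.
have eta1 : eta <= 1 by rewrite ge_min lexx.
exists eta => //; rewrite -lerBrDl; apply: (@le_trans _ _ (eta * B.[1])).
  rewrite !horner_coef mulr_sumr; apply: ler_sum => -[[|i] /= _] _.
    by rewrite B00 !mul0r mulr0.
  rewrite expr1n mulr1 mulrC ler_wpM2r// exprS ler_piMr// ?(ltW eta0)//.
  by rewrite exprn_ile1// ltW.
apply: (@le_trans _ _ ((kappa - S) / (B.[1] + 1) * B.[1])).
  by rewrite ler_wpM2r// ge_min lexx orbT.
by rewrite mulrAC ler_pdivrMr ?ltr_wpDl// ler_wpM2l ?(ltW d0)// lerDl.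
Qed.

End CoefExpBounds.

(** Numerator and denominator may both vanish in the limit; the common
    normalisation [c] cancels in the quotient. *)
Lemma EFin_div_cvg (R : realType) (c u v : nat -> R) (a b : R) :
  (\forall m \near \oo, c m != 0) -> b != 0 ->
  u m / c m @[m --> \oo] --> a -> v m / c m @[m --> \oo] --> b ->
  ((u m)%:E / (v m)%:E)%E @[m --> \oo] --> (a / b)%:E.
Proof.
move=> c0 b0 ua vb.
have vn0 : \forall m \near \oo, v m / c m != 0 by exact: (cvgr_neq0 _ vb b0).
apply: (@cvg_trans _ (((u m / c m) / (v m / c m))%:E @[m --> \oo])); last first.
  apply/cvg_EFin; first exact: nearW.
  by apply: cvgM => //; exact: cvgV.
apply: near_eq_cvg; near=> m.
have cm : c m != 0 by near: m.
have vm : v m / c m != 0 by near: m.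
have vm' : v m != 0 by apply: contraNneq vm => ->; rewrite mul0r.
by rewrite inver (negbTE vm') -EFinM invf_div mulrA divfK.
Unshelve. all: by end_near. Qed.

Section Subcritical.
Context {R : realType}.
Variables (q : nat -> R) (P : probability tree R) (kappa : R).
Hypotheses (q_dist : is_distribution q) (hP : GW_law q 0 P).
Hypotheses (mean1 : (mean q < 1)%E) (kappa1 : 1 < kappa).
Hypotheses (fk : genfun q kappa = kappa%:E) (fDk : (genfunD q 1 kappa < +oo)%E).

Let q0 := q_dist.1.
Let mu : R := fine (mean q).
Let mubar : R := fine (genfunD q 1 kappa).
Let kappa0 : 0 < kappa := lt_trans ltr01 kappa1.

Lemma mean_ge0 : (0 <= mean q)%E.
Proof. by apply: nneseries_ge0 => n _ _; rewrite lee_fin mulr_ge0. Qed.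

Lemma meanE : mean q = mu%:E.
Proof. by rewrite /mu fineK// ge0_fin_numE ?mean_ge0// (lt_trans mean1)// ltry. Qed.

Lemma mu_ge0 : 0 <= mu. Proof. by rewrite -lee_fin -meanE mean_ge0. Qed.

Lemma mu_lt1 : mu < 1. Proof. by rewrite -lte_fin -meanE. Qed.

Lemma genfun1 : genfun q 1 = 1%:E.
Proof. by rewrite -q_dist.2; apply: eq_eseriesr => n _; rewrite expr1n mulr1. Qed.

Lemma genfunD1 : genfunD q 1 1 = mu%:E.
Proof. by rewrite -meanE; apply: eq_eseriesr => n _; rewrite expr1n mulr1 ffactn1. Qed.

Lemma genfunDk : genfunD q 1 kappa = mubar%:E.
Proof.
rewrite /mubar fineK// ge0_fin_numE//; apply: nneseries_ge0 => n _ _.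
by rewrite lee_fin !mulr_ge0// exprn_ge0// ltW.
Qed.

(** A distribution carried by {0, 1} has no second fixed point, since then
    [f(kappa) = 1 + mu (kappa - 1)]. *)
Lemma offspring_ge2 : exists2 j, (1 < j)%N & 0 < q j.
Proof.
apply: contrapT => nj; have qj j : (1 < j)%N -> q j = 0.
  move=> j1; apply/eqP; rewrite eq_le q0 andbT leNgt; apply/negP => qj0.
  by apply: nj; exists j.
have : genfun q kappa = (1 + (kappa - 1)%:E * mean q)%E.
  rewrite -q_dist.2 -nneseriesZl; last by move=> n _; rewrite lee_fin mulr_ge0.
  rewrite -nneseriesD; last 2 first.
  - by move=> n _ _; rewrite lee_fin.
  - by move=> n _ _; rewrite -EFinM lee_fin !mulr_ge0// subr_ge0 ltW.
  apply: eq_eseriesr => n _; rewrite -EFinM -EFinD.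
  suff -> : q n * kappa ^+ n = q n + (kappa - 1) * (n%:R * q n) by [].
  case: n => [|[|n]]; [ring|ring|by rewrite qj// !(mul0r, mulr0) addr0].
rewrite fk meanE -EFinM -EFinD => -[kE].
have : (kappa - 1) * mu < (kappa - 1) * 1 by rewrite ltr_pM2l ?mu_lt1// subr_gt0.
by rewrite mulr1 ltrBrDl -kE ltxx.
Qed.

Lemma mu_gt0 : 0 < mu.
Proof.
have [j j1 qj] := offspring_ge2; rewrite -lte_fin -meanE.
apply: (@lt_le_trans _ _ (j%:R * q j)%:E).
  by rewrite lte_fin mulr_gt0// ltr0n (ltn_trans _ j1).
rewrite /mean (nneseriesD1 (n := j))//; last by move=> n _; rewrite lee_fin mulr_ge0.
by rewrite leeDl// nneseries_ge0// => n _ _; rewrite lee_fin mulr_ge0.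
Qed.

Variables (p : nat) (s : R).
Hypothesis s0k : 0 <= s < kappa.

Local Notation J := (genfun_jet q p).
Let D : {poly R} := s *: (1 + 'X).
Let T m := iter m J D.
Let a m := (T m)`_0.

Let s0 : 0 <= s. Proof. by case/andP: s0k. Qed.
Let D0 : poly_nneg D.
Proof. by move=> l; rewrite /D coefZ coefD coef1 coefX mulr_ge0// addr_ge0. Qed.

Let ok m : jet_ok q p (T m).
Proof.
pose B : {poly R} := s *: 'X.
have B0 : poly_nneg B by move=> l; rewrite coefZ coefX mulr_ge0.
have B00 : B`_0 = 0 by rewrite coefZ coefX mulr0.
have [_ sk] := andP s0k.
have [eta eta0 Dk] := small_horner B0 B00 sk.
have Dk' : D.[eta] <= kappa by rewrite /D scalerDr hornerD alg_polyC hornerC.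
by have [] := jet_ok_iter_horner p q0 D0 eta0 Dk' fk m.
Qed.

Let T0 m : poly_nneg (T m). Proof. exact: (ok m).1. Qed.

Let ok_iter m i : jet_ok q p (iter i J (T m)).
Proof. by rewrite /T -iterD; exact: ok. Qed.

Let TS m l : (l <= p)%N -> (T m.+1)`_l = \int[P]_x (T m ^+ gen_size 1 x)`_l.
Proof. by move=> lp; have [_ ->] := jet_mean q_dist hP 1 (ok_iter m) lp. Qed.

Let aE m : a m = \int[P]_x s ^+ gen_size m x.
Proof.
have [_ e] := jet_mean q_dist hP m (ok_iter 0) (leq0n p); rewrite -[LHS]e.
by apply: eq_Rintegral => x _; rewrite coef0_exp /= /D coefZ coefD coef1 coefX addr0 mulr1.
Qed.

Let int_kappa n : P.-integrable setT (EFin \o (fun x : tree => kappa ^+ gen_size n x)).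
Proof. by have [] := fixpoint_mean q_dist hP n (ltW kappa0) fk genfunDk. Qed.

Let Rint_kappa n : \int[P]_x kappa ^+ gen_size n x = kappa.
Proof. by have [] := fixpoint_mean q_dist hP n (ltW kappa0) fk genfunDk. Qed.

Let int_Zkappa n : P.-integrable setT
  (EFin \o (fun x : tree => (gen_size n x)%:R * kappa ^+ (gen_size n x).-1)).
Proof. by have [] := fixpoint_mean q_dist hP n (ltW kappa0) fk genfunDk. Qed.

Lemma integrable_gen_size n :
  P.-integrable setT (EFin \o (fun x : tree => (gen_size n x)%:R)).
Proof.
have [_ _ h _] := fixpoint_mean q_dist hP n ler01 genfun1 genfunD1.
by apply: eq_integrable h => // x _ /=; rewrite expr1n mulr1.
Qed.

Lemma Rintegral_gen_size n : \int[P]_x (gen_size n x)%:R = mu ^+ n.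
Proof.
have [_ _ _ <-] := fixpoint_mean q_dist hP n ler01 genfun1 genfunD1.
by apply: eq_Rintegral => x _; rewrite expr1n mulr1.
Qed.

Let int_s n : P.-integrable setT (EFin \o (fun x : tree => s ^+ gen_size n x)).
Proof.
apply: integrable_le (int_kappa n) _ => //.
  exact: (@measurable_gen_size _ n (fun z => s ^+ z)).
move=> x _; rewrite ger0_norm ?exprn_ge0//.
by apply: lerXn2r; rewrite ?nnegrE ?(ltW kappa0)//; case/andP: s0k => _ /ltW.
Qed.

Let a_lower m : 1 - mu ^+ m <= a m.
Proof.
have iD : P.-integrable setT (EFin \o (fun x : tree => s ^+ gen_size m x + (gen_size m x)%:R)).
  exact: (integrableD _ (int_s m) (integrable_gen_size m)).
rewrite lerBlDr -(Rintegral_gen_size m) aE -RintegralD//; last exact: integrable_gen_size.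
rewrite -[leLHS](Rintegral_probability_cst P 1); apply: le_Rintegral => //.
  exact: integrable_cst.
move=> x _; case: (gen_size m x) => [|z]; first by rewrite expr0 lerDl.
by rewrite ler_wpDl ?exprn_ge0// ler1n.
Qed.

(** [P(Z_m >= 1) <= mu ^ m] controls [s ^ Z_m] on [1 <= Z_m <= K], and
    [kappa ^ Z_m] controls it beyond [K]. *)
Let a_upper K m : a m <= 1 + (Num.max 1 s ^+ K * mu ^+ m + (s / kappa) ^+ K * kappa).
Proof.
set S := Num.max 1 s; have S1 : 1 <= S by rewrite le_max lexx.
have sS : s <= S by rewrite le_max lexx orbT.
have sk0 : 0 <= s / kappa by rewrite divr_ge0// ltW.
have sk1 : s / kappa <= 1.
  by rewrite ler_pdivrMr// mul1r; case/andP: s0k => _ /ltW.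
pose g1 (x : tree) := S ^+ K * (gen_size m x)%:R.
pose g2 (x : tree) := (s / kappa) ^+ K * kappa ^+ gen_size m x.
have i1 : P.-integrable setT (EFin \o g1) by exact: (integrableZl _ _ (integrable_gen_size m)).
have i2 : P.-integrable setT (EFin \o g2) by exact: (integrableZl _ _ (int_kappa m)).
have i12 : P.-integrable setT (EFin \o (fun x => g1 x + g2 x)) by exact: (integrableD _ i1 i2).
have i0 := integrable_cst P 1 (@measurableT _ tree).
rewrite -(Rintegral_gen_size m) -(RintegralZl _ measurableT (integrable_gen_size m)).
rewrite -[X in _ * X](Rint_kappa m) -(RintegralZl _ measurableT (int_kappa m)) -(RintegralD measurableT i1 i2).
rewrite -[X in X + _](Rintegral_probability_cst P 1) -(RintegralD measurableT i0 i12) aE.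
apply: le_Rintegral => //; first exact: (integrableD _ i0 i12).
move=> x _; rewrite /g1 /g2; case: (gen_size m x) => [|z].
  by rewrite !expr0 mulr0 add0r mulr1 lerDl exprn_ge0.
have [zK|Kz] := leqP z.+1 K.
  apply: (@le_trans _ _ (S ^+ K * z.+1%:R)); last first.
    by rewrite addrCA lerDl addr_ge0// mulr_ge0// exprn_ge0// ltW.
  apply: (@le_trans _ _ (S ^+ K)); last by rewrite ler_peMr ?ler1n// exprn_ge0// (le_trans ler01).
  apply: (@le_trans _ _ (S ^+ z.+1)); first by rewrite lerXn2r// nnegrE (le_trans s0).
  by rewrite ler_weXn2l.
apply: (@le_trans _ _ ((s / kappa) ^+ K * kappa ^+ z.+1)); last first.
  by rewrite addrA lerDr addr_ge0// mulr_ge0// exprn_ge0// (le_trans ler01).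
have -> : s ^+ z.+1 = (s / kappa) ^+ z.+1 * kappa ^+ z.+1.
  by rewrite -exprMn divfK// gt_eqF.
by rewrite ler_wpM2r ?exprn_ge0 ?(ltW kappa0)// ler_wiXn2l// ltnW.
Qed.

Let mu_cvg0 (c : R) : c * mu ^+ m @[m --> \oo] --> (0 : R).
Proof.
rewrite -[X in _ --> X](mulr0 c); apply: cvgMl_tmp; apply: cvg_expr.
by rewrite ger0_norm ?mu_ge0// mu_lt1.
Qed.

Let a_cvg : a m @[m --> \oo] --> (1 : R).
Proof.
apply/cvgrPdist_le => e e0; have e20 : 0 < e / 2 by rewrite divr_gt0.
have sk0 : 0 <= s / kappa by rewrite divr_ge0// ltW.
have : (s / kappa) ^+ K * kappa @[K --> \oo] --> (0 : R).
  rewrite -[X in _ --> X](mul0r kappa); apply: cvgMr_tmp; apply: cvg_expr.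
  by rewrite ger0_norm// ltr_pdivrMr// mul1r; case/andP: s0k.
move=> /cvgr_le /(_ _ e20)[K _ /(_ K (leqnn K)) /= Ke].
near=> m; rewrite ler_distlC; apply/andP; split.
  apply: le_trans (a_lower m); rewrite lerD2l lerN2; near: m.
  have := mu_cvg0 1; under eq_fun do rewrite mul1r.
  by move=> /cvgr_le; apply.
apply: le_trans (a_upper K m) _; rewrite lerD2l [leRHS]splitr lerD//; near: m.
by move: (mu_cvg0 (Num.max 1 s ^+ K)) => /cvgr_le; apply.
Unshelve. all: by end_near. Qed.

Let a_ge0 m : 0 <= a m. Proof. exact: T0. Qed.

Let a_le m : a m <= kappa.
Proof.
rewrite aE -(Rint_kappa m); apply: le_Rintegral => //.
move=> x _; apply: lerXn2r; rewrite ?nnegrE ?(ltW kappa0)//.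
by case/andP: s0k => _ /ltW.
Qed.

Let linear_part m n (A : set tree) : R :=
  \int[P]_(x in A) ((gen_size n x)%:R * a m ^+ (gen_size n x).-1).

Let int_linear m n : P.-integrable setT
  (EFin \o (fun x : tree => (gen_size n x)%:R * a m ^+ (gen_size n x).-1)).
Proof.
apply: integrable_le (int_Zkappa n) _ => //.
  exact: (@measurable_gen_size _ n (fun z => z%:R * a m ^+ z.-1)).
move=> x _; rewrite ger0_norm ?mulr_ge0 ?exprn_ge0// ler_wpM2l//.
by apply: lerXn2r; rewrite ?nnegrE ?(ltW kappa0)// a_le.
Qed.

Let linear_cvg n (A : set tree) : measurable A ->
  linear_part m n A @[m --> \oo] --> \int[P]_(x in A) (gen_size n x)%:R.
Proof.
move=> mA; have mt := @measurable_gen_size R n.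
apply: (proj2 (@Rintegral_dominated_cvg _ _ R P A
  (fun m x => (gen_size n x)%:R * a m ^+ (gen_size n x).-1) (fun x => (gen_size n x)%:R)
  (fun x => (gen_size n x)%:R * kappa ^+ (gen_size n x).-1) mA _ _ _ _ _)).
- by move=> m; exact: (mt (fun z => z%:R * a m ^+ z.-1)).
- exact: (mt (fun z => z%:R)).
- apply: aeW => x _; rewrite -[X in _ --> X]mulr1; apply: cvgMl_tmp.
  rewrite -[X in _ --> X](expr1n R (gen_size n x).-1).
  exact: (cvg_comp _ _ a_cvg (@exprn_continuous R (gen_size n x).-1 1)).
- exact: integrableS (int_Zkappa n).
- apply: aeW => x m _; rewrite ger0_norm ?mulr_ge0 ?exprn_ge0// ler_wpM2l//.
  by apply: lerXn2r; rewrite ?nnegrE ?(ltW kappa0)// a_le.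
Qed.

Let weighted m n (A : set tree) : R := \int[P]_(x in A) (T m ^+ gen_size n x)`_p.

Let weightE k (t : tree) : Hpol p (gen_size k t)%:R * s ^+ gen_size k t = (D ^+ gen_size k t)`_p.
Proof. by rewrite Hpol_bin coef_exp_affine. Qed.

Let weighted_mean m n (A : set tree) : filtr n A ->
  ('E_P[(fun t : tree => Hpol p (gen_size (m + n) t)%:R * s ^+ gen_size (m + n) t * \1_A t)%R] =
   (weighted m n A)%:E)%E.
Proof.
move=> nA; have mA := filtr_measurable nA.
have [iD _] := jet_mean q_dist hP (m + n) (ok_iter 0) (leqnn p).
under eq_fun do rewrite weightE.
rewrite expectation_indicE//; last exact: integrableS iD.
by congr EFin; rewrite addnC (GW_jet_Rintegral q_dist hP m (ok_iter 0) (leqnn p) nA).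
Qed.

Let weighted_meanT m n :
  ('E_P[(fun t : tree => Hpol p (gen_size (m + n) t)%:R * s ^+ gen_size (m + n) t)%R] =
   (weighted m n setT)%:E)%E.
Proof.
have [iD _] := jet_mean q_dist hP (m + n) (ok_iter 0) (leqnn p).
under eq_fun do rewrite weightE.
rewrite expectationE//.
by congr EFin; rewrite addnC (GW_jet_Rintegral q_dist hP m (ok_iter 0) (leqnn p) (filtrT n)).
Qed.

Let weighted_cvg0 n (A : set tree) : p = 0%N -> measurable A ->
  weighted m n A @[m --> \oo] --> \int[P]_(x in A) 1.
Proof.
move=> p0 mA; rewrite /weighted p0.
under eq_fun do under eq_Rintegral do rewrite coef0_exp.
apply: (proj2 (@Rintegral_dominated_cvg _ _ R P A
  (fun m x => a m ^+ gen_size n x) (fun=> 1) (fun x => kappa ^+ gen_size n x) mA _ _ _ _ _)).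
- by move=> m; exact: (@measurable_gen_size R n (fun z => a m ^+ z)).
- exact: measurable_cst.
- apply: aeW => x _; rewrite -[X in _ --> X](expr1n R (gen_size n x)).
  exact: (cvg_comp _ _ a_cvg (@exprn_continuous R (gen_size n x) 1)).
- exact: integrableS (int_kappa n).
- apply: aeW => x m _; rewrite ger0_norm ?exprn_ge0//.
  by apply: lerXn2r; rewrite ?nnegrE ?(ltW kappa0)// a_le.
Qed.

Section PositiveOrder.
Hypotheses (p0 : (0 < p)%N) (s_gt0 : 0 < s).

Let A1 m := (T m)`_1.

Let J_ge m j l : (l <= p)%N -> q j * (T m ^+ j)`_l <= (T m.+1)`_l.
Proof.
move=> lp; rewrite -lee_fin /T iterS (genfun_jetE q0 (ok m))//.
rewrite /jet_series (nneseriesD1 (n := j))//; last first.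
  by move=> i _; rewrite lee_fin mulr_ge0// poly_nnegX.
by rewrite leeDl// nneseries_ge0// => i _ _; rewrite lee_fin mulr_ge0// poly_nnegX.
Qed.

Let T_step_gt0 m l : 0 < a m -> (l <= p)%N -> 0 < (T m)`_l -> 0 < (T m.+1)`_l.
Proof.
move=> am lp Tl; have [[//|j] j1 qj] := offspring_ge2.
apply: lt_le_trans (J_ge m j.+1 lp); rewrite mulr_gt0//.
by apply: lt_le_trans (coef_exp_ge j l (T0 m)); rewrite mulr_gt0// exprn_gt0.
Qed.

Let T01_gt0 m : 0 < a m /\ 0 < A1 m.
Proof.
elim: m => [|m [am Am]].
  by rewrite /a /A1 /T/= /D !coefZ !coefD !coef1 !coefX addr0 add0r mulr1.
by split; apply: T_step_gt0.
Qed.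

Local Lemma T_gt0 m l : (0 < l <= p)%N -> (l <= m.+1)%N -> 0 < (T m)`_l.
Proof.
move=> /andP[l0 lp]; elim: m l l0 lp => [|m IH] l l0 lp.
  by rewrite leq_eqVlt ltnNge l0 orbF => /eqP ->; have [] := T01_gt0 0.
have [am Am] := T01_gt0 m.
case: l l0 lp => [//|[|l]] _ lp lm; first by have [] := T01_gt0 m.+1.
have Tl : 0 < (T m)`_l.+1 by apply: IH => //; exact: ltnW.
have [[|[|j]]// j1 qj] := offspring_ge2.
apply: lt_le_trans (J_ge m j.+2 lp); rewrite mulr_gt0//.
apply: lt_le_trans (coef_exp_ge2 j l.+1 (T0 m)).
by rewrite !mulr_gt0// exprn_gt0.
Qed.

Let g m := linear_part m 1 setT.

Let g_cvg : g m @[m --> \oo] --> mu.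
Proof. by have := @linear_cvg 1%N setT measurableT; rewrite Rintegral_gen_size expr1. Qed.

Let A1S m : A1 m.+1 = g m * A1 m.
Proof.
rewrite /A1 TS// /g /linear_part mulrC -(RintegralZl _ measurableT (int_linear m 1)).
by apply: eq_Rintegral => x _; rewrite coef1_exp mulrC.
Qed.

Let g_gt0 m : 0 < g m.
Proof.
have [_ Am] := T01_gt0 m; have [_] := T01_gt0 m.+1.
by rewrite A1S pmulr_lgt0.
Qed.

(** Past some rank the linear factor is squeezed in an interval inside (0, 1). *)
Let late : exists m0 rho, [/\ 0 <= rho < 1, forall m, (m0 <= m)%N -> mu / 2 <= g m <= rho,
   forall m, (m0 <= m)%N -> a m <= (1 + kappa) / 2 & A1 m0 <= 1].
Proof.
have mu12 : mu < (1 + mu) / 2 by have := mu_lt1; lra.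
have mu2 : mu / 2 < mu by have := mu_gt0; lra.
have k2 : 1 < (1 + kappa) / 2 by have := kappa1; lra.
have rho01 : 0 <= (1 + mu) / 2 < 1 by apply/andP; have := mu_lt1; have := mu_ge0; lra.
have [m1 _ H1] := cvgr_ge _ g_cvg _ mu2.
have [m2 _ H2] := cvgr_le _ g_cvg _ mu12.
have [m3 _ H3] := cvgr_le _ a_cvg _ k2.
pose m4 := maxn m1 (maxn m2 m3).
have A1i i : A1 (m4 + i) <= ((1 + mu) / 2) ^+ i * A1 m4.
  elim: i => [|i IH]; first by rewrite addn0 mul1r.
  rewrite addnS A1S exprS -mulrA ler_pM ?(ltW (g_gt0 _))//; first exact: T0.
  by apply: H2; rewrite /= (leq_trans _ (leq_addr _ _))// !leq_max leqnn orbT.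
have : ((1 + mu) / 2) ^+ i * A1 m4 @[i --> \oo] --> (0 : R).
  rewrite -[X in _ --> X](mul0r (A1 m4)); apply: cvgMr_tmp; apply: cvg_expr.
  by case/andP: rho01 => ? ?; rewrite ger0_norm.
move=> /cvgr_le/(_ _ ltr01)[i _ /(_ i (leqnn i))/= Hi].
exists (m4 + i)%N, ((1 + mu) / 2); split => //.
- move=> m mi; have mm : (m4 <= m)%N := leq_trans (leq_addr _ _) mi.
  by rewrite H1 ?H2//= (leq_trans _ mm)// !leq_max leqnn ?orbT.
- move=> m mi; have mm : (m4 <= m)%N := leq_trans (leq_addr _ _) mi.
  by apply: H3; rewrite /= (leq_trans _ mm)// !leq_max leqnn !orbT.
- exact: le_trans (A1i i) Hi.
Qed.

Let flat (l : nat) (C : R) : {poly R} := \poly_(i < l.+1) (if i == 0%N then 0 else C).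

Let flat_nneg l C : 0 <= C -> poly_nneg (flat l C).
Proof. by move=> C0 i; rewrite coef_poly; do 2 case: ifP => //. Qed.

Let flat0 l C : (flat l C)`_0 = 0. Proof. by rewrite coef_poly. Qed.

Let flatE l C i : (0 < i <= l)%N -> (flat l C)`_i = C.
Proof. by move=> /andP[i0 il]; rewrite coef_poly ltnS il; case: i i0 il. Qed.

(** All coefficients of positive index are of the order of [A1]: the recursion
    [T_(m+1)(l) = g_m T_m(l) + O(A1_m ^ 2)] makes [T_m(l) / A1_m] increase by
    geometrically decreasing amounts. *)
Let T_le m0 rho : 0 <= rho < 1 -> (forall m, (m0 <= m)%N -> mu / 2 <= g m <= rho) ->
  (forall m, (m0 <= m)%N -> a m <= (1 + kappa) / 2) -> A1 m0 <= 1 ->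
  (forall i, A1 (m0 + i) <= rho ^+ i) /\
  forall l, (l <= p)%N -> exists2 C, 0 <= C &
    forall i m, (0 < i <= l)%N -> (m0 <= m)%N -> (T m)`_i <= C * A1 m.
Proof.
move=> /andP[rho0 rho1] Hg Ha HA.
have Ageo i : A1 (m0 + i) <= rho ^+ i.
  elim: i => [|i IH]; first by rewrite addn0 expr0.
  rewrite addnS A1S exprS ler_pM ?(ltW (g_gt0 _))//; first exact: T0.
  by have /andP[] := Hg _ (leq_addr i m0).
have A1le m : (m0 <= m)%N -> A1 m <= 1.
  by move=> mm; rewrite -(subnKC mm) (le_trans (Ageo _))// exprn_ile1// ltW.
split => //; elim=> [|l IH] lp; first by exists 0 => // -[].
have [C C0 HC] := IH (ltnW lp).
have [eta eta0 HB] : exists2 eta, 0 < eta & (1 + kappa) / 2 + (flat l C).[eta] <= kappa.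
  by apply: small_horner; [exact: flat_nneg|exact: flat0|have := kappa1; lra].
pose K := eta ^- l.+1 * kappa; have K0 : 0 <= K.
  by rewrite mulr_ge0 ?(ltW kappa0)// invr_ge0 exprn_ge0// ltW.
have step m : (m0 <= m)%N -> (T m.+1)`_l.+1 <= g m * (T m)`_l.+1 + A1 m ^+ 2 * K.
  move=> mm; rewrite (TS m lp) /K -{1}(Rint_kappa 1).
  have iK : P.-integrable setT (EFin \o (fun x : tree => A1 m ^+ 2 * (eta ^- l.+1 * kappa ^+ gen_size 1 x))).
    exact: (integrableZl _ _ (integrableZl _ _ (int_kappa 1))).
  have iK' : P.-integrable setT (EFin \o (fun x : tree => eta ^- l.+1 * kappa ^+ gen_size 1 x)).
    exact: (integrableZl _ _ (int_kappa 1)).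
  have iL : P.-integrable setT (EFin \o (fun x : tree => (T m)`_l.+1 * ((gen_size 1 x)%:R * a m ^+ (gen_size 1 x).-1))).
    exact: (integrableZl _ _ (int_linear m 1)).
  rewrite -(RintegralZl _ measurableT (int_kappa 1)) -(RintegralZl _ measurableT iK').
  rewrite mulrC -(RintegralZl _ measurableT (int_linear m 1)) -(RintegralD measurableT iL iK).
  apply: le_Rintegral => //.
  - by have [] := jet_mean q_dist hP 1 (ok_iter m) lp.
  - exact: (integrableD _ iL iK).
  move=> x _; have A01 : 0 <= A1 m <= 1 by rewrite A1le// andbT; exact: T0.
  have [|_] := @coef_exp_linear_part _ (T m) (flat l C) (gen_size 1 x) l.+1 (A1 m) _ eta kappa
    (T0 m) (flat_nneg l C0) (flat0 l C) A01 (Ha m mm) eta0 _ HB (ltn0Sn l).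
    by move=> i /andP[i0 il]; rewrite flatE ?i0//= mulrC HC ?i0.
  by rewrite [X in _ <= X + _ -> _]mulrC.
have mu2 : 0 < mu / 2 by rewrite divr_gt0// mu_gt0.
have rho1' : 0 < 1 - rho by rewrite subr_gt0.
have A1_gt0 m : 0 < A1 m by have [] := T01_gt0 m.
pose c := K / (mu / 2); have c0 : 0 <= c by rewrite divr_ge0// ltW.
pose Y i := (T m0)`_l.+1 / A1 m0 + c * (1 - rho ^+ i) / (1 - rho).
have Y0 : 0 <= (T m0)`_l.+1 / A1 m0 by rewrite divr_ge0 ?(ltW (A1_gt0 _))//; exact: T0.
have Yge0 i : 0 <= Y i.
  rewrite addr_ge0// divr_ge0 ?(ltW rho1')// mulr_ge0// subr_ge0 exprn_ile1//.
  exact: ltW.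
have HY i : (T (m0 + i))`_l.+1 <= Y i * A1 (m0 + i).
  elim: i => [|i IHi].
    by rewrite /Y addn0 expr0 subrr mulr0 mul0r addr0 divfK// gt_eqF.
  rewrite addnS; apply: le_trans (step _ (leq_addr i m0)) _.
  set m := (m0 + i)%N in IHi *; have gm := g_gt0 m.
  have /andP[gmu _] := Hg m (leq_addr i m0).
  have -> : Y i.+1 = Y i + c * rho ^+ i.
    rewrite /Y -addrA; congr (_ + _); apply: (@mulIf _ (1 - rho)); first by rewrite gt_eqF.
    by rewrite mulrDl !divfK ?gt_eqF// exprS; ring.
  rewrite A1S mulrDl lerD//; first by rewrite mulrCA ler_wpM2l// ltW.
  have AK : A1 m * K <= c * rho ^+ i * g m.
    apply: (@le_trans _ _ (c * rho ^+ i * (mu / 2))); last first.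
      by rewrite ler_wpM2l// mulr_ge0// exprn_ge0.
    by rewrite mulrAC /c divfK ?gt_eqF// mulrC ler_wpM2l// Ageo.
  rewrite [leLHS](_ : _ = A1 m * K * A1 m); last by ring.
  by rewrite [leRHS]mulrA ler_wpM2r// ltW.
pose Yoo := (T m0)`_l.+1 / A1 m0 + c / (1 - rho).
have Yle i : Y i <= Yoo.
  rewrite lerD2l ler_wpM2r ?invr_ge0 ?(ltW rho1')// ler_piMr//.
  by rewrite gerBl exprn_ge0.
exists (Num.max C Yoo); first by rewrite le_max C0.
move=> i m /andP[i0]; rewrite leq_eqVlt => /predU1P[->|il] mm.
  rewrite -(subnKC mm); apply: le_trans (HY _) _.
  by rewrite ler_wpM2r ?(ltW (A1_gt0 _))// le_max Yle orbT.
apply: (@le_trans _ _ (C * A1 m)); first by apply: HC => //; rewrite i0.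
by rewrite ler_wpM2r ?(ltW (A1_gt0 _))// le_max lexx.
Qed.

(** Since [A1 m] tends to 0, only the linear term survives after division by
    [T_m(p)]. *)
Local Lemma weighted_cvg n (A : set tree) : measurable A ->
  weighted m n A / (T m)`_p @[m --> \oo] --> \int[P]_(x in A) (gen_size n x)%:R.
Proof.
move=> mA; have [m0 [rho [rho01 Hg Ha HA]]] := late.
have [Ageo TB] := T_le rho01 Hg Ha HA; have [C C0 HC] := TB p (leqnn p).
have [rho0 rho1] := andP rho01.
have A1le m : (m0 <= m)%N -> A1 m <= 1.
  by move=> mm; rewrite -(subnKC mm) (le_trans (Ageo _))// exprn_ile1// ltW.
have [eta eta0 HB] : exists2 eta, 0 < eta & (1 + kappa) / 2 + (flat p C).[eta] <= kappa.
  by apply: small_horner; [exact: flat_nneg|exact: flat0|have := kappa1; lra].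
have A1_gt0 m : 0 < A1 m by have [] := T01_gt0 m.
pose K := eta ^- p * kappa; have K0 : 0 <= K.
  by rewrite mulr_ge0 ?(ltW kappa0)// invr_ge0 exprn_ge0// ltW.
pose m1 := maxn m0 p; pose c := (T m1)`_p / A1 m1.
have Tp m : (p <= m)%N -> 0 < (T m)`_p.
  by move=> pm; apply: T_gt0; rewrite ?p0 ?leqnn// (leq_trans pm).
have c0 : 0 < c by rewrite divr_gt0// Tp// leq_maxr.
(* the ratio [T_m(p) / A1_m] is nondecreasing *)
have cT i : c * A1 (m1 + i) <= (T (m1 + i))`_p.
  elim: i => [|i IH]; first by rewrite addn0 divfK// gt_eqF.
  rewrite addnS A1S mulrCA; apply: le_trans (ler_wpM2l (ltW (g_gt0 _)) IH) _.
  set m := (m1 + i)%N in IH *.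
  rewrite (TS m (leqnn p)) mulrC -(RintegralZl _ measurableT (int_linear m 1)).
  apply: le_Rintegral => //.
  - exact: (integrableZl _ _ (int_linear m 1)).
  - by have [] := jet_mean q_dist hP 1 (ok_iter m) (leqnn p).
  move=> x _; rewrite mulrC coef_exp_binomial; case: {+}p p0 => // p' _.
  rewrite !big_ord_recl/= expr0 coef1 mulr0 add0r /bump /= !add1n bin1 expr1 subn1.
  have U0 : poly_nneg (T m - ((T m)`_0)%:P).
    by move=> j; rewrite coefB coefC; case: eqP => [->|_]; rewrite ?subrr ?subr0//; exact: T0.
  rewrite coefB coefC subr0 lerDl sumr_ge0// => j _.
  by rewrite !mulr_ge0 ?exprn_ge0 ?poly_nnegX//; exact: T0.
have A1_0 : A1 m @[m --> \oo] --> (0 : R).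
  rewrite -(cvg_shiftn m0); under eq_fun do rewrite addnC.
  apply: (@squeeze_cvgr _ _ _ _ (fun=> 0) (fun i => rho ^+ i)).
  - by apply: nearW => i /=; rewrite Ageo andbT ltW.
  - exact: cvg_cst.
  - by apply: cvg_expr; rewrite ger0_norm.
have upper : linear_part m n A + A1 m * (K / c) @[m --> \oo] --> \int[P]_(x in A) (gen_size n x)%:R.
  rewrite -[X in _ --> X]addr0 -[X in _ --> _ + X](mul0r (K / c)).
  by apply: cvgD; [exact: linear_cvg|exact: cvgMr_tmp].
apply: (squeeze_cvgr _ (linear_cvg (n := n) mA) upper); near=> m.
have mm1 : (m1 <= m)%N by near: m; exists m1.
have mm0 : (m0 <= m)%N by rewrite (leq_trans _ mm1)// leq_maxl.
have pm : (p <= m)%N by rewrite (leq_trans _ mm1)// leq_maxr.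
have Tpm := Tp m pm.
have iL : P.-integrable A (EFin \o (fun x : tree => (T m)`_p * ((gen_size n x)%:R * a m ^+ (gen_size n x).-1))).
  exact: (integrableS measurableT mA (@subsetT _ _) (integrableZl _ _ (int_linear m n))).
have iL' : P.-integrable A (EFin \o (fun x : tree => (gen_size n x)%:R * a m ^+ (gen_size n x).-1)).
  exact: (integrableS measurableT mA (@subsetT _ _) (int_linear m n)).
have iK' : P.-integrable setT (EFin \o (fun x : tree => eta ^- p * kappa ^+ gen_size n x)).
  exact: (integrableZl _ _ (int_kappa n)).
have iK : P.-integrable setT (EFin \o (fun x : tree => A1 m ^+ 2 * (eta ^- p * kappa ^+ gen_size n x))).
  exact: (integrableZl _ _ iK').
have iKA := integrableS measurableT mA (@subsetT _ _) iK.
have iW : P.-integrable A (EFin \o (fun x : tree => (T m ^+ gen_size n x)`_p)).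
  have [iW _] := jet_mean q_dist hP n (ok_iter m) (leqnn p).
  exact: (integrableS measurableT mA (@subsetT _ _) iW).
have bound (x : tree) :
    (T m)`_p * ((gen_size n x)%:R * a m ^+ (gen_size n x).-1) <= (T m ^+ gen_size n x)`_p /\
    (T m ^+ gen_size n x)`_p <= (T m)`_p * ((gen_size n x)%:R * a m ^+ (gen_size n x).-1)
      + A1 m ^+ 2 * (eta ^- p * kappa ^+ gen_size n x).
  have A01 : 0 <= A1 m <= 1 by rewrite A1le// andbT; exact: T0.
  have [|? ?] := @coef_exp_linear_part _ (T m) (flat p C) (gen_size n x) p (A1 m) _ eta kappa
    (T0 m) (flat_nneg p C0) (flat0 p C) A01 (Ha m mm0) eta0 _ HB p0.
    by move=> i /andP[i0 ip]; rewrite flatE ?i0/= ?(ltnW ip)// mulrC HC ?i0 ?(ltnW ip).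
  by rewrite mulrC; split.
apply/andP; split.
  rewrite ler_pdivlMr// mulrC /linear_part -(RintegralZl _ mA iL').
  by apply: le_Rintegral => // x _; have [] := bound x.
rewrite ler_pdivrMr//.
have W1 : weighted m n A <= linear_part m n A * (T m)`_p + A1 m ^+ 2 * K.
  rewrite mulrC /linear_part -(RintegralZl _ mA iL').
  apply: (@le_trans _ _ (\int[P]_(x in A) ((T m)`_p * ((gen_size n x)%:R * a m ^+ (gen_size n x).-1)) +
     \int[P]_(x in A) (A1 m ^+ 2 * (eta ^- p * kappa ^+ gen_size n x)))).
    rewrite -(RintegralD mA iL iKA); apply: le_Rintegral => //.
      exact: (integrableD _ iL iKA).
    by move=> x _; have [] := bound x.
  rewrite lerD2l /K -[X in _ * (_ * X)](Rint_kappa n).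
  rewrite -(RintegralZl _ measurableT (int_kappa n)) -(RintegralZl _ measurableT iK').
  rewrite Rintegral_mkcond; apply: le_Rintegral => //.
    by rewrite -restrict_EFin; exact: (integrable_mkcond _ mA).1.
  move=> x _; rewrite patchE; case: ifP => // _.
  by rewrite mulr_ge0 ?exprn_ge0 ?(T0 m)// mulr_ge0 ?exprn_ge0 ?(ltW kappa0)// invr_ge0 exprn_ge0// ltW.
apply: le_trans W1 _; rewrite mulrDl lerD2l.
have := cT (m - m1)%N; rewrite subnKC// => cTm.
have Kc0 : 0 <= A1 m * (K / c) by rewrite mulr_ge0 ?(T0 m)// divr_ge0// ltW.
rewrite [leRHS]mulrC; apply: le_trans (ler_wpM2r Kc0 cTm).
have KE : c * (K / c) = K by rewrite mulrC divfK// gt_eqF.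
rewrite le_eqVlt; apply/orP; left; apply/eqP; rewrite -{1}KE.
by set k := K / c; clearbody k; ring.
Unshelve. all: by end_near. Qed.

End PositiveOrder.

Lemma subcritical_cvg n (A : set tree) : p = 0%N \/ 0 < s -> filtr n A ->
  ('E_P[(fun t : tree => Hpol p (gen_size (m + n) t)%:R * s ^+ gen_size (m + n) t * \1_A t)%R]
    / 'E_P[(fun t : tree => Hpol p (gen_size (m + n) t)%:R * s ^+ gen_size (m + n) t)%R])%E
  @[m --> \oo] -->
  (if p == 0%N then 'E_P[(\1_A : tree -> R)]
   else 'E_P[(fun t : tree => (gen_size n t)%:R / mu ^+ n * \1_A t)%R])%E.
Proof.
move=> ps nA; have mA := filtr_measurable nA.
under eq_cvg do rewrite (weighted_mean _ nA) weighted_meanT.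
case: eqVneq => [p0|p0].
  have -> : 'E_P[(\1_A : tree -> R)]%E = ((\int[P]_(x in A) 1) / 1)%:E.
    rewrite divr1 -(expectation_indicE mA); last exact: integrable_cst.
    by congr expectation; apply/funext => t; rewrite mul1r.
  apply: (@EFin_div_cvg _ (fun=> 1)); rewrite ?oner_neq0//; first exact: nearW.
    by under eq_fun do rewrite divr1; exact: weighted_cvg0.
  have := weighted_cvg0 n p0 measurableT; rewrite Rintegral_probability_cst.
  by move=> WT; under eq_fun do rewrite divr1; exact: WT.
have s_gt0 : 0 < s by case: ps => // /eqP; rewrite (negbTE p0).
have p_gt0 : (0 < p)%N by rewrite lt0n.
have iZ : P.-integrable A (EFin \o (fun t : tree => (gen_size n t)%:R / mu ^+ n)).
  exact: (integrableS measurableT mA (@subsetT _ _) (integrableZr _ _ (integrable_gen_size n))).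
rewrite (expectation_indicE mA iZ) RintegralZr//; last first.
  exact: (integrableS measurableT mA (@subsetT _ _) (integrable_gen_size n)).
have mun : mu ^+ n != 0 by rewrite expf_neq0// gt_eqF// mu_gt0.
apply: (@EFin_div_cvg _ (fun m => (T m)`_p)) => //.
- near=> m; rewrite gt_eqF//; apply: T_gt0 => //; first by rewrite p_gt0 leqnn.
  by near: m; exists p => // m /= /leq_trans; apply.
- exact: weighted_cvg.
- by rewrite -(Rintegral_gen_size n); exact: weighted_cvg.
Unshelve. all: by end_near. Qed.

End Subcritical.

(** * Moments of a Laplace transform *)

Section LaplaceMoments.
Context {R : realType} d (T : measurableType d) (P : probability T R).
Variable W : T -> R.
Hypotheses (mW : measurable_fun setT W) (W0 : forall x, 0 <= W x).
Implicit Types (b c : R) (l : nat).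

Definition laplace_moment l b : R := \int[P]_x (W x ^+ l * expR (- (b * W x))).

Lemma expR_cvg (u : nat -> R) (x : R) : u m @[m --> \oo] --> x ->
  expR (u m) @[m --> \oo] --> expR x.
Proof. by move=> ux; exact: (cvg_comp _ _ ux (@continuous_expR R x)). Qed.

Lemma pow_expR_bound l b y : 0 < b -> 0 <= y ->
  y ^+ l * expR (- (b * y)) <= l`!%:R / b ^+ l.
Proof.
move=> b0 y0; rewrite expRN ler_pdivrMr ?expR_gt0// mulrAC ler_pdivlMr ?exprn_gt0//.
have by0 : 0 <= b * y by rewrite mulr_ge0// ltW.
rewrite mulrC -exprMn; case: l => [|l].
  by rewrite expr0 mul1r (le_trans _ (expR_ge1Dx _))// lerDl.
rewrite [leRHS]mulrC -ler_pdivrMr ?ltr0n ?fact_gt0//.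
by rewrite (le_trans _ (expR_ge1Dxn l by0))// lerDr.
Qed.

Lemma measurable_pow_expR l b : measurable_fun setT (fun x => W x ^+ l * expR (- (b * W x))).
Proof.
apply: measurable_funM; first exact: measurable_funX.
apply: (@measurableT_comp _ _ _ _ _ _ (@expR R)); first exact: measurable_expR.
by apply: measurable_funN; apply: measurable_funM => //; exact: measurable_cst.
Qed.

Lemma pow_expR_ge0 l b x : 0 <= W x ^+ l * expR (- (b * W x)).
Proof. by rewrite mulr_ge0 ?exprn_ge0// expR_ge0. Qed.

Lemma pow_expR_le l b x : 0 <= b -> W x ^+ l * expR (- (b * W x)) <= W x ^+ l.
Proof.
move=> b0; rewrite ler_piMr ?exprn_ge0// -expR0 ler_expR oppr_le0.
by rewrite mulr_ge0.
Qed.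

Lemma laplace_moment_ge0 l b : 0 <= laplace_moment l b.
Proof. by apply: Rintegral_ge0 => x _; exact: pow_expR_ge0. Qed.

Lemma pow_expR_integrable l b : 0 < b ->
  P.-integrable setT (EFin \o (fun x => W x ^+ l * expR (- (b * W x)))).
Proof.
move=> b0; apply: (integrable_le _ _ (integrable_cst P (l`!%:R / b ^+ l) measurableT)) => //.
  exact: measurable_pow_expR.
by move=> x _; rewrite ger0_norm ?pow_expR_ge0// pow_expR_bound.
Qed.

Lemma pow_integrable_expR l b : 0 <= b -> P.-integrable setT (EFin \o (fun x => W x ^+ l)) ->
  P.-integrable setT (EFin \o (fun x => W x ^+ l * expR (- (b * W x)))).
Proof.
move=> b0 iW; apply: (integrable_le _ _ iW) => //; first exact: measurable_pow_expR.
by move=> x _; rewrite ger0_norm ?pow_expR_ge0// pow_expR_le.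
Qed.

Lemma laplace_moment_cvg0 l (u : nat -> R) : (forall k, 0 <= u k) ->
  u k @[k --> \oo] --> (0 : R) ->
  P.-integrable setT (EFin \o (fun x => W x ^+ l)) ->
  laplace_moment l (u k) @[k --> \oo] --> laplace_moment l 0.
Proof.
move=> u0 uc iW; apply: (proj2 (@Rintegral_dominated_cvg _ _ R P setT
  (fun k x => W x ^+ l * expR (- (u k * W x))) _ (fun x => W x ^+ l) measurableT _ _ _ iW _)).
- by move=> k; exact: measurable_pow_expR.
- exact: measurable_pow_expR.
- apply: aeW => x _; apply: cvgMl_tmp; apply: expR_cvg; apply: cvgN.
  exact: cvgMr_tmp.
- by apply: aeW => x k _; rewrite ger0_norm ?pow_expR_ge0// pow_expR_le.
Qed.

(** Monotone convergence along [b = 1 / (k + 1)]. *)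
Lemma pow_integrable l (C : R) : (forall b, 0 < b -> laplace_moment l b <= C) ->
  P.-integrable setT (EFin \o (fun x => W x ^+ l)).
Proof.
move=> HC; pose u k : R := k.+1%:R^-1.
have u0 k : 0 < u k by rewrite invr_gt0.
have uc : u k @[k --> \oo] --> (0 : R) by exact: cvg_harmonic.
have := @cvg_monotone_convergence _ _ R P setT measurableT
  (fun k x => (W x ^+ l * expR (- (u k * W x)))%:E).
move=> /(_ (fun k => (measurable_EFinP _ _).2 (measurable_pow_expR l (u k)))).
have g0 k x : setT x -> (0 <= (W x ^+ l * expR (- (u k * W x)))%:E)%E.
  by move=> _; rewrite lee_fin pow_expR_ge0.
move=> /(_ g0); have nd x : setT x -> {homo (fun k => (W x ^+ l * expR (- (u k * W x)))%:E)
    : n m / (n <= m)%N >-> (n <= m)%E}.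
  move=> _ n m nm; rewrite lee_fin ler_wpM2l ?exprn_ge0// ler_expR lerN2 ler_wpM2r//.
  by rewrite lef_pV2 ?posrE// ler_nat.
move=> /(_ nd) cv.
have limE x : limn (fun k => (W x ^+ l * expR (- (u k * W x)))%:E) = (W x ^+ l)%:E.
  apply/cvg_lim => //; apply/cvg_EFin; first exact: nearW.
  rewrite /comp /= -[X in _ --> X]mulr1; apply: cvgMl_tmp.
  rewrite -expR0 -oppr0 -(mul0r (W x)); apply: expR_cvg; apply: cvgN.
  exact: cvgMr_tmp.
apply/integrableP; split; first by apply/measurable_EFinP; exact: measurable_funX.
have -> : (\int[P]_x `|(EFin \o (fun x => W x ^+ l)%R) x| =
    \int[P]_x limn (fun k => (W x ^+ l * expR (- (u k * W x)))%R%:E))%E.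
  by apply: eq_integral => x _; rewrite limE gee0_abs// lee_fin exprn_ge0.
move/cvg_lim : (cv) => <- //.
apply: (@le_lt_trans _ _ C%:E); last exact: ltry.
apply: lime_le; first by apply/cvg_ex; eexists; exact: cv.
apply: nearW => k; have := HC (u k) (u0 k); rewrite -lee_fin; apply: le_trans.
by rewrite /laplace_moment /Rintegral fineK// integrable_fin_num//; exact: pow_expR_integrable.
Qed.

Lemma laplace_moment_gt0 l b : (l = 0%N \/ ~ {ae P, forall x, W x = 0}) ->
  P.-integrable setT (EFin \o (fun x => W x ^+ l * expR (- (b * W x)))) ->
  0 < laplace_moment l b.
Proof.
move=> lW iWe; rewrite lt_neqAle laplace_moment_ge0 andbT; apply/eqP => H.
have : (\int[P]_x `|(W x ^+ l * expR (- (b * W x)))%:E| = 0)%E.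
  under eq_integral => x _ do rewrite gee0_abs ?lee_fin ?pow_expR_ge0//.
  rewrite -[LHS]fineK ?integrable_fin_num//.
  by congr EFin; exact: esym H.
move/ae_eq_integral_abs => /(_ measurableT).
have mWe := (measurable_EFinP _ _).2 (measurable_pow_expR l b).
move=> /(_ mWe) ae0; case: lW => [l0|]; last first.
  apply; case: ae0 => N [mN N0 sN]; exists N; split => // x /= Wx; apply: sN => /= /(_ I).
  move=> [] /eqP; rewrite mulf_eq0 (gt_eqF (expR_gt0 _)) orbF expf_eq0 => /andP[_ /eqP].
  exact: Wx.
case: ae0 => N [mN N0 sN]; have : (P setT <= P N)%E.
  apply: le_measure; rewrite ?inE// => x _; apply: sN => /= /(_ I) [] /eqP.
  by rewrite l0 expr0 mul1r gt_eqF// expR_gt0.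
move: N0 => /= ->; rewrite (_ : P setT = 1%E); last exact: probability_setT.
by rewrite lee_fin ler10.
Qed.

Lemma is_derive_pow_expR l c x :
  is_derive c (1 : R) (fun c => W x ^+ l * expR (- (c * W x)))
    (- (W x ^+ l.+1 * expR (- (c * W x)))).
Proof.
have dg : is_derive c (1 : R) (fun c : R => - (c * W x)) (- W x).
  have -> : (fun c : R => - (c * W x)) = (- W x) \*: id.
    by apply/funext => y; rewrite /= /GRing.scale/= mulNr mulrC.
  by apply: is_derive_eq; rewrite /GRing.scale/= mulr1.
have de : is_derive c (1 : R) (expR \o (fun c : R => - (c * W x)))
    (expR (- (c * W x)) * - W x).
  exact: is_derive1_comp.
have -> : (fun c => W x ^+ l * expR (- (c * W x))) =
    (W x ^+ l) \*: (expR \o (fun c : R => - (c * W x))) by [].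
apply: is_derive_eq; rewrite /GRing.scale/= exprS; ring.
Qed.

Lemma is_derive_laplace_moment l b : 0 < b ->
  is_derive b (1 : R) (laplace_moment l) (- laplace_moment l.+1 b).
Proof.
move=> b0; pose f c x := W x ^+ l * expR (- (c * W x)).
have b20 : 0 < b / 2 by rewrite divr_gt0.
have bI : b \in `]b / 2, (b + 1)[ by rewrite in_itv/=; apply/andP; split; lra.
have I0 c : `]b / 2, b + 1[%classic c -> 0 < c.
  by rewrite /= in_itv/= => /andP[bc _]; exact: lt_trans bc.
have d1 c x : derive1 (f ^~ x) c = - (W x ^+ l.+1 * expR (- (c * W x))).
  by rewrite derive1E; have := is_derive_pow_expR l c x => /(@derive_val _ _ _ _ _ _ _) ->.
have fI c : `]b / 2, b + 1[%classic c -> P.-integrable setT (EFin \o f c).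
  by move=> cI; apply: pow_expR_integrable; exact: I0.
have fD c x : `]b / 2, b + 1[%classic c -> setT x -> derivable (f ^~ x) c 1.
  by move=> _ _; have [] := is_derive_pow_expR l c x.
have GI := pow_expR_integrable l.+1 b20.
have fG c x : `]b / 2, b + 1[%classic c -> setT x ->
    `|partial1of2 f c x| <= W x ^+ l.+1 * expR (- (b / 2 * W x)).
  rewrite /= in_itv/= => /andP[bc _] _.
  rewrite /partial1of2 d1 normrN ger0_norm ?pow_expR_ge0// ler_wpM2l ?exprn_ge0//.
  by rewrite ler_expR lerN2 ler_wpM2r// ltW.
have G0 := pow_expR_ge0 l.+1 (b / 2).
apply: DeriveDef.
  exact: (derivable_under_integral measurableT bI fI fD G0 GI fG).
rewrite -derive1E (differentiation_under_integral measurableT bI fI fD G0 GI fG).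
have i1 := pow_expR_integrable l.+1 b0.
rewrite -mulN1r -(RintegralZl _ measurableT i1).
by apply: eq_Rintegral => x _; rewrite /partial1of2 d1 mulN1r.
Qed.

(** The difference quotients of [y ^ l exp (- h y)] at 0 are dominated by
    [y ^ (l + 1)], because [1 - exp (- u) <= u]. *)
Lemma laplace_moment_right_derivative l :
  P.-integrable setT (EFin \o (fun x => W x ^+ l)) ->
  P.-integrable setT (EFin \o (fun x => W x ^+ l.+1)) ->
  (laplace_moment l h - laplace_moment l 0) / h @[h --> 0^'+] --> - laplace_moment l.+1 0.
Proof.
move=> iW iW'; apply/cvg_at_rightP => u [u0 uc].
pose g (h : R) x := (W x ^+ l * expR (- (h * W x)) - W x ^+ l) / h.
have i0 h : 0 <= h -> _ := fun h0 => pow_integrable_expR h0 iW.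
have gE k : (laplace_moment l (u k) - laplace_moment l 0) / u k = \int[P]_x g (u k) x.
  have ik : P.-integrable setT (EFin \o (fun x => W x ^+ l * expR (- (u k * W x)) - W x ^+ l)).
    exact: (integrableB _ (i0 _ (ltW (u0 k))) iW).
  rewrite /g (RintegralZr _ measurableT ik) (RintegralB measurableT (i0 _ (ltW (u0 k))) iW).
  congr ((_ - _) / _); apply: eq_Rintegral => x _.
  by rewrite mul0r oppr0 expR0 mulr1.
under eq_fun do rewrite gE.
have -> : - laplace_moment l.+1 0 = \int[P]_x (- W x ^+ l.+1).
  rewrite -mulN1r -(RintegralZl _ measurableT (pow_integrable_expR (lexx 0) iW')).
  by apply: eq_Rintegral => x _; rewrite mul0r oppr0 expR0 mulr1 mulN1r.
have gM h x : g h x = W x ^+ l * ((expR (- (h * W x)) - 1) / h).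
  by rewrite /g mulrA mulrBr mulr1.
have g1 h x : 0 < h -> - W x <= (expR (- (h * W x)) - 1) / h.
  move=> h0; rewrite ler_pdivlMr// mulNr mulrC lerBrDl.
  exact: expR_ge1Dx.
have g2 h x : 0 < h -> (expR (- (h * W x)) - 1) / h <= - (W x * expR (- (h * W x))).
  move=> h0; rewrite ler_pdivrMr//; set E := expR _.
  have : E * (1 + h * W x) <= 1.
    by rewrite /E expRN mulrC ler_pdivrMr ?expR_gt0// mul1r expR_ge1Dx.
  have -> : - (W x * E) * h = - (E * (h * W x)) by ring.
  by rewrite mulrDr mulr1; lra.
apply: (proj2 (@Rintegral_dominated_cvg _ _ R P setT (fun k => g (u k)) _
  (fun x => W x ^+ l.+1) measurableT _ _ _ iW' _)).
- move=> k; apply: measurable_funM; last exact: measurable_cst.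
  by apply: measurable_funB; [exact: measurable_pow_expR|exact: measurable_funX].
- by apply: measurable_funN; exact: measurable_funX.
- apply: aeW => x _; under eq_fun do rewrite gM.
  rewrite exprSr -mulrN; apply: cvgMl_tmp.
  apply: (@squeeze_cvgr _ _ _ _ (fun=> - W x) (fun k => - (W x * expR (- (u k * W x))))).
  + by apply: nearW => k; rewrite g1 ?g2.
  + exact: cvg_cst.
  + apply: cvgN; rewrite -[X in _ --> X]mulr1; apply: cvgMl_tmp.
    rewrite -expR0 -oppr0 -(mul0r (W x)); apply: expR_cvg; apply: cvgN.
    exact: cvgMr_tmp.
- apply: aeW => x k _; rewrite gM normrM ger0_norm ?exprn_ge0// exprSr ler_wpM2l ?exprn_ge0//.
  rewrite ler_norml g1//= (le_trans (g2 _ _ (u0 k)))// (le_trans _ (W0 x))//.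
  by rewrite oppr_le0 mulr_ge0// expR_ge0.
Qed.

(** Differentiation under the integral for [0 < b]; the derivative at 0 is the
    one of [laplace_moment_right_derivative], and asks for finite moments. *)
Lemma der0n_laplace (phi : R -> R) n :
  (forall b, phi b = laplace_moment 0 b) ->
  (forall l, (l <= n)%N -> P.-integrable setT (EFin \o (fun x => W x ^+ l))) ->
  forall l b, 0 <= b -> 0 < b \/ (l <= n)%N -> der0n l phi b = (- 1) ^+ l * laplace_moment l b.
Proof.
move=> phiE iW; elim=> [|l IH] b b0 bn; first by rewrite /der0n /= phiE expr0 mul1r.
rewrite /der0n iterS -/(der0n l phi) /der0; case: eqP => [b_eq0|/eqP b_neq0].
  have ln : (l.+1 <= n)%N by case: bn; rewrite ?b_eq0 ?ltxx.
  rewrite b_eq0; apply/cvg_lim => //.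
  have H : (fun h => (-1) ^+ l * ((laplace_moment l h - laplace_moment l 0) / h)) h
      @[h --> 0^'+] --> (-1) ^+ l.+1 * laplace_moment l.+1 0.
    rewrite exprSr -mulrA mulN1r; apply: cvgMl_tmp.
    by apply: laplace_moment_right_derivative; apply: iW => //; exact: ltnW.
  apply: cvg_trans H; apply: near_eq_cvg; near=> h.
  have h0 : 0 < h by near: h; exact: nbhs_right_gt.
  rewrite !IH ?(ltW h0)//; [by rewrite -mulrBr mulrA|by right; exact: ltnW|by left].
have b_gt0 : 0 < b by rewrite lt_neqAle eq_sym b_neq0.
rewrite derive1E (@near_eq_derive _ _ _ _ ((-1) ^+ l \*: laplace_moment l)).
  have dl := is_derive_laplace_moment l b_gt0.
  by rewrite derive_val exprSr -mulrA mulN1r.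
near=> c; have c0 : 0 < c by near: c; exact: lt_nbhsr.
by rewrite IH ?(ltW c0)//; left.
Unshelve. all: by end_near. Qed.

End LaplaceMoments.

(** * Super-critical process: factorial moments *)

Section Supercritical.
Context {R : realType}.
Variables (q : nat -> R) (P : probability tree R) (p : nat) (mb : R).
Hypotheses (q_dist : is_distribution q) (hP : GW_law q 0 P).
Hypotheses (p_gt0 : (0 < p)%N) (mb1 : 1 < mb).
Hypothesis q_moment : forall i, (i <= p)%N -> (\sum_(n <oo) ('C(n, i)%:R * q n)%:E < +oo)%E.
Hypothesis q_mean : (\sum_(n <oo) (n%:R * q n)%:E = mb%:E)%E.

Let q0 := q_dist.1.
Let mb0 : 0 < mb := lt_trans ltr01 mb1.
Local Notation J := (genfun_jet q p).
Implicit Types D G : {poly R}.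

Let ok D : poly_nneg D -> D`_0 <= 1 -> jet_ok q p D.
Proof. by move=> D0 D1; have [] := jet_ok_moment q0 q_dist.2 q_moment D0 D1. Qed.

Let ok_iter D : poly_nneg D -> D`_0 <= 1 -> forall m, jet_ok q p (iter m J D).
Proof. by move=> D0 D1; exact: (jet_ok_iter_moment q0 q_dist.2 q_moment D0 D1). Qed.

Lemma coef_exp_top (A : {poly R}) c l j : (0 < l)%N -> A`_0 = 1 ->
  ((A + c *: 'X^l) ^+ j)`_l = (A ^+ j)`_l + j%:R * c.
Proof.
move=> l0 A0; elim: j => [|j IH]; first by rewrite !expr0 mul0r addr0.
rewrite !exprS mulrDl coefD -scalerAl coefZ coefXnM ltnn subnn coef0_exp coefD coefZ coefXn.
rewrite A0 (ltn_eqF l0) mulr0 addr0 expr1n mulr1.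
rewrite coefM [in RHS]coefM !big_ord_recl /= A0 !mul1r !subn0 IH.
have -> : \sum_(i < l) A`_(bump 0 i) * ((A + c *: 'X^l) ^+ j)`_(l - bump 0 i) =
   \sum_(i < l) A`_(bump 0 i) * (A ^+ j)`_(l - bump 0 i).
  apply: eq_bigr => i _; congr (_ * _).
  apply: (@eq_coef_exp _ (l - bump 0 i)) => // k kl.
  rewrite coefD coefZ coefXn ltn_eqF ?mulr0 ?addr0// (leq_ltn_trans kl)//.
  by rewrite ltn_subrL l0 andbT /bump add1n.
by rewrite -[j.+1%:R]natr1 mulrDl mul1r; ring.
Qed.

Lemma genfun_jet_le A B : poly_nneg A -> A`_0 <= 1 -> poly_nneg B -> B`_0 <= 1 ->
  (forall l, (l <= p)%N -> A`_l <= B`_l) -> forall l, (l <= p)%N -> (J A)`_l <= (J B)`_l.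
Proof.
move=> A0 A1 B0 B1 AB l lp; rewrite -lee_fin !(genfun_jetE q0)//; try exact: ok.
apply: lee_nneseries => [j _ _|j _]; first by rewrite lee_fin mulr_ge0// poly_nnegX.
by rewrite lee_fin ler_wpM2l//; exact: le_coef_exp lp.
Qed.

Lemma genfun_jet_scale A B c : poly_nneg A -> A`_0 <= 1 -> poly_nneg B -> B`_0 <= 1 ->
  (forall l, (l <= p)%N -> B`_l = c ^+ l * A`_l) ->
  forall l, (l <= p)%N -> (J B)`_l = c ^+ l * (J A)`_l.
Proof.
move=> A0 A1 B0 B1 AB l lp; apply: EFin_inj; rewrite EFinM !(genfun_jetE q0)//; try exact: ok.
rewrite -nneseriesZl; last by move=> j _; rewrite lee_fin mulr_ge0// poly_nnegX.
apply: eq_eseriesr => j _; rewrite -EFinM (coef_exp_scale _ AB lp).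
by congr EFin; rewrite mulrCA.
Qed.

(** A polynomial [G] with [f(G(t)) <= G(mb t)] coefficientwise dominates all the
    iterates of [1 + t], after rescaling of [t]: it bounds the normalised
    factorial moments of all generations at once. *)
Lemma dominating_jet : exists G, [/\ poly_nneg G, G`_0 = 1, 1 <= G`_1 &
  forall l, (l <= p)%N -> (J G)`_l <= mb ^+ l * G`_l].
Proof.
suff H k : (k <= p)%N -> exists G, [/\ poly_nneg G, G`_0 = 1, 1 <= G`_1 &
    forall l, (l <= k)%N -> (J G)`_l <= mb ^+ l * G`_l] by exact: H.
have JG0 G : poly_nneg G -> G`_0 = 1 -> (J G)`_0 = 1.
  move=> G0 G1; apply: EFin_inj; rewrite (genfun_jetE q0)//; last by apply: ok; rewrite ?G1.
  by rewrite -q_dist.2; apply: eq_eseriesr => j _; rewrite coef0_exp G1 expr1n mulr1.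
elim: k => [|k IH] kp.
  have G0 : poly_nneg (1 + 'X : {poly R}).
    by move=> l; rewrite coefD coef1 coefX addr_ge0.
  have G1 : (1 + 'X : {poly R})`_0 = 1 by rewrite coefD coef1 coefX addr0.
  exists (1 + 'X); split => //; first by rewrite coefD coef1 coefX add0r.
  by move=> l; rewrite leqn0 => /eqP ->; rewrite expr0 mul1r JG0// G1.
have [G [G0 G1 G11 HG]] := IH (ltnW kp).
(* The term [g X^(k+1)] contributes [g mb] to [J G] and [g mb^(k+1)] to
   [G(mb t)]; the difference absorbs the coefficient already present. *)
pose g := if k == 0%N then 0 else (J G)`_k.+1 / (mb ^+ k.+1 - mb).
have mbk : (0 < k)%N -> 0 < mb ^+ k.+1 - mb.
  by move=> k0; rewrite subr_gt0 exprS ltr_pMr// exprn_egt1// -lt0n.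
have g0 : 0 <= g.
  rewrite /g; case: eqP => // /eqP; rewrite -lt0n => k0.
  by rewrite divr_ge0 ?(ltW (mbk k0))//; exact: genfun_jet_nneg.
exists (G + g *: 'X^(k.+1)); have G'0 : poly_nneg (G + g *: 'X^(k.+1)).
  by move=> l; rewrite coefD coefZ addr_ge0// mulr_ge0// coefXn.
have G'1 : (G + g *: 'X^(k.+1))`_0 = 1 by rewrite coefD coefZ coefXn mulr0 addr0.
have G'l l : (l <= k)%N -> (G + g *: 'X^(k.+1))`_l = G`_l.
  by move=> lk; rewrite coefD coefZ coefXn ltn_eqF// mulr0 addr0.
have okG : jet_ok q p G by apply: ok => //; rewrite G1.
have okG' : jet_ok q p (G + g *: 'X^(k.+1)) by apply: ok => //; rewrite G'1.
split => //.
  by rewrite coefD (le_trans G11)// lerDl coefZ mulr_ge0// coefXn.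
move=> l; rewrite leq_eqVlt => /predU1P[->|]; last first.
  rewrite ltnS => lk; have lp : (l <= p)%N by rewrite (leq_trans lk)// ltnW.
  rewrite G'l//; apply: le_trans (HG l lk); rewrite -lee_fin !(genfun_jetE q0)//.
  rewrite le_eqVlt; apply/orP; left; apply/eqP; apply: eq_eseriesr => j _.
  congr (_ * _)%:E; apply: (@eq_coef_exp _ k) => // i ik; exact: G'l.
have -> : (J (G + g *: 'X^(k.+1)))`_k.+1 = (J G)`_k.+1 + g * mb.
  apply: EFin_inj; rewrite EFinD EFinM -q_mean !(genfun_jetE q0)// -nneseriesZl; last first.
    by move=> j _; rewrite lee_fin mulr_ge0.
  rewrite /jet_series -nneseriesD; last 2 first.
  - by move=> j _ _; rewrite lee_fin mulr_ge0// poly_nnegX.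
  - by move=> j _ _; rewrite -EFinM lee_fin !mulr_ge0.
  apply: eq_eseriesr => j _; rewrite coef_exp_top// -EFinM -EFinD.
  by congr EFin; ring.
rewrite coefD coefZ coefXn eqxx mulr1 mulrDr.
have [k0|] := posnP k.
  rewrite /g k0 mul0r mulr0 !addr0 expr1.
  (* for the linear coefficient the inequality is an equality *)
  rewrite -lee_fin (genfun_jetE q0)// EFinM -q_mean muleC -nneseriesZl; last first.
    by move=> j _; rewrite lee_fin mulr_ge0.
  rewrite le_eqVlt; apply/orP; left; apply/eqP; apply: eq_eseriesr => j _.
  by rewrite coef1_exp G1 expr1n mulr1 -EFinM; congr EFin; ring.
move=> k0; have gE : g * (mb ^+ k.+1 - mb) = (J G)`_k.+1.
  by rewrite /g gtn_eqF// divfK// gt_eqF// mbk.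
by rewrite -gE mulrBr [mb ^+ _ * g]mulrC subrK lerDr mulr_ge0// exprn_ge0// ltW.
Qed.

(** By [coef_exp_affine] the powers [z] of this jet have the coefficients
    ['C(z, l) exp (- b z / mb ^ m)], the weights put on generation [m]. *)
Definition laplace_jet (b : R) (m : nat) : {poly R} := expR (- (b / mb ^+ m)) *: (1 + 'X).

(** The mean of ['C(Z_m, l) exp (- b Z_m / mb ^ m)], divided by [mb ^ (m l)]: the
    normalisation that makes [Z_m ^ l] converge. *)
Definition norm_moment (m l : nat) (b : R) : R :=
  (iter m J (laplace_jet b m))`_l / mb ^+ (m * l).

Definition moment_jet (m : nat) (b : R) : {poly R} :=
  \poly_(l < p.+1) norm_moment m l b.

Lemma laplace_jet_nneg b m : poly_nneg (laplace_jet b m).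
Proof. by move=> l; rewrite coefZ mulr_ge0 ?expR_ge0// coefD coef1 coefX addr_ge0. Qed.

Lemma laplace_jet_le1 b m : 0 <= b -> (laplace_jet b m)`_0 <= 1.
Proof.
move=> b0; rewrite coefZ coefD coef1 coefX addr0 mulr1 -expR0 ler_expR oppr_le0.
by rewrite divr_ge0// exprn_ge0// ltW.
Qed.

Lemma laplace_jetE b m z l :
  (laplace_jet b m ^+ z)`_l = 'C(z, l)%:R * expR (- (b * z%:R / mb ^+ m)).
Proof.
by rewrite coef_exp_affine -expRM_natl; congr (_ * expR _); rewrite mulrN mulrCA mulrA.
Qed.

Lemma laplace_jetD b m n : laplace_jet b (n + m) = laplace_jet (b / mb ^+ n) m.
Proof. by rewrite /laplace_jet exprD invfM mulrA. Qed.

Let mbX_gt0 n : 0 < mb ^+ n. Proof. by rewrite exprn_gt0. Qed.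

Let mbX_neq0 n : mb ^+ n != 0. Proof. by rewrite gt_eqF. Qed.

Let ok_laplace b m i : 0 <= b -> jet_ok q p (iter i J (laplace_jet b m)).
Proof. by move=> b0; apply: ok_iter; [exact: laplace_jet_nneg|exact: laplace_jet_le1]. Qed.

Lemma norm_momentE m l b : 0 <= b -> (l <= p)%N ->
  norm_moment m l b = (\int[P]_x (laplace_jet b m ^+ gen_size m x)`_l) / mb ^+ (m * l).
Proof.
move=> b0 lp; rewrite /norm_moment.
by have [_ ->] := jet_mean q_dist hP m (fun i => ok_laplace m i b0) lp.
Qed.

Lemma norm_moment_ge0 m l b : 0 <= b -> 0 <= norm_moment m l b.
Proof. by move=> b0; rewrite divr_ge0 ?(ltW (mbX_gt0 _))//; exact: (ok_laplace m m b0).1. Qed.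

Lemma moment_jet_nneg m b : 0 <= b -> poly_nneg (moment_jet m b).
Proof. by move=> b0 l; rewrite coef_poly; case: ifP => // _; exact: norm_moment_ge0. Qed.

Lemma moment_jetE m b l : (l <= p)%N -> (moment_jet m b)`_l = norm_moment m l b.
Proof. by move=> lp; rewrite coef_poly ltnS lp. Qed.

Section Domination.
Variable G : {poly R}.
Hypotheses (G0 : poly_nneg G) (G1 : G`_0 = 1) (G11 : 1 <= G`_1).
Hypothesis JG : forall l, (l <= p)%N -> (J G)`_l <= mb ^+ l * G`_l.

Let rescaled m : {poly R} := \poly_(l < p.+1) ((mb ^+ m) ^+ l * G`_l).

Lemma iter_genfun_jet_le D m l : poly_nneg D -> D`_0 <= 1 ->
  (forall i, (i <= p)%N -> D`_i <= G`_i) -> (l <= p)%N ->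
  (iter m J D)`_l <= mb ^+ (m * l) * G`_l.
Proof.
move=> D0 D1 DG; elim: m l => [|m IH] l lp; first by rewrite mul0n expr0 mul1r DG.
have H0 : poly_nneg (rescaled m).
  by move=> i; rewrite coef_poly; case: ifP => // _; rewrite mulr_ge0// exprn_ge0// ltW.
have H1 : (rescaled m)`_0 <= 1 by rewrite coef_poly/= expr0 mul1r G1.
rewrite iterS; apply: (@le_trans _ _ (J (rescaled m))`_l).
  apply: genfun_jet_le => //.
  - exact: (ok_iter D0 D1 m).1.
  - by have := IH 0%N (leq0n p); rewrite muln0 expr0 mul1r G1.
  - by move=> i ip; rewrite coef_poly ltnS ip -exprM; exact: IH.
rewrite (@genfun_jet_scale G _ (mb ^+ m))//; first last.
- by move=> i ip; rewrite coef_poly ltnS ip.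
- by rewrite G1.
rewrite [leRHS](_ : _ = (mb ^+ m) ^+ l * (mb ^+ l * G`_l)); last first.
  by rewrite mulSn exprD exprM; ring.
by rewrite ler_wpM2l ?JG// exprn_ge0// ltW.
Qed.

Lemma norm_moment_le m l b : 0 <= b -> (l <= p)%N -> norm_moment m l b <= G`_l.
Proof.
move=> b0 lp; rewrite ler_pdivrMr// mulrC; apply: iter_genfun_jet_le => //.
- exact: laplace_jet_nneg.
- exact: laplace_jet_le1.
move=> i ip; rewrite /laplace_jet coefZ coefD coef1 coefX.
have e1 : expR (- (b / mb ^+ m)) <= 1.
  by rewrite -expR0 ler_expR oppr_le0 divr_ge0// ltW.
case: i ip => [|[|i]] _ /=; first by rewrite addr0 mulr1 G1.
  by rewrite add0r mulr1 (le_trans e1).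
by rewrite addr0 mulr0; exact: G0.
Qed.

Lemma dominating_integrable n l : (l <= p)%N ->
  P.-integrable setT (EFin \o (fun x : tree => (G ^+ gen_size n x)`_l)).
Proof.
have G1' : G`_0 <= 1 by rewrite G1.
by move=> lp; have [] := jet_mean q_dist hP n (ok_iter G0 G1') lp.
Qed.

(** Dominated convergence, [(G ^ Z_n)_l] being an integrable bound common to all
    the [V_ m]. *)
Lemma jet_power_cvg (V_ : nat -> {poly R}) (V : {poly R}) n l (A : set tree) :
  measurable A -> (l <= p)%N -> (forall m, poly_nneg (V_ m)) ->
  (forall m i, (i <= p)%N -> (V_ m)`_i <= G`_i) ->
  (forall i, (i <= p)%N -> (V_ m)`_i @[m --> \oo] --> V`_i) ->
  P.-integrable A (EFin \o (fun x : tree => (V ^+ gen_size n x)`_l)) /\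
  \int[P]_(x in A) (V_ m ^+ gen_size n x)`_l @[m --> \oo] -->
  \int[P]_(x in A) (V ^+ gen_size n x)`_l.
Proof.
move=> mA lp V0 VG VV.
apply: (@Rintegral_dominated_cvg _ _ R P A (fun m x => (V_ m ^+ gen_size n x)`_l) _
  (fun x => (G ^+ gen_size n x)`_l) mA).
- by move=> m; exact: (@measurable_gen_size R n (fun z => (V_ m ^+ z)`_l)).
- exact: (@measurable_gen_size R n (fun z => (V ^+ z)`_l)).
- by apply: aeW => x _; exact: (cvg_coef_exp VV lp).
- exact: (integrableS measurableT mA (@subsetT _ _) (dominating_integrable n lp)).
- apply: aeW => x m _; rewrite ger0_norm ?poly_nnegX//.
  by apply: (@le_coef_exp _ p) => //; exact: VG.
Qed.

End Domination.

Lemma moment_jet_integrable n m l b : 0 <= b -> (l <= p)%N ->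
  P.-integrable setT (EFin \o (fun x : tree => (moment_jet m b ^+ gen_size n x)`_l)).
Proof.
move=> b0 lp; have [G [G0 G1 G11 JG]] := dominating_jet.
apply: (integrable_le _ _ (dominating_integrable G0 G1 n lp)) => //.
  exact: (@measurable_gen_size R n (fun z => (moment_jet m b ^+ z)`_l)).
move=> x _; have Q0 := moment_jet_nneg m b0; rewrite ger0_norm ?poly_nnegX//.
apply: (@le_coef_exp _ p) => // i ip; rewrite moment_jetE//.
exact: (norm_moment_le G0 G1 G11 JG).
Qed.

Lemma weighted_jet_mean n m l b (A : set tree) : 0 <= b -> (l <= p)%N -> filtr n A ->
  \int[P]_(x in A) (laplace_jet b (n + m) ^+ gen_size (n + m) x)`_l =
  mb ^+ (m * l) * \int[P]_(x in A) (moment_jet m (b / mb ^+ n) ^+ gen_size n x)`_l.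
Proof.
move=> b0 lp nA; rewrite laplace_jetD; set b' := b / mb ^+ n.
have b'0 : 0 <= b' by rewrite divr_ge0// ltW.
have okb i := ok_laplace m i b'0.
rewrite (GW_jet_Rintegral q_dist hP m okb lp nA).
have scale z : (iter m J (laplace_jet b' m) ^+ z)`_l = mb ^+ (m * l) * (moment_jet m b' ^+ z)`_l.
  rewrite exprM; apply: (@coef_exp_scale _ p) => // i ip.
  by rewrite moment_jetE// /norm_moment exprM mulrC divfK// gt_eqF// exprn_gt0.
have mA := filtr_measurable nA.
rewrite -(RintegralZl _ mA); first by apply: eq_Rintegral => x _; rewrite scale.
exact: (integrableS measurableT mA (@subsetT _ _) (moment_jet_integrable n m b'0 lp)).
Qed.

Lemma norm_momentD n m l b : 0 <= b -> (l <= p)%N ->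
  norm_moment (n + m) l b =
  (\int[P]_x (moment_jet m (b / mb ^+ n) ^+ gen_size n x)`_l) / mb ^+ (n * l).
Proof.
move=> b0 lp; rewrite norm_momentE// (weighted_jet_mean m b0 lp (filtrT n)).
by rewrite mulnDl exprD [X in X / _]mulrC -mulf_div divff ?mulr1// gt_eqF.
Qed.

Variable W : tree -> R.
Hypotheses (mW : measurable_fun setT W) (W0 : forall x, 0 <= W x).
Hypothesis W_lim : {ae P, forall x : tree, (gen_size n x)%:R / mb ^+ n @[n --> \oo] --> W x}.

Definition limit_moment (l : nat) (b : R) : R := laplace_moment P W l b / l`!%:R.

Definition limit_jet (b : R) : {poly R} := \poly_(l < p.+1) limit_moment l b.

Lemma limit_moment_ge0 l b : 0 <= limit_moment l b.
Proof. by rewrite divr_ge0//; exact: laplace_moment_ge0. Qed.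

Lemma limit_jet_nneg b : poly_nneg (limit_jet b).
Proof. by move=> l; rewrite coef_poly; case: ifP => // _; exact: limit_moment_ge0. Qed.

Lemma limit_jetE b l : (l <= p)%N -> (limit_jet b)`_l = limit_moment l b.
Proof. by move=> lp; rewrite coef_poly ltnS lp. Qed.

Let invmb_cvg0 : (mb ^+ m)^-1 @[m --> \oo] --> (0 : R).
Proof.
under eq_fun do rewrite -exprVn; apply: cvg_expr.
by rewrite ger0_norm ?invr_ge0 ?(ltW mb0)// invf_lt1.
Qed.

Let bin_cvg l (z : nat -> nat) (w : R) : (z m)%:R / mb ^+ m @[m --> \oo] --> w ->
  'C(z m, l)%:R / mb ^+ (m * l) @[m --> \oo] --> w ^+ l / l`!%:R.
Proof.
move=> zw; have -> : (fun m => 'C(z m, l)%:R / mb ^+ (m * l)) =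
    (fun m => \prod_(j < l) (((z m)%:R - j%:R) / mb ^+ m) / l`!%:R).
  apply/funext => m; rewrite -Hpol_bin /Hpol big_split/= prodr_const card_ord exprVn -exprM.
  by rewrite -[LHS]mulrA mulrC.
apply: cvgMr_tmp; elim: l => [|l IH].
  by under eq_fun do rewrite big_ord0; rewrite expr0; exact: cvg_cst.
under eq_fun do rewrite big_ord_recr/=; rewrite exprSr; apply: cvgM => //.
under eq_fun do rewrite mulrBl; rewrite -[w]subr0; apply: cvgB => //.
by rewrite -(mulr0 l%:R); exact: cvgMl_tmp.
Qed.

Let bin_le l z m : 'C(z, l)%:R / mb ^+ (m * l) <= (z%:R / mb ^+ m) ^+ l :> R.
Proof.
rewrite expr_div_n -exprM ler_wpM2r ?invr_ge0 ?exprn_ge0 ?(ltW mb0)//.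
rewrite -natrX ler_nat (@leq_trans (z ^_ l))//.
  by rewrite -bin_ffact leq_pmulr// fact_gt0.
by elim: l => // l IH; rewrite ffactnSr expnSr leq_mul// leq_subr.
Qed.

(** Dominated convergence: [y ^ l exp (- b y)] is bounded when [0 < b]. *)
Lemma norm_moment_cvg l b : 0 < b -> (l <= p)%N ->
  norm_moment m l b @[m --> \oo] --> limit_moment l b.
Proof.
move=> b0 lp; pose f m (x : tree) : R :=
  'C(gen_size m x, l)%:R / mb ^+ (m * l) * expR (- (b * ((gen_size m x)%:R / mb ^+ m))).
have -> : (fun m => norm_moment m l b) = (fun m => \int[P]_x f m x).
  apply/funext => m; rewrite (norm_momentE m (ltW b0) lp) mulrC -(RintegralZl _ measurableT).
    by apply: eq_Rintegral => x _; rewrite laplace_jetE /f mulrCA mulrA mulrA.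
  by have [] := jet_mean q_dist hP m (fun i => ok_laplace m i (ltW b0)) lp.
have -> : limit_moment l b = \int[P]_x (W x ^+ l * expR (- (b * W x)) / l`!%:R).
  by rewrite (RintegralZr _ measurableT (pow_expR_integrable P mW W0 l b0)).
apply: (proj2 (@Rintegral_dominated_cvg _ _ R P setT f _ (fun=> l`!%:R / b ^+ l)
  measurableT _ _ _ (integrable_cst P _ measurableT) _)).
- move=> m; exact: (@measurable_gen_size R m (fun z => 'C(z, l)%:R / mb ^+ (m * l) * expR (- (b * (z%:R / mb ^+ m))))).
- by apply: measurable_funM; [exact: measurable_pow_expR|exact: measurable_cst].
- apply: ae_imp W_lim => x Wx _; rewrite mulrAC; apply: cvgM; first exact: bin_cvg.
  by apply: expR_cvg; apply: cvgN; exact: cvgMl_tmp.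
- apply: aeW => x m _; have y0 : 0 <= (gen_size m x)%:R / mb ^+ m by rewrite divr_ge0// ltW.
  rewrite ger0_norm ?mulr_ge0 ?expR_ge0// ?invr_ge0 ?exprn_ge0 ?(ltW mb0)//.
  by apply: le_trans (pow_expR_bound l b0 y0); rewrite ler_wpM2r ?expR_ge0.
Qed.

Section LimitDomination.
Variable G : {poly R}.
Hypotheses (G0 : poly_nneg G) (G1 : G`_0 = 1) (G11 : 1 <= G`_1).
Hypothesis JG : forall l, (l <= p)%N -> (J G)`_l <= mb ^+ l * G`_l.

Lemma limit_moment_le_pos l b : 0 < b -> (l <= p)%N -> limit_moment l b <= G`_l.
Proof.
move=> b0 lp; have cv := norm_moment_cvg b0 lp.
rewrite -(cvg_lim _ cv)//; apply: limr_le; first by apply/cvg_ex; eexists; exact: cv.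
by apply: nearW => m; exact: (norm_moment_le G0 G1 G11 JG m (ltW b0) lp).
Qed.

End LimitDomination.

Lemma limit_integrable l : (l <= p)%N -> P.-integrable setT (EFin \o (fun x => W x ^+ l)).
Proof.
move=> lp; have [G [G0 G1 G11 JG]] := dominating_jet.
apply: (@pow_integrable _ _ _ P W mW W0 l (G`_l * l`!%:R)) => b b0.
rewrite -ler_pdivrMr ?ltr0n ?fact_gt0//.
exact: (limit_moment_le_pos G0 G1 G11 JG).
Qed.

Lemma limit_moment_cvg0 l (u : nat -> R) : (l <= p)%N -> (forall k, 0 <= u k) ->
  u k @[k --> \oo] --> (0 : R) ->
  limit_moment l (u k) @[k --> \oo] --> limit_moment l 0.
Proof.
move=> lp u0 uc; apply: cvgMr_tmp.
by apply: laplace_moment_cvg0 => //; exact: limit_integrable.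
Qed.

Let vanishing (c : R) k : R := c / k.+1%:R.

Let vanishing_cvg c : vanishing c k @[k --> \oo] --> (0 : R).
Proof.
rewrite -[X in _ --> X](mulr0 c); apply: cvgMl_tmp; exact: cvg_harmonic.
Qed.

Lemma limit_moment_le G l b : poly_nneg G -> G`_0 = 1 -> 1 <= G`_1 ->
  (forall l, (l <= p)%N -> (J G)`_l <= mb ^+ l * G`_l) -> 0 <= b -> (l <= p)%N ->
  limit_moment l b <= G`_l.
Proof.
move=> G0 G1 G11 JG; rewrite le_eqVlt => /predU1P[<-|b0] lp; last first.
  exact: (limit_moment_le_pos G0 G1 G11 JG).
have cv := limit_moment_cvg0 lp (fun k => divr_ge0 ler01 (ler0n R k.+1)) (vanishing_cvg 1).
rewrite -(cvg_lim _ cv)//; apply: limr_le; first by apply/cvg_ex; eexists; exact: cv.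
by apply: nearW => k; apply: (limit_moment_le_pos G0 G1 G11 JG) => //; rewrite divr_gt0.
Qed.

(** The functional equation of the Laplace transform, for all the derivatives
    at once. *)
Lemma limit_momentD n l b : 0 <= b -> (l <= p)%N ->
  limit_moment l b =
  (\int[P]_x (limit_jet (b / mb ^+ n) ^+ gen_size n x)`_l) / mb ^+ (n * l).
Proof.
move=> b0 lp; have [G [G0 G1 G11 JG]] := dominating_jet.
have pos c : 0 < c -> limit_moment l c =
    (\int[P]_x (limit_jet (c / mb ^+ n) ^+ gen_size n x)`_l) / mb ^+ (n * l).
  move=> c0; have c'0 : 0 < c / mb ^+ n by rewrite divr_gt0.
  have /cvg_lim <- // : norm_moment (n + m) l c @[m --> \oo] --> limit_moment l c.
    under eq_fun do rewrite addnC.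
    by have := norm_moment_cvg c0 lp; rewrite -(cvg_shiftn n).
  apply/cvg_lim => //; under eq_fun do rewrite (norm_momentD n _ (ltW c0) lp).
  apply: cvgMr_tmp; apply: (proj2 (jet_power_cvg G0 G1 _ measurableT lp _ _ _)).
  - by move=> m; apply: moment_jet_nneg; exact: ltW.
  - by move=> m i ip; rewrite moment_jetE//; exact: (norm_moment_le G0 G1 G11 JG m (ltW c'0) ip).
  - move=> i ip; rewrite limit_jetE//; under eq_fun do rewrite moment_jetE//.
    exact: norm_moment_cvg.
move: b0; rewrite le_eqVlt => /predU1P[<-|]; last exact: pos.
pose u k : R := mb ^+ n * vanishing 1 k.
have u0 k : 0 < u k by rewrite mulr_gt0// divr_gt0.
have cv := limit_moment_cvg0 lp (fun k => ltW (u0 k)) _.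
have /cv/cvg_lim <- // : u k @[k --> \oo] --> (0 : R).
  by rewrite -[X in _ --> X](mulr0 (mb ^+ n)); exact: cvgMl_tmp.
apply/cvg_lim => //; under eq_fun do rewrite (pos _ (u0 _)).
apply: cvgMr_tmp; apply: (proj2 (jet_power_cvg G0 G1 _ measurableT lp _ _ _)).
- by move=> k; exact: limit_jet_nneg.
- move=> k i ip; rewrite limit_jetE//; apply: (limit_moment_le G0 G1 G11 JG) => //.
  by rewrite divr_ge0 ?ltW.
- move=> i ip; rewrite mul0r limit_jetE//; under eq_fun do rewrite limit_jetE//.
  apply: limit_moment_cvg0 => //; first by move=> k; rewrite divr_ge0 ?ltW.
  have -> : (fun k => u k / mb ^+ n) = vanishing 1.
    by apply/funext => k; rewrite /u mulrAC divff ?mul1r// gt_eqF.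
  exact: vanishing_cvg.
Qed.

Lemma coef_exp_low (B : {poly R}) l : B`_0 = 0 -> (B ^+ l)`_l = B`_1 ^+ l.
Proof.
move=> B0; elim: l => [|l IH]; first by rewrite !expr0 coef1.
rewrite !exprS coefM !big_ord_recl/= B0 mul0r add0r /bump/= addn0 subSS subn0 IH.
rewrite big1 ?addr0// => i _.
by rewrite coef_expXn0 ?mulr0// !add1n subSS ltn_subrL/= (leq_ltn_trans _ (ltn_ord i)).
Qed.

Let bin_mean m l : (l <= p)%N ->
  P.-integrable setT (EFin \o (fun x : tree => 'C(gen_size m x, l)%:R)) /\
  \int[P]_x 'C(gen_size m x, l)%:R = mb ^+ (m * l) * norm_moment m l 0.
Proof.
move=> lp; have E : (fun x : tree => (laplace_jet 0 m ^+ gen_size m x)`_l) =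
    (fun x : tree => 'C(gen_size m x, l)%:R).
  by apply/funext => x; rewrite laplace_jetE !mul0r oppr0 expR0 mulr1.
have [] := jet_mean q_dist hP m (fun i => ok_laplace m i (lexx 0)) lp.
by rewrite /norm_moment E mulrC divfK ?gt_eqF// => ? ->.
Qed.

Lemma norm_moment1 m : norm_moment m 1 0 = 1.
Proof.
have q1 : genfun q 1 = 1%:E.
  by rewrite -q_dist.2; apply: eq_eseriesr => j _; rewrite expr1n mulr1.
have qD1 : genfunD q 1 1 = mb%:E.
  by rewrite -q_mean; apply: eq_eseriesr => j _; rewrite expr1n mulr1 ffactn1.
have [_ _ _ e] := fixpoint_mean q_dist hP m ler01 q1 qD1.
have [_ eB] := bin_mean m p_gt0; rewrite muln1 in eB.
apply: (@mulfI _ (mb ^+ m)); first by rewrite gt_eqF.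
rewrite -eB mulr1 -e; apply: eq_Rintegral => x _.
by rewrite bin1 expr1n mulr1.
Qed.

Lemma limit_moment00 : limit_moment 0 0 = 1.
Proof.
rewrite /limit_moment /laplace_moment divr1 -[RHS](Rintegral_probability_cst P).
by apply: eq_Rintegral => x _; rewrite mul0r oppr0 expR0 expr0 mulr1.
Qed.

Let mb_ratio n i l : (i <= l)%N ->
  mb ^+ (n * i) / mb ^+ (n * l) = (mb ^+ n)^-1 ^+ (l - i).
Proof.
move=> il; rewrite -{1}(subnK il) mulnDr exprD invfM mulrCA divff ?gt_eqF//.
by rewrite mulr1 exprVn -exprM.
Qed.

(** Without weights the dominated convergence of [norm_moment_cvg] fails. Instead,
    [limit_momentD] is expanded by [coef_exp_binomial]: its term of highest index
    is [norm_moment n l 0] when the limit has mean 1, and the other ones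
    carry negative powers of [mb ^ n]. *)
Lemma norm_moment_cvg0 l : limit_moment 1 0 = 1 -> (l <= p)%N ->
  norm_moment n l 0 @[n --> \oo] --> limit_moment l 0.
Proof.
move=> V1 lp; have [G [G0 G1 G11 JG]] := dominating_jet.
set V := limit_jet 0; have V0 : V`_0 = 1 by rewrite limit_jetE// limit_moment00.
set U := V - (V`_0)%:P; have U00 : U`_0 = 0 by rewrite coefB coefC subrr.
have U0 : poly_nneg U.
  move=> j; rewrite coefB coefC; case: eqP => [->|_]; rewrite ?subrr// subr0.
  exact: limit_jet_nneg.
have E n : limit_moment l 0 =
    \sum_(i < l.+1) (U ^+ i)`_l * norm_moment n i 0 * (mb ^+ n)^-1 ^+ (l - i).
  rewrite (limit_momentD n (lexx 0) lp) mul0r -/V.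
  have ii (i : 'I_l.+1) : P.-integrable setT
      (EFin \o (fun x : tree => (U ^+ i)`_l * 'C(gen_size n x, i)%:R)).
    have [|iB _] := @bin_mean n i; first by rewrite (leq_trans _ lp)// -ltnS.
    exact: (integrableZl _ _ iB).
  have -> : \int[P]_x (V ^+ gen_size n x)`_l =
      \sum_(i < l.+1) \int[P]_x ((U ^+ i)`_l * 'C(gen_size n x, i)%:R).
    rewrite -(proj2 (Rintegral_sum ii)); apply: eq_Rintegral => x _.
    by rewrite coef_exp_binomial -/U V0; apply: eq_bigr => i _; rewrite expr1n mulr1 mulrC.
  rewrite mulr_suml; apply: eq_bigr => i _.
  have ip : (i <= p)%N by rewrite (leq_trans _ lp)// -ltnS.
  have [iB eB] := bin_mean n ip.
  have il : (i <= l)%N by rewrite -ltnS.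
  rewrite (RintegralZl _ measurableT iB) eB -(mb_ratio n il).
  set N := norm_moment n i 0; clearbody N.
  by rewrite -!mulrA; congr (_ * _); rewrite mulrCA.
have E' n : norm_moment n l 0 = limit_moment l 0 -
    \sum_(i < l) (U ^+ i)`_l * norm_moment n i 0 * (mb ^+ n)^-1 ^+ (l - i).
  rewrite (E n) big_ord_recr/= subnn expr0 mulr1 coef_exp_low//.
  rewrite coefB coefC subr0 limit_jetE// V1 expr1n mul1r addrAC subrr add0r//.
have -> : (fun n => norm_moment n l 0) = (fun n => limit_moment l 0 -
    \sum_(i < l) (U ^+ i)`_l * norm_moment n i 0 * (mb ^+ n)^-1 ^+ (l - i)).
  by apply/funext => n; exact: E'.
rewrite -[X in _ --> X](subr0 (limit_moment l 0)); apply: cvgB; first exact: cvg_cst.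
rewrite [X in _ --> X](_ : 0 = \sum_(i < l) (0 : R)); last by rewrite big1.
apply: cvg_sum => i _; have ip : (i <= p)%N by rewrite (leq_trans _ lp)// ltnW.
apply: (@squeeze_cvgr _ _ _ _ (fun=> 0) (fun n => (U ^+ i)`_l * G`_i * (mb ^+ n)^-1 ^+ (l - i))).
- apply: nearW => n; have r0 : 0 <= (mb ^+ n)^-1 ^+ (l - i).
    by rewrite exprn_ge0// invr_ge0 ltW.
  have Ui0 : 0 <= (U ^+ i)`_l by exact: poly_nnegX.
  apply/andP; split.
    by apply: mulr_ge0 => //; apply: mulr_ge0 => //; exact: norm_moment_ge0.
  apply: ler_wpM2r => //; apply: ler_wpM2l => //.
  exact: (norm_moment_le G0 G1 G11 JG).
- exact: cvg_cst.
- rewrite -[X in _ --> X](mulr0 ((U ^+ i)`_l * G`_i)); apply: cvgMl_tmp.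
  have li : (0 < l - i)%N by rewrite subn_gt0.
  have := cvg_comp _ _ invmb_cvg0 (@exprn_continuous R (l - i) 0).
  by rewrite expr0n -leqn0 leqNgt li.
Qed.

(** The second moments of [y = Z_m / mb ^ m] are bounded and [y] has mean 1, so
    [y exp (- b y) >= y - b y ^ 2] bounds the mean of [y exp (- b y)] below by
    [1 - C b], with [C] the same for all [m]: no mass is lost in the limit. *)
Lemma limit_moment1 : (1 < p)%N -> limit_moment 1 0 = 1.
Proof.
move=> p1; have [G [G0 G1 G11 JG]] := dominating_jet.
pose C := G`_2 *+ 2 + 1.
have lower m b : 0 < b -> 1 - b * C <= norm_moment m 1 b /\ norm_moment m 1 b <= 1.
  move=> b0; pose y (x : tree) : R := (gen_size m x)%:R / mb ^+ m.
  have y0 x : 0 <= y x by rewrite divr_ge0// ltW.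
  pose z2 (x : tree) : R := 'C(gen_size m x, 2)%:R.
  have [iZ eZ] := bin_mean m p_gt0; rewrite muln1 norm_moment1 mulr1 in eZ.
  have [iZ2 eZ2] := bin_mean m p1.
  have iy : P.-integrable setT (EFin \o y).
    apply: eq_integrable (integrableZl measurableT (mb ^+ m)^-1 iZ) => // x _.
    by rewrite /= bin1 -EFinM mulrC.
  have ey : \int[P]_x y x = 1.
    rewrite /y (RintegralZr _ measurableT).
      rewrite -[X in _ = X](divff (mbX_neq0 m)) -eZ; congr (_ / _).
      by apply: eq_Rintegral => x _; rewrite bin1.
    by apply: eq_integrable iZ => // x _; rewrite /= bin1.
  pose y2 (x : tree) : R := ('C(gen_size m x, 2)%:R * 2) / mb ^+ (m * 2) + y x / mb ^+ m.
  have y2E x : y x ^+ 2 = y2 x.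
    have -> : y2 x = ('C(gen_size m x, 2)%:R * 2 + (gen_size m x)%:R) / mb ^+ (m * 2).
      by rewrite mulrDl /y2 /y -[X in _ + X]mulrA -invfM -exprD addnn -muln2.
    rewrite /y expr_div_n -exprM.
    congr (_ / _); rewrite -natrM -natrD -natrX; congr (_%:R).
    have := bin_ffact (gen_size m x) 2; rewrite ffactnS ffactn1 => ->.
    by case: (gen_size m x) => //= k; rewrite addnC -mulnS mulnn.
  have iz2 : P.-integrable setT (EFin \o (fun x : tree => 'C(gen_size m x, 2)%:R * 2 / mb ^+ (m * 2) : R)).
    apply: eq_integrable (integrableZl measurableT (2 / mb ^+ (m * 2)) iZ2) => // x _.
    by rewrite /= -EFinM mulrC mulrA.
  have iy' : P.-integrable setT (EFin \o (fun x : tree => y x / mb ^+ m)).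
    apply: eq_integrable (integrableZl measurableT (mb ^+ m)^-1 iy) => // x _.
    by rewrite /= -EFinM mulrC.
  have iy2 : P.-integrable setT (EFin \o y2) by exact: (integrableD _ iz2 iy').
  have ey2 : \int[P]_x y2 x <= C.
    rewrite /y2 (RintegralD measurableT iz2 iy') (RintegralZr _ measurableT iy) ey lerD//.
      have -> : \int[P]_x ('C(gen_size m x, 2)%:R * 2 / mb ^+ (m * 2)) =
          2 / mb ^+ (m * 2) * \int[P]_x 'C(gen_size m x, 2)%:R.
        rewrite -(RintegralZl _ measurableT iZ2); apply: eq_Rintegral => x _.
        by rewrite -mulrA mulrC.
      rewrite eZ2 mulrA divfK// mulr_natl lerMn2r/=.
      exact: (norm_moment_le G0 G1 G11 JG).
    by rewrite mul1r invf_le1 ?mbX_gt0// exprn_ege1// ltW.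
  have nmE : norm_moment m 1 b = \int[P]_x (y x * expR (- (b * y x))).
    rewrite (norm_momentE m (ltW b0) p_gt0) mulrC -(RintegralZl _ measurableT).
      by apply: eq_Rintegral => x _; rewrite laplace_jetE bin1 muln1 /y mulrA mulrA [_ * (_)%:R]mulrC.
    by have [] := jet_mean q_dist hP m (fun i => ok_laplace m i (ltW b0)) p_gt0.
  have ye0 x : 0 <= y x * expR (- (b * y x)) by apply: mulr_ge0 => //; exact: expR_ge0.
  have ye1 x : y x * expR (- (b * y x)) <= y x.
    apply: ler_piMr => //; rewrite -expR0 ler_expR oppr_le0; apply: mulr_ge0 => //.
    exact: ltW.
  have iye : P.-integrable setT (EFin \o (fun x => y x * expR (- (b * y x)))).
    apply: integrable_le iy _ => //.
      exact: (@measurable_gen_size R m (fun z => z%:R / mb ^+ m * expR (- (b * (z%:R / mb ^+ m))))).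
    by move=> x _; rewrite ger0_norm.
  rewrite nmE; split; last by rewrite -ey; exact: le_Rintegral.
  apply: (@le_trans _ _ (1 - b * \int[P]_x y2 x)).
    by rewrite lerD2l lerN2 ler_wpM2l// ltW.
  have iby := integrableZl measurableT b iy2.
  have iyb : P.-integrable setT (EFin \o (fun x => y x - b * y2 x)) by exact: (integrableB _ iy iby).
  rewrite -ey -(RintegralZl _ measurableT iy2) -(RintegralB measurableT iy iby).
  apply: le_Rintegral => // x _; rewrite -y2E expr2.
  have -> : y x - b * (y x * y x) = y x * (1 + - (b * y x)) by ring.
  by rewrite ler_wpM2l// expR_ge1Dx.
have lim b : 0 < b -> 1 - b * C <= limit_moment 1 b <= 1.
  move=> b0; have cv := norm_moment_cvg b0 p_gt0.
  have ex : cvgn (fun m => norm_moment m 1 b) by apply/cvg_ex; eexists; exact: cv.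
  rewrite -(cvg_lim _ cv)//; apply/andP; split.
    by apply: limr_ge => //; apply: nearW => m; have [] := lower m b b0.
  by apply: limr_le => //; apply: nearW => m; have [] := lower m b b0.
have cv0 := limit_moment_cvg0 p_gt0 (fun k => divr_ge0 ler01 (ler0n R k.+1)) (vanishing_cvg 1).
apply: (cvg_unique _ cv0) => //.
apply: (@squeeze_cvgr _ _ _ _ (fun k => 1 - vanishing 1 k * C) (fun=> 1)).
- by apply: nearW => k; apply: lim; rewrite divr_gt0.
- rewrite -[X in _ --> X]subr0; apply: cvgB; first exact: cvg_cst.
  rewrite -[X in _ --> X](mul0r C); apply: cvgMr_tmp; exact: vanishing_cvg.
- exact: cvg_cst.
Qed.

Lemma norm_moment0 m : norm_moment m 0 0 = 1.
Proof.
have [_] := bin_mean m (leq0n p); rewrite muln0 expr0 mul1r => <-.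
rewrite -[RHS](Rintegral_probability_cst P); apply: eq_Rintegral => x _.
by rewrite bin0.
Qed.

Lemma weighted_meanE m r b : 0 <= b -> (r <= p)%N ->
  \int[P]_x (laplace_jet b m ^+ gen_size m x)`_r = mb ^+ (m * r) * norm_moment m r b.
Proof. by move=> b0 rp; rewrite (norm_momentE m b0 rp) mulrC divfK. Qed.

Let moment_jet_ratio_cvg n r a (A : set tree) (V : {poly R}) (va : R) : 0 <= a -> (r <= p)%N ->
  filtr n A -> va != 0 ->
  (forall i, (i <= p)%N -> norm_moment m i (a / mb ^+ n) @[m --> \oo] --> V`_i) ->
  norm_moment m r a @[m --> \oo] --> va ->
  ((\int[P]_(x in A) (laplace_jet a (m + n) ^+ gen_size (m + n) x)`_r)%:E /
   (\int[P]_x (laplace_jet a (m + n) ^+ gen_size (m + n) x)`_r)%:E)%E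
  @[m --> \oo] --> ((\int[P]_(x in A) (V ^+ gen_size n x)`_r) / (mb ^+ (n * r) * va))%:E.
Proof.
move=> a0 rp nA va0 VV Va; have [G [G0 G1 G11 JG]] := dominating_jet.
have a'0 : 0 <= a / mb ^+ n by rewrite divr_ge0// ltW.
apply: (@EFin_div_cvg _ (fun m => mb ^+ (m * r))).
- by apply: nearW => m; exact: mbX_neq0.
- by rewrite mulf_neq0.
- have -> : (fun m => (\int[P]_(x in A) (laplace_jet a (m + n) ^+ gen_size (m + n) x)`_r) / mb ^+ (m * r))
      = (fun m => \int[P]_(x in A) (moment_jet m (a / mb ^+ n) ^+ gen_size n x)`_r).
    apply/funext => m; rewrite addnC (weighted_jet_mean m a0 rp nA).
    by rewrite mulrAC divff ?mul1r.
  apply: (proj2 (jet_power_cvg G0 G1 _ (filtr_measurable nA) rp _ _ _)).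
  + by move=> m; exact: moment_jet_nneg.
  + by move=> m i ip; rewrite moment_jetE//; exact: (norm_moment_le G0 G1 G11 JG).
  + by move=> i ip; under eq_fun do rewrite moment_jetE//; exact: VV.
- have -> : (fun m => (\int[P]_x (laplace_jet a (m + n) ^+ gen_size (m + n) x)`_r) / mb ^+ (m * r))
      = (fun m => mb ^+ (n * r) * norm_moment (m + n) r a).
    apply/funext => m; rewrite weighted_meanE// mulnDl exprD -mulrA mulrAC divff ?mul1r//.
  by apply: cvgMl_tmp; have := Va; rewrite -(cvg_shiftn n).
Qed.

(** For [p = 1] and [a = 0] the means [norm_moment m 1 0] stay equal to 1 even when
    mass is lost in the limit [W]; the ratio is then insensitive to the factor
    [limit_moment 1 0], which appears in both terms. *)
Lemma supercritical_cvg n r a (A : set tree) : 0 <= a -> (r <= p)%N -> filtr n A ->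
  0 < limit_moment r a ->
  ((\int[P]_(x in A) (laplace_jet a (m + n) ^+ gen_size (m + n) x)`_r)%:E /
   (\int[P]_x (laplace_jet a (m + n) ^+ gen_size (m + n) x)`_r)%:E)%E
  @[m --> \oo] -->
  ((\int[P]_(x in A) (limit_jet (a / mb ^+ n) ^+ gen_size n x)`_r) /
   (mb ^+ (n * r) * limit_moment r a))%:E.
Proof.
move=> a0 rp nA La; have La' : limit_moment r a != 0 by rewrite gt_eqF.
have [a_gt0|ale0] := ltP 0 a.
  apply: moment_jet_ratio_cvg => //; last exact: norm_moment_cvg.
  move=> i ip; rewrite limit_jetE//; apply: norm_moment_cvg => //.
  by rewrite divr_gt0.
have {}a0 : a = 0 by apply/eqP; rewrite eq_le ale0.
subst a; rewrite mul0r; have [p1|p1] := ltnP 1 p.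
  have V1 := limit_moment1 p1; apply: moment_jet_ratio_cvg => //.
    by move=> i ip; rewrite mul0r limit_jetE//; exact: norm_moment_cvg0.
  exact: norm_moment_cvg0.
have := @moment_jet_ratio_cvg n r 0 A (1 + 'X) 1 (lexx 0) rp nA (oner_neq0 R).
have r1 : (r <= 1)%N := leq_trans rp p1.
have -> : (\int[P]_(x in A) (limit_jet 0 ^+ gen_size n x)`_r) / (mb ^+ (n * r) * limit_moment r 0)
    = (\int[P]_(x in A) ((1 + 'X : {poly R}) ^+ gen_size n x)`_r) / (mb ^+ (n * r) * 1).
  have E z : (limit_jet 0 ^+ z)`_r = limit_moment r 0 * ((1 + 'X : {poly R}) ^+ z)`_r.
    case: r r1 {rp La La'} => [|[|//]] _.
      by rewrite !coef0_exp limit_jetE// limit_moment00 coefD coef1 coefX addr0 mul1r.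
    rewrite !coef1_exp !limit_jetE// limit_moment00 !coefD !coef1 !coefX addr0 add0r.
    by rewrite mulr1 mulrC.
  have -> : \int[P]_(x in A) (limit_jet 0 ^+ gen_size n x)`_r =
      limit_moment r 0 * \int[P]_(x in A) ((1 + 'X : {poly R}) ^+ gen_size n x)`_r.
    rewrite -(RintegralZl _ (filtr_measurable nA)); first by apply: eq_Rintegral => x _; exact: E.
    have [iB _] := bin_mean n rp; apply: (integrableS measurableT (filtr_measurable nA) (@subsetT _ _)).
    apply: eq_integrable iB => // x _ /=; congr EFin.
    by have := coef_exp_affine (1 : R) (gen_size n x) r; rewrite scale1r expr1n mulr1.
  by rewrite mulr1 [X in X / _]mulrC -mulf_div divff ?mulr1.
apply.
  move=> i ip; rewrite mul0r; have i1 : (i <= 1)%N := leq_trans ip p1.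
  case: i i1 {ip} => [|[|//]] _; under eq_fun do rewrite ?norm_moment0 ?norm_moment1.
    by rewrite coefD coef1 coefX addr0; exact: cvg_cst.
  by rewrite coefD coef1 coefX add0r; exact: cvg_cst.
case: r r1 {rp La La'} => [|[|//]] _; under eq_fun do rewrite ?norm_moment0 ?norm_moment1;
  exact: cvg_cst.
Qed.

Lemma laplace_jet_integrable m l b : 0 <= b -> (l <= p)%N ->
  P.-integrable setT (EFin \o (fun x : tree => (laplace_jet b m ^+ gen_size m x)`_l)).
Proof.
by move=> b0 lp; have [] := jet_mean q_dist hP m (fun i => ok_laplace m i b0) lp.
Qed.

Lemma limit_jet_integrable n l b : 0 <= b -> (l <= p)%N ->
  P.-integrable setT (EFin \o (fun x : tree => (limit_jet b ^+ gen_size n x)`_l)).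
Proof.
move=> b0 lp; have [G [G0 G1 G11 JG]] := dominating_jet.
apply: (integrable_le _ _ (dominating_integrable G0 G1 n lp)) => //.
  exact: (@measurable_gen_size R n (fun z => (limit_jet b ^+ z)`_l)).
move=> x _; have V0 := limit_jet_nneg b; rewrite ger0_norm ?poly_nnegX//.
apply: (@le_coef_exp _ p) => // i ip; rewrite limit_jetE//.
exact: (limit_moment_le G0 G1 G11 JG).
Qed.

(** The functional equation at the first generation: it says that the offspring
    weights of a node of type [l] sum to 1. *)
Lemma limit_jet_series l b : 0 <= b -> (l <= p)%N ->
  jet_series q (limit_jet (b / mb)) l = (mb ^+ l * limit_moment l b)%:E.
Proof.
move=> b0 lp; have [G [G0 G1 G11 JG]] := dominating_jet.
have V0 := limit_jet_nneg (b / mb).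
have V1 : (limit_jet (b / mb))`_0 <= 1.
  rewrite limit_jetE// -G1; apply: (limit_moment_le G0 G1 G11 JG) => //.
  by rewrite divr_ge0// ltW.
rewrite -(genfun_jetE q0 (ok V0 V1) lp); congr EFin.
have [_ /= <-] := jet_mean q_dist hP 1 (ok_iter V0 V1) lp.
by rewrite (limit_momentD 1 b0 lp) expr1 mul1n [RHS]mulrC divfK// expf_neq0// gt_eqF.
Qed.

End Supercritical.

(** * Tilting by the fixed point *)

Section Tilting.
Context {R : realType}.
Variables (q : nat -> R) (kappa : R).
Hypotheses (q_dist : is_distribution q) (kappa1 : 1 < kappa).
Hypotheses (fk : genfun q kappa = kappa%:E).

Let q0 := q_dist.1.
Let kappa0 : 0 < kappa := lt_trans ltr01 kappa1.
Let kappa_neq0 : kappa != 0. Proof. by rewrite gt_eqF. Qed.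

Lemma exprzB1 (n : nat) : kappa ^ (n%:Z - 1) = kappa ^+ n / kappa.
Proof. by rewrite expfzDr// exprN1. Qed.

Lemma qbarE n : qbar q kappa n = kappa ^+ n / kappa * q n.
Proof. by rewrite /qbar exprzB1. Qed.

Lemma qbar_ge0 n : 0 <= qbar q kappa n.
Proof. by rewrite qbarE mulr_ge0// divr_ge0 ?exprn_ge0// ltW. Qed.

Lemma qbar_dist : is_distribution (qbar q kappa).
Proof.
split; first exact: qbar_ge0.
have -> : (\sum_(n <oo) (qbar q kappa n)%:E = (kappa^-1)%:E * genfun q kappa)%E.
  rewrite -nneseriesZl; last by move=> n _; rewrite lee_fin mulr_ge0// exprn_ge0// ltW.
  by apply: eq_eseriesr => n _; rewrite -EFinM qbarE; congr EFin; ring.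
by rewrite fk -EFinM mulVf.
Qed.

Lemma qbar_ffact k :
  (\sum_(n <oo) ((n ^_ k)%:R * qbar q kappa n)%:E = (kappa ^+ k / kappa)%:E * genfunD q k kappa)%E.
Proof.
rewrite -nneseriesZl; last by move=> n _; rewrite lee_fin !mulr_ge0// exprn_ge0// ltW.
apply: eq_eseriesr => n _; rewrite -EFinM qbarE; congr EFin.
have [kn|nk] := leqP k n; last by rewrite ffact_small// !(mul0r, mulr0).
by rewrite -{2}(subnKC kn) exprD; ring.
Qed.

Lemma ffact_le i p n : (i <= p)%N -> (n ^_ i <= p ^ p + n ^_ p)%N.
Proof.
have ffX m k : (m ^_ k <= m ^ k)%N.
  by elim: k => // k IH; rewrite ffactnSr expnSr leq_mul// leq_subr.
move=> ip; have [pn|np] := leqP p n.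
  apply: leq_trans (leq_addl _ _); elim: p ip pn => [|p IH]; first by rewrite leqn0 => /eqP ->.
  rewrite leq_eqVlt => /predU1P[->//|ip] pn.
  by rewrite ffactnSr (leq_trans (IH ip (ltnW pn)))// leq_pmulr// subn_gt0.
apply: leq_trans (leq_addr _ _); apply: leq_trans (ffX n i) _.
apply: leq_trans (leq_pexp2l (leq_ltn_trans (leq0n n) np) ip).
by case: i {ip} => [|i]; rewrite ?expn0// leq_exp2r// ltnW.
Qed.

Lemma qbar_moment p i : (genfunD q p kappa < +oo)%E -> (i <= p)%N ->
  (\sum_(n <oo) ('C(n, i)%:R * qbar q kappa n)%:E < +oo)%E.
Proof.
move=> fD ip; apply: (@le_lt_trans _ _
    (\sum_(n <oo) ((p ^ p)%:R%:E * (qbar q kappa n)%:E + ((n ^_ p)%:R * qbar q kappa n)%:E))%E).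
  apply: lee_nneseries => [n _ _|n _]; first by rewrite lee_fin mulr_ge0// qbar_ge0.
  rewrite -EFinM -EFinD lee_fin -mulrDl ler_wpM2r ?qbar_ge0// -natrD ler_nat.
  by apply: leq_trans (ffact_le n ip); rewrite -bin_ffact leq_pmulr// fact_gt0.
rewrite nneseriesD; last 2 first.
- by move=> n _ _; rewrite -EFinM lee_fin mulr_ge0// qbar_ge0.
- by move=> n _ _; rewrite lee_fin mulr_ge0// qbar_ge0.
rewrite nneseriesZl; last by move=> n _; rewrite lee_fin qbar_ge0.
rewrite qbar_dist.2 qbar_ffact lte_add_pinfty//; first by rewrite mule1 ltry.
by rewrite lte_mul_pinfty// lee_fin divr_ge0 ?exprn_ge0// ltW.
Qed.

Lemma qbar_mean mubar : genfunD q 1 kappa = mubar%:E ->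
  (\sum_(n <oo) (n%:R * qbar q kappa n)%:E = mubar%:E)%E.
Proof.
move=> fD; have := qbar_ffact 1; rewrite expr1 divff// mul1e fD => <-.
by apply: eq_eseriesr => n _; rewrite ffactn1.
Qed.

(** Trapezoidal rule for the convex derivative of [x ^ n] on [1, kappa]; summed
    against [q] it gives [f'(kappa) + f'(1) >= 2]. *)
Lemma trapezoid n : 2 * (kappa ^+ n - 1) <= (kappa - 1) * (n%:R * kappa ^+ n.-1 + n%:R) :> R.
Proof.
case: n => [|n]; first by rewrite expr0 subrr mul0r addr0 !mulr0.
rewrite subrX1 mulrCA ler_pM2l ?subr_gt0//=.
have sym : \sum_(i < n.+1) kappa ^+ i = \sum_(i < n.+1) kappa ^+ (n - i).
  by rewrite (reindex_inj rev_ord_inj)/=; apply: eq_bigr => i _; rewrite subSS.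
have -> : 2 * \sum_(i < n.+1) kappa ^+ i = \sum_(i < n.+1) (kappa ^+ i + kappa ^+ (n - i)).
  by rewrite big_split/= -sym; ring.
apply: (@le_trans _ _ (\sum_(i < n.+1) (kappa ^+ n + 1))).
  apply: ler_sum => i _; have ni : (i <= n)%N by rewrite -ltnS.
  have ki j : 0 <= kappa ^+ j - 1 by rewrite subr_ge0 exprn_ege1// ltW.
  have := mulr_ge0 (ki i) (ki (n - i)%N).
  have -> : (kappa ^+ i - 1) * (kappa ^+ (n - i) - 1) =
      kappa ^+ i * kappa ^+ (n - i) + 1 - (kappa ^+ i + kappa ^+ (n - i)) by ring.
  by rewrite -exprD subnKC// subr_ge0.
by rewrite sumr_const card_ord -[leLHS]mulr_natl mulrDr mulr1.
Qed.

Lemma qbar_mean_gt1 mubar : (mean q < 1)%E -> genfunD q 1 kappa = mubar%:E -> 1 < mubar.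
Proof.
move=> mean1 fD; have mE := meanE q_dist mean1; set mu := fine _ in mE.
have mu1 : mu < 1 by rewrite -lte_fin -mE.
have k1 : 0 <= kappa - 1 by rewrite subr_ge0 ltW.
have D0 n : 0 <= (n ^_ 1)%:R * q n * kappa ^+ (n - 1).
  by rewrite !mulr_ge0// exprn_ge0// ltW.
have M0 n : 0 <= n%:R * q n by rewrite mulr_ge0.
have Z (c : R) (f : nat -> R) : (forall n, 0 <= f n) ->
    (\sum_(n <oo) (c * f n)%:E = c%:E * \sum_(n <oo) (f n)%:E)%E.
  by move=> f0; rewrite -nneseriesZl// => n _; rewrite lee_fin.
have S (f g : nat -> R) : (forall n, 0 <= f n) -> (forall n, 0 <= g n) ->
    (\sum_(n <oo) (f n + g n)%:E = \sum_(n <oo) (f n)%:E + \sum_(n <oo) (g n)%:E)%E.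
  by move=> f0 g0; rewrite -nneseriesD// => n _ _; rewrite lee_fin.
have K0 n : 0 <= q n * kappa ^+ n by rewrite mulr_ge0// exprn_ge0// ltW.
have h : ((2 * kappa)%:E <= (2 + ((kappa - 1) * mubar + (kappa - 1) * mu))%:E)%E.
  have -> : (2 + ((kappa - 1) * mubar + (kappa - 1) * mu))%:E =
      (\sum_(n <oo) (2 * q n + ((kappa - 1) * ((n ^_ 1)%:R * q n * kappa ^+ (n - 1)) +
         (kappa - 1) * (n%:R * q n)))%:E)%E.
    rewrite !S ?Z//; try by move=> n; rewrite ?addr_ge0// mulr_ge0.
    by rewrite q_dist.2 -/(genfunD q 1 kappa) -/(mean q) fD mE mule1.
  rewrite EFinM -fk -Z//; apply: lee_nneseries => [n _ _|n _].
    by rewrite lee_fin mulr_ge0.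
  rewrite lee_fin ffactn1 subn1.
  rewrite -subr_ge0 [leRHS](_ : _ = q n * ((kappa - 1) * (n%:R * kappa ^+ n.-1 + n%:R) -
    2 * (kappa ^+ n - 1))); last by ring.
  by rewrite mulr_ge0// subr_ge0 trapezoid.
rewrite lee_fin in h.
have : (kappa - 1) * (2 - mu) <= (kappa - 1) * mubar by lra.
rewrite ler_pM2l ?subr_gt0//; lra.
Qed.

(** Every node but the root is a child, so the powers of [kappa] telescope. *)
Lemma prod_qbar r (t : set word) j :
  \prod_(v <- upto r t j) qbar q kappa (nkids t v) =
  kappa ^+ size (lev r t j) / kappa * \prod_(v <- upto r t j) q (nkids t v).
Proof.
elim: j => [|j IH]; first by rewrite !big_nil mulr1 expr1 divff.
have -> : upto r t j.+1 = upto r t j ++ lev r t j by [].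
rewrite !big_cat IH/=.
have -> : \prod_(v <- lev r t j) qbar q kappa (nkids t v) =
    kappa ^+ size (lev r t j.+1) / kappa ^+ size (lev r t j) *
    \prod_(v <- lev r t j) q (nkids t v).
  rewrite /= size_flatten sumnE !big_map.
  elim: (lev r t j) => [|v s IHs]; first by rewrite !big_nil divff ?mulr1// expf_neq0.
  rewrite !big_cons IHs qbarE size_map size_iota exprD /= exprS invfM.
  by ring.
rewrite mulrACA; congr (_ * _); rewrite [LHS]mulrC mulrA divfK//.
by rewrite expf_neq0.
Qed.

(** The case of events of generation [n]: on each atom the two laws differ by the
    factor found in [prod_qbar]. *)
Lemma tilted_integral (P Pbar : probability tree R) n (A : set tree) (g : nat -> R) :
  GW_law q 0 P -> GW_law (qbar q kappa) 0 Pbar -> filtr n A -> (forall z, 0 <= g z) ->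
  (\int[Pbar]_(x in A) (g (gen_size n x))%:E =
   \int[P]_(x in A) (kappa ^+ gen_size n x / kappa * g (gen_size n x))%:E)%E.
Proof.
move=> hP hPbar nA g0.
have g'0 z : 0 <= kappa ^+ z / kappa * g z.
  by rewrite mulr_ge0// divr_ge0 ?exprn_ge0// ltW.
apply: (eq_filtr_integral nA).
- exact: (gen_size_mfun _ (fun z => (g z)%:E)).
- by move=> x; rewrite lee_fin.
- exact: (gen_size_mfun _ (fun z => (kappa ^+ z / kappa * g z)%:E)).
- by move=> x; rewrite lee_fin.
move=> x0 _; rewrite !atom_integral; try by move=> x /eq_gen_size ->.
have [rx0|nr] := pselect (rooted_tree (ones 0) x0); last first.
  by rewrite (GW_notrooted q_dist hP)// (GW_notrooted qbar_dist hPbar)// !mule0.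
have := GW_atom q_dist hP n rx0; rewrite add0n => ->.
have := GW_atom qbar_dist hPbar n rx0; rewrite add0n => ->.
rewrite prod_qbar -!EFinM; congr EFin.
by have := gen_sizeE rx0 n; rewrite add0n => <-; ring.
Qed.

End Tilting.

(** The compositions in [acoef] enumerate the coefficients of the powers of the
    jet of [phi] without its constant term; the signs of the derivatives
    cancel between numerator and denominator. *)
Lemma Gfun_jet (R : realType) (phi : R -> R) (mu a : R) p n n0 x (V : {poly R}) (v : R) :
  (forall l, (l <= p)%N -> der0n l phi (a / mu ^+ n) = (-1) ^+ l * (l`!%:R * V`_l)) ->
  der0n p phi (a / mu ^+ n0) = (-1) ^+ p * (p`!%:R * v) ->
  Gfun phi mu a p n n0 x = (V ^+ x)`_p / v.
Proof.
move=> HV Hv; have phiV : phi (a / mu ^+ n) = V`_0.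
  by rewrite (_ : phi _ = der0n 0 phi (a / mu ^+ n))// HV// expr0 !mul1r.
have sgn0 (k : nat) : (-1) ^+ k != 0 :> R by rewrite expf_neq0// oppr_eq0 oner_neq0.
have fact0 (k : nat) : k`!%:R != 0 :> R by rewrite pnatr_eq0 -lt0n fact_gt0.
have U0 : (V - (V`_0)%:P)`_0 = 0 by rewrite coefB coefC subrr.
have Ul l : (0 < l)%N -> (V - (V`_0)%:P)`_l = V`_l.
  by move=> l0; rewrite coefB coefC gtn_eqF// subr0.
have acoefE i : acoef phi mu a i p n = (-1) ^+ p * ((V - (V`_0)%:P) ^+ i)`_p.
  rewrite /acoef (coef_exp_ffun _ _ (leqnn p)) mulr_sumr.
  rewrite [RHS](bigID (fun s : {ffun 'I_i -> 'I_p.+1} => [forall r, (0 < s r)%N]))/=.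
  rewrite [X in _ + X]big1 ?addr0; last first.
    move=> s /andP[_ /forallPn[r]]; rewrite -leqNgt leqn0 => /eqP sr.
    by rewrite (bigD1 r)//= sr U0 mul0r mulr0.
  apply: eq_big => [s|s /andP[/forallP s0 /eqP sp]]; first by rewrite andbC.
  have -> : (-1) ^+ p = \prod_(r < i) (-1) ^+ s r :> R by rewrite prodrXr sp.
  rewrite -big_split/=; apply: eq_bigr => r _.
  by rewrite HV -1?ltnS// Ul// -mulrA [_%:R * _]mulrC mulfK.
case: p HV Hv acoefE => [|p] HV Hv acoefE; rewrite /Gfun.
  by move: Hv; rewrite /= => ->; rewrite phiV coef0_exp expr0 !mul1r.
rewrite Hv phiV coef_exp_binomial big_ord_recl/= expr0 coef1 mulr0 add0r.
rewrite big_add1/= big_mkord mulr_suml mulr_sumr; apply: eq_bigr => i _.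
rewrite acoefE Hpol_bin /bump/= add1n.
have [ix|xi] := leqP i.+1 x; last by rewrite bin_small// !(mulr0, mul0r).
rewrite subzn// -exprnP.
have [-> | v0] := eqVneq v 0; first by rewrite !mulr0 !invr0 !(mulr0, mul0r).
by field; rewrite v0 sgn0 fact0.
Qed.

(** * A sequence of independent variables with prescribed countable laws *)

Section Digits.
Context {R : realType}.
Implicit Types (r : nat -> R) (P : nat -> nat -> R) (v : R).

Definition cumul r (n : nat) : R := \sum_(0 <= i < n) r i.

Definition digit0 r v : nat := xget 0%N [set x | cumul r x <= v < cumul r x.+1].

(** A point of [[0, 1[] is located in the partition into intervals of lengths
    [P 0 0], [P 0 1], and so on, then its interval is rescaled to [[0, 1[] to read
    the next digit. With constant uniform laws this is a usual expansion. *)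
Fixpoint digit P n v : nat :=
  if n is m.+1 then
    digit (fun i => P i.+1) m ((v - cumul (P 0%N) (digit0 (P 0%N) v)) / P 0%N (digit0 (P 0%N) v))
  else digit0 (P 0%N) v.

Lemma cumul_mono r : (forall n, 0 <= r n) -> {homo cumul r : m n / (m <= n)%N >-> m <= n}.
Proof.
move=> r0 m n mn; rewrite /cumul (big_cat_nat (leq0n m) mn)//= lerDl.
by apply: sumr_ge0 => i _.
Qed.

Lemma cumul_le1 r n : is_distribution r -> cumul r n <= 1.
Proof.
move=> [r0 r1]; rewrite -lee_fin -r1 /cumul -sumEFin.
by apply: nneseries_lim_ge => i _; rewrite lee_fin.
Qed.

Lemma digit0_unique r v x : (forall n, 0 <= r n) ->
  cumul r x <= v < cumul r x.+1 -> digit0 r v = x.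
Proof.
move=> r0 xv; apply: xget_unique => // y /andP[cy yc]; move/andP: xv => [cx xc].
have lt i j : cumul r i <= v -> v < cumul r j.+1 -> (i <= j)%N.
  move=> ci cj; rewrite leqNgt; apply/negP => ji.
  by have := lt_le_trans cj (le_trans (cumul_mono r0 ji) ci); rewrite ltxx.
by apply/eqP; rewrite eqn_leq !lt.
Qed.

Lemma digit0P r v : is_distribution r -> 0 <= v < 1 ->
  cumul r (digit0 r v) <= v < cumul r (digit0 r v).+1.
Proof.
move=> rd /andP[v0 v1]; have [r0 r1] := rd.
suff [n nv] : exists n, cumul r n <= v < cumul r n.+1 by rewrite (digit0_unique r0 nv).
have cv : cumul r n @[n --> \oo] --> (1 : R).
  have := @is_cvg_nneseries _ (fun n => (r n)%:E) xpredT 0%N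
    (fun n _ _ => (r0 n : (0 <= (r n)%:E)%E)).
  move=> /cvg_ex[l ul]; have : (l = 1)%E by rewrite -r1; apply/esym/cvg_lim.
  move=> l1; move: ul; rewrite l1 => /fine_cvg; apply: cvg_trans.
  rewrite (_ : fine \o _ = cumul r)//; apply/funext => n /=.
  by rewrite sumEFin.
have : exists n, v < cumul r n.
  by have [n _ nv] := cvgr_gt _ cv _ v1; exists n; apply: nv => /=.
move=> ev; have := ex_minnP ev => -[[|n] nv nmin].
  by move: nv; rewrite /cumul big_nil ltNge v0.
exists n; rewrite nv andbT leNgt; by apply/negP => /nmin; rewrite ltnn.
Qed.

(** Fixing one more digit rescales an interval into one of the pieces of the
    partition, and so multiplies its length by the probability of that digit. *)
Lemma digit_interval P (s : seq nat) : (forall i, is_distribution (P i)) ->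
  exists2 a, 0 <= a & a + \prod_(i < size s) P i (nth 0%N s i) <= 1 /\
  forall v, 0 <= v < 1 -> ((forall i, (i < size s)%N -> digit P i v = nth 0%N s i) <->
     a <= v < a + \prod_(i < size s) P i (nth 0%N s i)).
Proof.
elim: s P => [|x s IH] P Pd.
  exists 0 => //=; rewrite big_ord0 add0r; split => // v ->; split => //.
have [a a0 [a1 aP]] := IH (fun i => P i.+1) (fun i => Pd i.+1).
rewrite /= big_ord_recl /= in a1 aP *.
set m := \prod_(i < size s) _ in a1 aP *.
have m0 : 0 <= m by apply: prodr_ge0 => i _; have [] := Pd i.+1.
have [r0 _] := Pd 0%N; set r := P 0%N in r0 *.
have cS y : cumul r y.+1 = cumul r y + r y by rewrite /cumul big_nat_recr.
have c0 y : 0 <= cumul r y by apply: sumr_ge0 => i _.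
exists (cumul r x + r x * a); first by rewrite addr_ge0// mulr_ge0.
split.
  rewrite -addrA -mulrDr (le_trans _ (cumul_le1 x.+1 (Pd 0%N)))// cS lerD2l.
  by rewrite ler_piMr.
move=> v v01; have dv := digit0P (Pd 0%N) v01; rewrite -/r in dv.
set w := (v - cumul r (digit0 r v)) / r (digit0 r v).
have rd_gt0 : 0 < r (digit0 r v).
  by move: dv; rewrite cS => /andP[cv vc]; have := le_lt_trans cv vc; rewrite ltrDl.
have w01 : 0 <= w < 1.
  move: dv; rewrite cS => /andP[cv vc].
  by rewrite divr_ge0 ?subr_ge0 ?(ltW rd_gt0)//= /w ltr_pdivrMr// mul1r ltrBlDl.
have eqv : digit0 r v = x -> (a <= w < a + m) =
    (cumul r x + r x * a <= v < cumul r x + r x * a + r x * m).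
  move=> dx; rewrite /w dx in rd_gt0 *.
  rewrite ler_pdivlMr// ltr_pdivrMr// lerBrDl ltrBlDl mulrDl addrA.
  by rewrite ![_ * r x]mulrC.
split.
  move=> dP; have dx : digit0 r v = x by exact: (dP 0%N).
  rewrite -eqv//; apply/(aP w w01) => i is_; exact: (dP i.+1).
move=> av; have dx : digit0 r v = x.
  apply: digit0_unique => //; move: av => /andP[av va]; rewrite cS; apply/andP; split.
    by apply: le_trans av; rewrite lerDl mulr_ge0.
  apply: lt_le_trans va _; rewrite -addrA lerD2l -mulrDr ler_piMr//.
move: av; rewrite -eqv// => /(aP w w01) wP [|i] si //=.
exact: wP.
Qed.

Lemma digit_gt0 P n v : (forall i, is_distribution (P i)) -> 0 <= v < 1 -> 0 < P n (digit P n v).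
Proof.
elim: n P v => [|n IH] P v Pd v01; have := digit0P (Pd 0%N) v01;
  rewrite /cumul big_nat_recr//= -/(cumul _ _) => /andP[cv vc].
  by have := le_lt_trans cv vc; rewrite ltrDl.
have rd_gt0 : 0 < P 0%N (digit0 (P 0%N) v) by have := le_lt_trans cv vc; rewrite ltrDl.
apply: (IH (fun i => P i.+1)) => //.
by rewrite divr_ge0 ?subr_ge0// ?(ltW rd_gt0)//= ltr_pdivrMr// mul1r ltrBlDl.
Qed.

Lemma measurable_fun_nat d (T : measurableType d) (f : T -> nat) :
  (forall x, measurable (f @^-1` [set x])) -> measurable_fun setT f.
Proof.
move=> mf _ B _; rewrite setTI.
have -> : f @^-1` B = \bigcup_(x in B) (f @^-1` [set x]).
  by apply/seteqP; split => [v Bv|v [x Bx fx]]; [exists (f v) | rewrite /preimage/= fx].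
by apply: bigcup_measurable.
Qed.

Lemma measurable_digit0 r : (forall n, 0 <= r n) -> measurable_fun setT (digit0 r).
Proof.
move=> r0.
have pre x : x != 0%N -> digit0 r @^-1` [set x] = `[cumul r x, cumul r x.+1[%classic.
  move=> x0; apply/seteqP; split => v /=; rewrite in_itv/=; last exact: digit0_unique.
  have [[y yv]|nv] := pselect (exists y, cumul r y <= v < cumul r y.+1).
    by rewrite (digit0_unique r0 yv) => <-.
  rewrite /digit0 xgetPN => [e|y yv]; first by move: x0; rewrite -e eqxx.
  by apply: nv; exists y.
have mpre x : x != 0%N -> measurable (digit0 r @^-1` [set x]).
  by move=> x0; rewrite pre//; exact: measurable_itv.
apply: measurable_fun_nat => -[|x]; last exact: mpre.
have -> : digit0 r @^-1` [set 0%N] = ~` \bigcup_x (digit0 r @^-1` [set x.+1]).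
  apply/seteqP; split => v /=; first by move=> v0 [x _ /=]; rewrite v0.
  by case E : (digit0 r v) => [//|x] nv; exfalso; apply: nv; exists x.
by apply: measurableC; apply: bigcup_measurable => x _; exact: mpre.
Qed.

Lemma measurable_digit P n : (forall i, is_distribution (P i)) ->
  measurable_fun setT (digit P n).
Proof.
elim: n P => [|n IH] P Pd /=; first by apply: measurable_digit0; have [] := Pd 0%N.
have md := measurable_digit0 (Pd 0%N).1.
have mnat (g : nat -> R) : measurable_fun setT (fun v => g (digit0 (P 0%N) v)).
  by apply: (@measurableT_comp _ _ _ _ _ _ g).
apply: (@measurableT_comp _ _ _ _ _ _ (digit (fun i => P i.+1) n)); first exact: IH.
apply: measurable_funM; last exact: (mnat (fun x => (P 0%N x)^-1)).
by apply: measurable_funB => //; exact: (mnat (cumul (P 0%N))).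
Qed.

(** Digits make sense on [[0, 1[] only; clipping gives every point digits of
    positive probability. *)
Definition clip v : R := if 0 <= v < 1 then v else 0.

Definition coin P n v : nat := digit P n (clip v).

Lemma clip01 v : 0 <= clip v < 1.
Proof. by rewrite /clip; case: ifP => // _; rewrite lexx ltr01. Qed.

Lemma coin_gt0 P n v : (forall i, is_distribution (P i)) -> 0 < P n (coin P n v).
Proof. by move=> Pd; apply: digit_gt0 => //; exact: clip01. Qed.

Lemma measurable_coin P n : (forall i, is_distribution (P i)) -> measurable_fun setT (coin P n).
Proof.
move=> Pd; apply: (@measurableT_comp _ _ _ _ _ _ (digit P n)); first exact: measurable_digit.
rewrite /clip; apply: measurable_fun_ifT => //.
apply: measurable_and; first by apply: measurable_fun_ler => //; exact: measurable_id.
by apply: measurable_fun_ltr => //; exact: measurable_id.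
Qed.

Local Notation Pr := (uniform_prob (@ltr01 R)).

Lemma coin_prefix P (s : seq nat) : (forall i, is_distribution (P i)) ->
  Pr [set v | forall i, (i < size s)%N -> coin P i v = nth 0%N s i] =
  (\prod_(i < size s) P i (nth 0%N s i))%:E.
Proof.
move=> Pd; have [a a0 [a1 aP]] := digit_interval s Pd; set m := \prod_(i < size s) _ in a1 aP *.
have m0 : 0 <= m by apply: prodr_ge0 => i _; have [] := Pd i.
set E := [set v | _]; have mE : measurable E.
  rewrite (_ : E = \bigcap_(i in [set i | (i < size s)%N]) (coin P i @^-1` [set nth 0%N s i])).
    apply: bigcap_measurableType => i _.
    by rewrite -[X in measurable X]setTI; exact: measurable_coin.
  by apply/seteqP; split.
rewrite /uniform_prob integral_uniform_pdf (eq_integral (cst 1%E)); last first.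
  move=> v; rewrite inE => -[_ /=]; rewrite in_itv/= /uniform_pdf => ->.
  by rewrite subr0 invr1.
rewrite integral_cst ?mul1e; last exact: measurableI.
have -> : E `&` `[0, 1]%classic = `[a, a + m[%classic `|` (E `&` [set 1]).
  apply/seteqP; split => v /=.
    move=> [Ev]; rewrite in_itv/= => /andP[v0]; rewrite le_eqVlt => /predU1P[v1|v1].
      by right.
    left; rewrite in_itv/=; apply/aP => //; first by rewrite v0.
    by move=> i si; have := Ev i si; rewrite /coin /clip v0 v1.
  case; rewrite in_itv/=.
    move=> av; have v01 : 0 <= v < 1.
      by move/andP: (av) => [av' va]; rewrite (le_trans a0 av') (lt_le_trans va).
    split; last by move/andP: v01 => [v0 /ltW v1]; rewrite /= in_itv/= v0.
    by move=> i si; rewrite /coin /clip v01; apply: (proj2 (aP v v01)).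
  by move=> [Ev v1]; split => //; rewrite v1 ler01 lexx.
rewrite measureU0//; last 2 first.
- exact: measurableI.
- apply/eqP; rewrite -measure_le0 -(lebesgue_measure_set1 (1 : R)).
  by apply: le_measure; rewrite ?inE//; exact: measurableI.
apply: etrans (lebesgue_measure_itv `[a, a + m[) _; rewrite /= lte_fin ltrDl; case: ltP => [_|m0'].
  by rewrite -EFinB addrAC subrr add0r.
by congr EFin; apply/esym/eqP; rewrite eq_le m0 m0'.
Qed.

(** [coin_prefix] prescribes all the first coordinates; those that are not in [J]
    are summed out one at a time, by downward induction on the number of
    coordinates already prescribed. *)
Lemma coin_indep P (J : seq nat) (x : nat -> nat) : (forall i, is_distribution (P i)) -> uniq J ->
  Pr [set v | forall i, i \in J -> coin P i v = x i] = (\prod_(i <- J) P i (x i))%:E.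
Proof.
move=> Pd uJ; pose E N (s : seq nat) := [set v | (forall i, (i < size s)%N -> coin P i v = nth 0%N s i) /\
  forall i, (size s <= i < N)%N -> i \in J -> coin P i v = x i].
have mE N s : measurable (E N s).
  rewrite (_ : E N s = (\bigcap_(i in [set i | (i < size s)%N]) (coin P i @^-1` [set nth 0%N s i])) `&`
    \bigcap_(i in [set i | (size s <= i < N)%N /\ i \in J]) (coin P i @^-1` [set x i])).
    by apply: measurableI; apply: bigcap_measurableType => i _;
       rewrite -[X in measurable X]setTI; exact: measurable_coin.
  apply/seteqP; split => v [h1 h2]; split => //.
    by move=> i [iN iJ]; exact: h2.
  by move=> i iN iJ; exact: (h2 i (conj iN iJ)).
have prE N d : forall s, (size s + d = N)%N -> Pr (E N s) =
    (\prod_(i < size s) P i (nth 0%N s i) * \prod_(size s <= i < N | i \in J) P i (x i))%:E.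
  elim: d => [|d IH] s sN.
    rewrite addn0 in sN; subst N; rewrite big_geq// mulr1 -coin_prefix//; congr (Pr _).
    apply/seteqP; split => v; first by case.
    by move=> h; split => // i /andP[Ni]; rewrite ltnNge Ni.
  have ltN : (size s < N)%N by rewrite -sN addnS ltnS leq_addr.
  have sS y : (size (rcons s y) + d = N)%N by rewrite size_rcons addSnnS.
  have prS y : \prod_(i < size (rcons s y)) P i (nth 0%N (rcons s y) i) =
      \prod_(i < size s) P i (nth 0%N s i) * P (size s) y.
    rewrite size_rcons big_ord_recr/= nth_rcons ltnn eqxx; congr (_ * _).
    by apply: eq_bigr => i _; rewrite nth_rcons ltn_ord.
  have ES v y : (forall i, (i < (size s).+1)%N -> coin P i v = nth 0%N (rcons s y) i) <->
      (forall i, (i < size s)%N -> coin P i v = nth 0%N s i) /\ coin P (size s) v = y.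
    split=> [h|[h hy] i].
      split=> [i si|]; last by rewrite h// nth_rcons ltnn eqxx.
      by rewrite h ?nth_rcons ?si// ltnS ltnW.
    rewrite ltnS leq_eqVlt nth_rcons => /predU1P[->|si]; first by rewrite ltnn eqxx.
    by rewrite si h.
  have rest_S v (B : nat -> Prop) : (forall i, (size s <= i < N)%N -> B i) <->
      B (size s) /\ (forall i, (size s < i < N)%N -> B i).
    split=> [h|[h0 h] i]; first by split => [|i /andP[si iN]]; apply: h; rewrite ?leqnn ?ltN// (ltnW si).
    by rewrite leq_eqVlt => /andP[/predU1P[<-//|si] iN]; apply: h; rewrite si.
  rewrite big_ltn_cond//; case: ifP => [sJ|sJ].
    have -> : E N s = E N (rcons s (x (size s))).
      apply/seteqP; split => v; rewrite /E/= size_rcons ES rest_S//.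
        by move=> [h1 [h2 h3]]; split => //; split => //; exact: h2.
      by move=> [[h1 h2] h3]; split.
    by rewrite (IH _ (sS _)) prS size_rcons mulrA.
  have -> : E N s = \bigcup_y E N (rcons s y).
    apply/seteqP; split => v.
      rewrite {1}/E/= rest_S// => -[h1 [_ h3]]; exists (coin P (size s) v) => //.
      by rewrite /E/= size_rcons ES.
    move=> [y _]; rewrite /E/= size_rcons ES rest_S// => -[[h1 _] h3]; split => //.
    by split => //; rewrite sJ.
  rewrite measure_bigcup; last first.
  - apply/trivIsetP => y z _ _ yz; apply/seteqP; split => v // -[].
    rewrite /E/= !size_rcons !ES => -[[_ ey] _] [[_ ez] _].
    by move: yz; rewrite -ey -ez eqxx.
  - by move=> y _; exact: mE.
  set A := \prod_(i < size s) _; set B := \prod_((size s).+1 <= i < N | _) _.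
  rewrite (eq_eseriesl (Q := xpredT)); last by move=> y; rewrite in_setT.
  rewrite (eq_eseriesr (g := fun y => ((A * B)%:E * (P (size s) y)%:E)%E)).
    rewrite nneseriesZl; last by move=> y _; rewrite lee_fin; have [] := Pd (size s).
    by have [_ ->] := Pd (size s); rewrite mule1.
  by move=> y _; apply: etrans (IH _ (sS y)) _; rewrite prS size_rcons -EFinM mulrAC.
pose N := (\sum_(i <- J) i).+1%N.
have JN i : i \in J -> (i < N)%N.
  by move=> iJ; rewrite ltnS (big_rem i)//= leq_addr.
have -> : [set v | forall i, i \in J -> coin P i v = x i] = E N [::].
  apply/seteqP; split => v h; first by split => // i _; exact: h.
  by move=> i iJ; apply: (proj2 h) => //; rewrite JN.
rewrite (prE N N)//= big_ord0 mul1r; congr EFin.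
rewrite -big_filter; apply: perm_big; apply: uniq_perm => //.
  by rewrite filter_uniq// iota_uniq.
move=> i; rewrite mem_filter mem_index_iota /=.
by case iJ: (i \in J) => //=; rewrite JN.
Qed.

End Digits.

(** * The multi-type tree built from a family of offspring variables *)

(** For variables with countably many values measurability is a property of the
    fibres, and is preserved by arbitrary, even random, maps. *)
Section DiscreteMeasurable.
Context d (T : measurableType d).

Definition discrete_measurable (K : Type) (f : T -> K) := forall k, measurable (f @^-1` [set k]).

Lemma discrete_measurable_preimage (K : countType) (f : T -> K) (B : set K) :
  discrete_measurable f -> measurable (f @^-1` B).
Proof.
move=> mf; have -> : f @^-1` B = \bigcup_k (if k \in B then f @^-1` [set k] else set0).
  apply/seteqP; split => [v Bv|v [k _]]; last first.
    by case: ifP => // /set_mem Bk fk; rewrite /preimage/= fk.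
  by exists (f v) => //; rewrite mem_set.
apply: countable_bigcupT_measurable => [|k]; first exact: countableP.
by case: ifP => // _; exact: mf.
Qed.

Lemma discrete_measurable_comp (K : countType) (K' : Type) (g : K -> K') (f : T -> K) :
  discrete_measurable f -> discrete_measurable (g \o f).
Proof. by move=> mf k; exact: (discrete_measurable_preimage (g @^-1` [set k]) mf). Qed.

Lemma discrete_measurable_bind (K : countType) (K' : Type) (f : T -> K) (g : K -> T -> K') :
  discrete_measurable f -> (forall k, discrete_measurable (g k)) ->
  discrete_measurable (fun w => g (f w) w).
Proof.
move=> mf mg k'.
have -> : (fun w => g (f w) w) @^-1` [set k'] = \bigcup_k (f @^-1` [set k] `&` g k @^-1` [set k']).
  apply/seteqP; split => [w gw|w [k _ [fk gk]]]; first by exists (f w).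
  by rewrite /preimage/= fk.
apply: countable_bigcupT_measurable => [|k]; first exact: countableP.
by apply: measurableI; [exact: mf | exact: mg].
Qed.

Lemma discrete_measurable_fun (f : T -> nat) : discrete_measurable f -> measurable_fun setT f.
Proof. by move=> mf; exact: measurable_fun_nat. Qed.

Lemma measurable_forall (K : countType) (F : K -> set T) :
  (forall k, measurable (F k)) -> measurable [set w | forall k, F k w].
Proof.
move=> mF; have -> : [set w | forall k, F k w] = ~` \bigcup_k ~` F k.
  apply/seteqP; split => [w Fw [k _]|w nF k]; first by apply; exact: Fw.
  by apply: contrapT => nk; apply: nF; exists k.
apply: measurableC; apply: countable_bigcupT_measurable => [|k]; first exact: countableP.
exact: measurableC.
Qed.

End DiscreteMeasurable.

Section MultitypeTree.
Context d (T : measurableType d).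
Variables (xi : word -> nat -> T -> seq nat) (n0 p : nat).
Hypothesis mxi : forall u l, discrete_measurable (xi u l).
Implicit Types (w : T) (u v : word).

(** Words are read from the root down. The state is the word read so far with the
    type of that node, or [None] once the tree has been left. *)
Definition label_step w (st : word * option nat) (i : nat) : word * option nat :=
  (rcons st.1 i,
   if st.2 is Some l then
     if (0 < i <= size (xi st.1 l w))%N then Some (nth 0%N (xi st.1 l w) i.-1) else None
   else None).

Definition label w v : option nat := (foldl (label_step w) (ones n0, Some p) v).2.

Definition is_node w u : bool := (take n0 u == ones n0) && isSome (label w (drop n0 u)).

Definition node_type w u : nat := odflt 0%N (label w (drop n0 u)).

Lemma label_rcons w v i : label w (rcons v i) =
  if label w v is Some l then
    if (0 < i <= size (xi (ones n0 ++ v) l w))%N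
    then Some (nth 0%N (xi (ones n0 ++ v) l w) i.-1) else None
  else None.
Proof.
have fst_foldl : (foldl (label_step w) (ones n0, Some p) v).1 = ones n0 ++ v.
  by elim/last_ind: v => [|v j IH]; rewrite ?cats0// foldl_rcons/= IH rcons_cat.
by rewrite /label foldl_rcons/= fst_foldl.
Qed.

Lemma is_node_size w u : is_node w u -> (n0 <= size u)%N.
Proof.
move=> /andP[/eqP/(congr1 size)]; rewrite size_take size_ones.
by case: ltnP => [/ltnW//|_ ->].
Qed.

Lemma is_node_root w : is_node w (ones n0).
Proof. by rewrite /is_node take_oversize ?drop_oversize ?size_ones// eqxx. Qed.

Lemma node_type_root w : node_type w (ones n0) = p.
Proof. by rewrite /node_type drop_oversize ?size_ones. Qed.

Lemma node_rcons w u i : rcons u i <> ones n0 ->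
  is_node w (rcons u i) = is_node w u && (0 < i <= size (xi u (node_type w u) w))%N /\
  (is_node w (rcons u i) -> node_type w (rcons u i) = nth 0%N (xi u (node_type w u) w) i.-1).
Proof.
move=> ur; have [un|nu] := ltnP (size u) n0.
  have -> : is_node w u = false by apply/negP => /is_node_size; rewrite leqNgt un.
  have -> : is_node w (rcons u i) = false.
    rewrite /is_node take_oversize ?size_rcons//.
    by move/eqP/negbTE: ur => ->.
  by [].
rewrite /is_node /node_type drop_rcons// label_rcons.
have -> : take n0 (rcons u i) = take n0 u by rewrite -cats1 takel_cat.
case: eqP => //= tu; have -> : ones n0 ++ drop n0 u = u by rewrite -{1}tu cat_take_drop.
by case: (label w (drop n0 u)) => //= l; case: ifP.
Qed.

Lemma is_node_rooted w : rooted_tree (ones n0) [set u | is_node w u].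
Proof.
have root_ne v i : (n0 <= size v)%N -> rcons v i <> ones n0.
  by move=> nv /(congr1 size)/eqP; rewrite size_rcons size_ones gtn_eqF// ltnS.
split.
- move=> u /=; elim/last_ind: u => [//|u i IH]; have [->|/eqP ur] := eqVneq (rcons u i) (ones n0).
    by rewrite /words/= ones_word.
  rewrite (node_rcons w ur).1 => /andP[/IH wu /andP[i0 _]].
  by rewrite /words/= all_rcons i0.
- exact: is_node_root.
- by move=> v; rewrite size_ones => vn /is_node_size; rewrite leqNgt vn.
- by move=> v i /= tv ur; move: tv; rewrite (node_rcons w ur).1 => /andP[].
- move=> v /= tv; exists (size (xi v (node_type w v) w)) => i i0.
  by rewrite (node_rcons w (root_ne _ _ (is_node_size tv))).1 tv i0.
Qed.

Definition multitype_tree w : tree := tree_of (is_node_rooted w).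

Lemma discrete_measurable_label v : discrete_measurable (fun w => label w v).
Proof.
elim/last_ind: v => [|v i IH].
  move=> k; have [ek|nk] := pselect (Some p = k).
    by rewrite (_ : _ @^-1` _ = setT)//; apply/seteqP; split.
  by rewrite (_ : _ @^-1` _ = set0)//; apply/seteqP; split => // w.
pose g (o : option nat) w := if o is Some l then
    if (0 < i <= size (xi (ones n0 ++ v) l w))%N
    then Some (nth 0%N (xi (ones n0 ++ v) l w) i.-1) else None
  else None.
have -> : (fun w => label w (rcons v i)) = (fun w => g (label w v) w).
  by apply/funext => w; rewrite label_rcons.
apply: (@discrete_measurable_bind _ T (option nat) _ _ g IH) => -[l|].
  exact: (discrete_measurable_comp (fun s => if (0 < i <= size s)%N then Some (nth 0%N s i.-1) else None)
    (mxi (ones n0 ++ v) l)).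
by move=> k; have [<-|nk] := pselect (None = k);
  [rewrite (_ : _ @^-1` _ = setT)//; apply/seteqP; split
  |rewrite (_ : _ @^-1` _ = set0)//; apply/seteqP; split].
Qed.

Lemma measurable_node_type u : discrete_measurable (fun w => node_type w u).
Proof. exact: (discrete_measurable_comp (odflt 0%N) (discrete_measurable_label (drop n0 u))). Qed.

Lemma measurable_is_node u : measurable [set w | is_node w u].
Proof.
exact: (discrete_measurable_preimage [set o | (take n0 u == ones n0) && isSome o]
  (discrete_measurable_label (drop n0 u))).
Qed.

Lemma measurable_multitype_tree : measurable_fun setT multitype_tree.
Proof.
apply: (@measurability _ _ _ _ _ _ cylinders) => // _ [A [h _ hA] <-].
rewrite setTI (filtr_bigcup h A) preimage_bigcup.
apply: bigcup_measurable => i _; have [[x0 [_ ->]]|->] := code_atom i hA; last by rewrite preimage_set0.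
rewrite (_ : _ @^-1` _ = [set w | forall u : seq nat, is_node w u /\ (size u <= h)%N <-> restr h x0 u]).
  apply: (@measurable_forall _ T (seq nat) (fun u =>
    [set w | is_node w u /\ (size u <= h)%N <-> restr h x0 u])) => u.
  have [hu|hu] := leqP (size u) h; last first.
    have [xu|xu] := pselect (restr h x0 u).
      by rewrite (_ : [set _ | _] = set0)//; apply/seteqP; split => // w /= [_ /(_ xu)[]].
    by rewrite (_ : [set _ | _] = setT)//; apply/seteqP; split => // w _ /=; split => // -[].
  have [xu|xu] := pselect (restr h x0 u).
    rewrite (_ : [set _ | _] = [set w | is_node w u]); first exact: measurable_is_node.
    by apply/seteqP; split => w /=; [move=> [_ /(_ xu)[]]|move=> nu; split].
  rewrite (_ : [set _ | _] = ~` [set w | is_node w u]); first exact/measurableC/measurable_is_node.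
  by apply/seteqP; split => w /=; [move=> [h1 _] nu; apply: xu; apply: h1|move=> nu; split => // -[]].
apply/seteqP; split => w; rewrite /atom/preimage/=.
  by move=> <- u.
by move=> H; apply/seteqP; split => u /H.
Qed.

(** By induction on words: the type of a node selects the offspring variable to
    be read there, and that variable gives the types of the children. *)
Lemma multitype_treeP w (h : nat) (t : set word) (c : word -> nat) :
  (n0 < h)%N -> rooted_tree (ones n0) t -> (forall u, t u -> (size u <= h)%N) ->
  c (ones n0) = p ->
  (restr h (multitype_tree w) = t /\ forall u, t u -> node_type w u = c u) <->
  (forall u, restr h.-1 t u -> xi u (c u) w = [seq c (rcons u i) | i <- iota 1 (nkids t u)]).
Proof.
move=> n0h rt th cr; have h0 : (0 < h)%N by exact: leq_ltn_trans n0h.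
have root_ne v i : (n0 <= size v)%N -> rcons v i <> ones n0.
  by move=> nv /(congr1 size)/eqP; rewrite size_rcons size_ones gtn_eqF// ltnS.
have tsize u : t u -> (n0 <= size u)%N by move=> /(rooted_size rt); rewrite size_ones.
split=> [[tauE typE] u [tu uh]|H].
  have nkE : nkids t u = size (xi u (c u) w).
    apply: nkids_unique => i i0; rewrite -{1}tauE /restr/= size_rcons.
    have uh' : (size u < h)%N by rewrite -(prednK h0).
    rewrite (node_rcons w (root_ne _ _ (tsize _ tu))).1 typE// i0 uh'/=.
    have : restr h (multitype_tree w) u by rewrite tauE.
    by move=> [/= -> _]; split => [[]|].
  apply: (@eq_from_nth _ 0%N); first by rewrite size_map size_iota.
  move=> i; rewrite -nkE => ik; rewrite (nth_map 0%N) ?size_iota// nth_iota// add1n.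
  have tui : t (rcons u i.+1) by apply/(nkidsP rt tu).
  rewrite -(typE _ tui) (node_rcons w (root_ne _ _ (tsize _ tu))).2 ?(typE _ tu)//.
  have : restr h (multitype_tree w) (rcons u i.+1) by rewrite tauE.
  by move=> [].
have main u : (size u <= h)%N -> (is_node w u <-> t u) /\ (t u -> node_type w u = c u).
  elim/last_ind: u => [|u i IH] uh; last first.
    have [->|/eqP ur] := eqVneq (rcons u i) (ones n0).
      rewrite is_node_root node_type_root cr; split => //; split => // _; exact: rooted_root rt.
    rewrite size_rcons in uh; have [nu cu] := IH (ltnW uh).
    have [nui tui] := node_rcons w ur.
    have [tu|ntu] := pselect (t u); last first.
      have ntui : ~ t (rcons u i) by move=> tui'; exact: ntu (rooted_parent rt tui' ur).
      rewrite nui; split; last by move=> /ntui.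
      by split => [/andP[/nu]|/ntui].
    have xiE : xi u (c u) w = [seq c (rcons u j) | j <- iota 1 (nkids t u)].
      by apply: H; split => //; rewrite -ltnS prednK.
    have nu' : is_node w u by apply/nu.
    rewrite (cu tu) xiE nu' size_map size_iota /= in nui tui.
    have iff_ui : is_node w (rcons u i) <-> t (rcons u i).
      rewrite nui; split=> [/andP[i0 ik]|tui']; first exact/(nkidsP rt tu).
      have i0 := rooted_letter rt tui'; rewrite i0; exact/(nkidsP rt tu).
    split => // tui'; have i0 := rooted_letter rt tui'; rewrite tui; last exact/iff_ui.
    have ik : (i.-1 < nkids t u)%N by rewrite prednK//; apply/(nkidsP rt tu).
    by rewrite (nth_map 0%N) ?size_iota// nth_iota// add1n prednK.
  have [n00|n0_gt0] := posnP n0.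
    have -> : [::] = ones n0 by rewrite n00.
    rewrite is_node_root node_type_root cr; split => //; split => // _; exact: rooted_root rt.
  split; last by move=> /tsize; rewrite leqNgt n0_gt0.
  by split => [/is_node_size|/tsize]; rewrite leqNgt n0_gt0.
split=> [|u tu]; last by apply: (main u (th u tu)).2.
apply/seteqP; split => u; first by move=> [nu uh]; apply/(main u uh).1.
by move=> tu; split; [apply/(main u (th u tu)).1|exact: th].
Qed.

End MultitypeTree.

(** * Existence of the multi-type tree *)

Section MultitypeLaw.
Context {R : realType}.
Implicit Types (r : seq nat -> R) (u : word).

Local Notation decode := (@choice.pickle_inv (seq nat : countType)).
Local Notation encode := (@choice.pickle (seq nat : countType)).

(** The independent variables of [coin_indep] are integers, so offspring sequences
    are encoded. *)
Definition coded r (k : nat) : R := if decode k is Some s then r s else 0.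

Lemma codedE r s : coded r (encode s) = r s.
Proof. by rewrite /coded choice.pickleK_inv. Qed.

Lemma single_term_series (x : R) (k0 : nat) : 0 <= x ->
  (\sum_(k <oo) (if k == k0 then x else 0)%:E = x%:E)%E.
Proof.
move=> x0; rewrite nneseries_esumT; last by move=> k; case: ifP; rewrite lee_fin.
rewrite -(esum_set1 (t := k0) (a := fun=> x%:E)) ?lee_fin// [RHS]esum_mkcond.
apply: eq_esum => k _; rewrite (_ : (k \in [set k0]) = (k == k0)); last first.
  by apply/idP/eqP => [/set_mem|->]//; exact: mem_set.
by case: eqP.
Qed.

Definition ffun_seq (p n : nat) (f : {ffun 'I_n -> 'I_p.+1}) : seq nat :=
  [seq val (f i) | i <- enum 'I_n].

Lemma size_ffun_seq p n (f : {ffun 'I_n -> 'I_p.+1}) : size (ffun_seq f) = n.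
Proof. by rewrite size_map size_enum_ord. Qed.

Lemma big_ffun_seq (T : Type) (idx : T) (op : Monoid.com_law idx) p n
    (f : {ffun 'I_n -> 'I_p.+1}) (F : nat -> T) :
  \big[op/idx]_(j <- ffun_seq f) F j = \big[op/idx]_i F (f i).
Proof. by rewrite big_map big_enum. Qed.

(** Sums over all the sequences of given sum, arranged by length. *)
Lemma coded_series r p l : (l <= p)%N -> (forall s, 0 <= r s) ->
  (forall s, r s != 0 -> sumn s = l) ->
  (\sum_(k <oo) (coded r k)%:E =
   \sum_(n <oo) (\sum_(f : {ffun 'I_n -> 'I_p.+1} | (\sum_i f i)%N == l) r (ffun_seq f))%:E)%E.
Proof.
move=> lp r0 r_sum.
pose G k n : R := \sum_(f : {ffun 'I_n -> 'I_p.+1} | (\sum_i f i)%N == l)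
  (if k == encode (ffun_seq f) then r (ffun_seq f) else 0).
have G0 k n : 0 <= G k n by apply: sumr_ge0 => f _; case: ifP.
transitivity (\sum_(k <oo) \sum_(n <oo) (G k n)%:E)%E.
  apply: eq_eseriesr => k _; rewrite /coded.
  have := @choice.pickle_invK (seq nat : countType) k.
  case E: (decode k) => [s|] /=.
    move=> sk; rewrite -(single_term_series (size s) (r0 s)); apply: eq_eseriesr => n _.
    congr EFin; apply/esym; case: eqVneq => [->|ns]; last first.
      apply: big1 => f _; case: eqP => // kf; case/eqP: ns.
      by rewrite -(size_ffun_seq f); congr size; apply: (pcan_inj choice.pickleK); rewrite -kf sk.
    have kE (f : {ffun 'I_(size s) -> 'I_p.+1}) : (k == encode (ffun_seq f)) = (s == ffun_seq f).
      by rewrite -sk; apply/eqP/eqP => [e|e]; [exact: (pcan_inj choice.pickleK e) | exact: (congr1 _ e)].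
    have [rs0|rs_neq0] := eqVneq (r s) 0.
      by rewrite rs0; apply: big1 => f _; rewrite kE; case: eqP => // <-; exact: rs0.
    have sl := r_sum s rs_neq0.
    pose f0 := [ffun i : 'I_(size s) => inord (nth 0%N s i) : 'I_p.+1].
    have f0s : ffun_seq f0 = s.
      apply: (@eq_from_nth _ 0%N); first exact: size_ffun_seq.
      rewrite size_ffun_seq => i si; rewrite /ffun_seq (nth_map (Ordinal si)) ?size_enum_ord//.
      rewrite (nth_ord_enum _ (Ordinal si)) ffunE /= inordK// ltnS (leq_trans _ lp)// -sl.
      by rewrite sumnE (big_nth 0%N) big_mkord (bigD1 (Ordinal si))//= leq_addr.
    rewrite /G (bigD1 f0)/=; last first.
      by rewrite -(big_ffun_seq _ f0 id) f0s -sl sumnE.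
    rewrite f0s sk eqxx big1 ?addr0// => f /andP[_ ff0]; rewrite kE; case: eqP => // sf.
    case/eqP: ff0; apply/ffunP => i; apply: val_inj => /=.
    have nthf (g : {ffun 'I_(size s) -> 'I_p.+1}) : nth 0%N (ffun_seq g) i = g i.
      by rewrite /ffun_seq (nth_map i) ?size_enum_ord// nth_ord_enum.
    by rewrite -!nthf -sf f0s.
  move=> _; rewrite eseries0// => n _ _; congr EFin; apply: big1 => f _.
  by case: eqP => // kf; move: E; rewrite kf choice.pickleK_inv.
rewrite nneseries_interchange; last by move=> k n; rewrite lee_fin.
apply: eq_eseriesr => n _; rewrite /G.
under eq_eseriesr => k _ do rewrite -sumEFin.
rewrite nneseries_sum; last by move=> f k _; case: ifP; rewrite lee_fin.
rewrite -sumEFin; apply: eq_bigr => f _; exact: single_term_series.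
Qed.

Variables (rho : nat -> nat -> seq nat -> R) (n0 p : nat).
Hypothesis rho_dist : forall n l, (l <= p)%N -> is_distribution (coded (rho n l)).
Hypothesis rho_sum : forall n l s, rho n l s != 0 -> sumn s = l.

Local Notation decode2 := (@choice.pickle_inv (seq nat * nat : countType)%type).
Local Notation encode2 := (@choice.pickle (seq nat * nat : countType)%type).

(** One variable for each node [u] and each type [l] that the node could have; it
    is read only if [u] turns out to be a node of type [l]. Indices that are not
    such pairs receive an arbitrary law. *)
Definition coin_law (i : nat) : nat -> R :=
  if decode2 i is Some ul then
    if (ul.2 <= p)%N then coded (rho (size ul.1) ul.2) else coded (rho 0 0)
  else coded (rho 0 0).

Lemma coin_law_dist i : is_distribution (coin_law i).
Proof.
rewrite /coin_law; case: (decode2 i) => [[u l]|]; last exact: rho_dist.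
by case: ifP => lp; exact: rho_dist.
Qed.

Lemma coin_lawE u l : (l <= p)%N -> coin_law (encode2 (u, l)) = coded (rho (size u) l).
Proof. by move=> lp; rewrite /coin_law choice.pickleK_inv lp. Qed.

Definition offspring u l (v : R) : seq nat :=
  odflt [::] (decode (coin coin_law (encode2 (u, l)) v)).

Lemma offspringE u l s v : (l <= p)%N ->
  offspring u l v = s <-> coin coin_law (encode2 (u, l)) v = encode s.
Proof.
move=> lp; rewrite /offspring; split=> [|->]; last by rewrite choice.pickleK_inv.
have := coin_gt0 (encode2 (u, l)) v coin_law_dist; rewrite coin_lawE// /coded.
have := @choice.pickle_invK (seq nat : countType) (coin coin_law (encode2 (u, l)) v).
by case: (decode _) => [s' /= <- _ ->//|_]; rewrite ltxx.
Qed.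

Lemma offspring_sum u l v : (l <= p)%N -> sumn (offspring u l v) = l.
Proof.
move=> lp; have /(offspringE _ _ _ lp) ov := erefl (offspring u l v).
have := coin_gt0 (encode2 (u, l)) v coin_law_dist; rewrite coin_lawE// ov codedE.
by move=> r0; apply: (@rho_sum (size u)); rewrite gt_eqF.
Qed.

Lemma discrete_measurable_offspring u l : discrete_measurable (offspring u l).
Proof.
apply: (discrete_measurable_comp (fun k => odflt [::] (decode k))) => k.
by rewrite -[X in measurable X]setTI; exact: (measurable_coin _ coin_law_dist).
Qed.

Local Notation tau := (multitype_tree offspring n0 p).
Local Notation typ := (node_type offspring n0 p).
Local Notation Pr := (uniform_prob (@ltr01 R)).

Lemma nth_le_sumn (s : seq nat) i : (nth 0 s i <= sumn s)%N.
Proof.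
elim: s i => [|x s IH] [|i] //=; first exact: leq_addr.
exact: leq_trans (IH i) (leq_addl _ _).
Qed.

Lemma node_type_le v u : is_node offspring n0 p v u -> (typ v u <= p)%N.
Proof.
elim/last_ind: u => [|u i IH] nu.
  have /size0nil e : size (ones n0) = 0%N.
    by apply/eqP; rewrite size_ones -leqn0; exact: is_node_size nu.
  by rewrite -e node_type_root.
have [->|/eqP ur] := eqVneq (rcons u i) (ones n0); first by rewrite node_type_root.
have [nE tE] := node_rcons offspring p v ur; rewrite tE//.
move: nu; rewrite nE => /andP[/IH up _].
by apply: leq_trans (nth_le_sumn _ _) _; rewrite offspring_sum.
Qed.

(** The event reads one offspring variable per node of the first generations, and
    these are independent. Types never exceed that of the root, so a labelling
    [c] with larger types gives 0 on both sides. *)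
Lemma multitype_law (h : nat) (t : set word) (c : word -> nat) :
  (n0 < h)%N -> rooted_tree (ones n0) t -> (forall u, t u -> (size u <= h)%N) ->
  Pr [set v | restr h (tau v) = t /\ forall u, t u -> typ v u = c u] =
  ((c (ones n0) == p)%:R *
   \big[*%R/1]_(u \in restr h.-1 t)
     rho (size u) (c u) [seq c (rcons u i) | i <- iota 1 (nkids t u)])%:E.
Proof.
move=> n0h rt th; case: eqVneq => [cr|/eqP cr]; last first.
  rewrite mul0r (_ : [set v | _] = set0) ?measure0//.
  apply/seteqP; split => // v /= [_ /(_ _ (rooted_root rt))].
  by rewrite node_type_root => /esym.
rewrite mul1r.
pose s u := [seq c (rcons u i) | i <- iota 1 (nkids t u)].
pose U := upto (ones n0) t (h - n0).
have memU u : u \in U <-> t u /\ (size u < h)%N.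
  by rewrite /U (mem_upto rt) size_ones subnKC// ltnW.
have UE : restr h.-1 t = [set` U].
  apply/seteqP; split => u /=.
    by move=> [tu uh]; apply/memU; rewrite -(prednK (leq_ltn_trans _ n0h)).
  by move/memU => [tu uh]; split => //; rewrite -ltnS prednK// (leq_ltn_trans _ n0h).
rewrite UE -fsbig_seq ?upto_uniq//.
have [cp|ncp] := pselect (forall u, u \in U -> (c u <= p)%N).
  pose J := [seq encode2 (u, c u) | u <- U].
  pose x i := if decode2 i is Some ul then encode (s ul.1) else 0%N.
  have -> : [set v | restr h (tau v) = t /\ forall u, t u -> typ v u = c u] =
      [set v | forall i, i \in J -> coin coin_law i v = x i].
    apply/seteqP; split => v /=.
      move=> /(multitype_treeP offspring v n0h rt th cr) H i /mapP[u Uu ->].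
      rewrite /x choice.pickleK_inv/=; apply/(offspringE _ _ _ (cp _ Uu)); apply: H.
      by rewrite UE.
    move=> H; apply/(multitype_treeP offspring v n0h rt th cr) => u; rewrite UE /= => Uu.
    apply/(offspringE _ _ _ (cp _ Uu)); rewrite H; first by rewrite /x choice.pickleK_inv.
    exact: map_f.
  rewrite coin_indep; last 2 first.
  - exact: coin_law_dist.
  - by rewrite map_inj_uniq ?upto_uniq// => u u' /(pcan_inj choice.pickleK)[].
  congr EFin; rewrite big_map; apply: eq_big_seq => u Uu.
  by rewrite coin_lawE ?cp// /x choice.pickleK_inv codedE.
rewrite (_ : [set v | _] = set0); last first.
  apply/seteqP; split => // v /= [tauE tyE]; apply: ncp => u /memU[tu _].
  rewrite -tyE//; apply: node_type_le.
  have : restr h (tau v) u by rewrite tauE.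
  by move=> [].
rewrite measure0; apply/esym; congr EFin; apply: contrapT => prod_neq0; apply: ncp.
have sumE u : u \in U -> sumn (s u) = c u.
  move=> Uu; apply: (@rho_sum (size u)); apply/eqP => r0; apply: prod_neq0.
  by rewrite (big_rem u)//= r0 mul0r.
suff H u : t u -> (c u <= p)%N by move=> u /memU[tu _]; exact: H.
elim/last_ind: u => [|u i IH] tu.
  have /size0nil e : size (ones n0) = 0%N.
    by apply/eqP; rewrite -leqn0; exact: (rooted_size rt tu).
  by rewrite -e cr.
have [->|/eqP ur] := eqVneq (rcons u i) (ones n0); first by rewrite cr.
have tu' := rooted_parent rt tu ur; have i0 := rooted_letter rt tu.
have ik : (i.-1 < nkids t u)%N by rewrite prednK//; apply/(nkidsP rt tu').
apply: leq_trans (IH tu'); rewrite -(sumE u); last first.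
  by apply/memU; split => //; have := th _ tu; rewrite size_rcons.
apply: leq_trans (nth_le_sumn (s u) i.-1).
by rewrite (nth_map 0%N) ?size_iota// nth_iota// add1n prednK.
Qed.

Lemma node_type_sum v u : nodes (tau v) u ->
  typ v u = (\sum_(w <- [seq rcons u i | i <- iota 1 (nkids (tau v) u)]) typ v w)%N.
Proof.
move=> nu; have ur i : rcons u i <> ones n0.
  move=> /(congr1 size)/eqP; rewrite size_rcons size_ones gtn_eqF// ltnS.
  exact: is_node_size nu.
pose s := offspring u (typ v u) v.
have nuE i : is_node offspring n0 p v (rcons u i) = (0 < i <= size s)%N.
  by rewrite (node_rcons offspring p v (ur i)).1 nu.
have -> : nkids (tau v) u = size s.
  by apply: nkids_unique => i i0 /=; rewrite nuE i0.
have sE : sumn s = typ v u by apply: offspring_sum; exact: node_type_le.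
rewrite -{1}sE sumnE (big_nth 0%N) big_map -(addn0 1%N) iotaDl big_map /index_iota subn0.
apply: eq_big_seq => i; rewrite mem_iota/= => is_.
by rewrite (node_rcons offspring p v (ur _)).2 ?nuE//= add1n.
Qed.

End MultitypeLaw.

(** * Density of the law of the multi-type tree *)

Section TypeSums.
Variables (r : word) (t : set word).

Local Notation children u := [seq rcons u i | i <- iota 1 (nkids t u)].

Lemma sum_lev (c : word -> nat) k :
  (forall j u, (j < k)%N -> u \in lev r t j -> c u = (\sum_(v <- children u) c v)%N) ->
  (\sum_(v <- lev r t k) c v = c r)%N.
Proof.
elim: k => [|k IH] H; first by rewrite /= big_seq1.
rewrite -IH; last by move=> j u jk; apply: H; exact: ltnW.
rewrite /= big_flatten big_map; apply: eq_big_seq => u uk.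
by rewrite -(H k).
Qed.

(** The type of a node is the sum of the types of its children, hence of its
    descendants at distance [m]. *)
Fixpoint ancestor_type (d : word -> nat) (m : nat) (u : word) : nat :=
  if m is m'.+1 then (\sum_(v <- children u) ancestor_type d m' v)%N else d u.

Variable h : nat.

Definition type_from_leaves (d : word -> nat) (u : word) := ancestor_type d (h - size u) u.

Lemma type_from_leavesS d u : (size u < h)%N ->
  type_from_leaves d u = (\sum_(v <- children u) type_from_leaves d v)%N.
Proof.
move=> uh; rewrite {1}/type_from_leaves; case E: (h - size u)%N => [|m] /=.
  by move/eqP: E; rewrite subn_eq0 leqNgt uh.
apply: eq_big_seq => v /mapP[i _ ->]; rewrite /type_from_leaves size_rcons subnS.
by rewrite E.
Qed.

Lemma type_from_leaves_leaf d u : size u = h -> type_from_leaves d u = d u.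
Proof. by rewrite /type_from_leaves => ->; rewrite subnn. Qed.

(** Labellings in which every type is the sum of the types of the children are
    determined by their values on generation [h]. *)
Lemma eq_types (c c' : word -> nat) : rooted_tree r t ->
  (forall u, t u -> (size u < h)%N -> c u = (\sum_(v <- children u) c v)%N) ->
  (forall u, t u -> (size u < h)%N -> c' u = (\sum_(v <- children u) c' v)%N) ->
  (forall u, t u -> size u = h -> c u = c' u) ->
  forall u, t u -> (size u <= h)%N -> c u = c' u.
Proof.
move=> rt cS cS' cc' u; have [m] := ubnP (h - size u); elim: m u => // m IH u hum tu.
rewrite leq_eqVlt => /predU1P[|uh]; first exact: cc'.
rewrite cS// cS'//; apply: eq_big_seq => v /mapP[i].
rewrite mem_iota add1n ltnS => /andP[i0 ik] ->; apply: IH; rewrite ?size_rcons//.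
  by rewrite subnS prednK ?subn_gt0.
exact/(nkidsP rt tu i0).
Qed.

End TypeSums.

Section Density.
Context {R : realType} d (Om : measurableType d) (Pr : probability Om R).
Variables (tau : Om -> tree) (typ : Om -> word -> nat) (n0 p : nat).
Variables (qb : nat -> R) (mb : R) (V : nat -> {poly R}) (rho : nat -> nat -> seq nat -> R).
Hypotheses (mb0 : 0 < mb) (V_gt0 : forall n l, (l <= p)%N -> 0 < (V n)`_l).
Hypothesis rhoE : forall n l s, (l <= p)%N -> sumn s = l ->
  rho n l s = qb (size s) * (\prod_(j <- s) (V n.+1)`_j) / (mb ^+ l * (V n)`_l).

Local Notation children t u := [seq rcons u i | i <- iota 1 (nkids t u)].

Lemma prod_rho_generation n t (c : word -> nat) (s : seq word) :
  (forall u, u \in s -> [/\ size u = n, (c u <= p)%N & c u = (\sum_(v <- children t u) c v)%N]) ->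
  \prod_(u <- s) rho (size u) (c u) [seq c (rcons u i) | i <- iota 1 (nkids t u)] =
  (\prod_(u <- s) qb (nkids t u)) *
  (\prod_(v <- flatten [seq children t u | u <- s]) (V n.+1)`_(c v)) /
  (mb ^+ (\sum_(u <- s) c u) * \prod_(u <- s) (V n)`_(c u)).
Proof.
elim: s => [|u s IH] H; first by rewrite /= !big_nil !mulr1 divr1.
have [un cp cS] := H u (mem_head _ _).
have sumc : sumn [seq c (rcons u i) | i <- iota 1 (nkids t u)] = c u.
  by rewrite cS big_map sumnE big_map.
rewrite !big_cons IH; last by move=> v vs; apply: H; rewrite inE vs orbT.
rewrite rhoE// size_map size_iota un /= big_cat !big_map/= exprD.
set A := \prod_(i <- iota _ _) _; set B := \prod_(v <- flatten _) _; set C := \prod_(i <- s) qb _.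
set D := \prod_(i <- s) (V n)`_ _; set E := (\sum_(i <- s) c i)%N.
by rewrite !invfM; ring.
Qed.

(** The offspring probabilities telescope along the tree: the weight of a type
    appears once as a child and once as a parent. *)
Lemma prod_rho t (c : word -> nat) k : rooted_tree (ones n0) t -> c (ones n0) = p ->
  (forall j u, (j < k)%N -> u \in lev (ones n0) t j -> c u = (\sum_(v <- children t u) c v)%N) ->
  \prod_(u <- upto (ones n0) t k) rho (size u) (c u) [seq c (rcons u i) | i <- iota 1 (nkids t u)] =
  (\prod_(u <- upto (ones n0) t k) qb (nkids t u)) *
  (\prod_(v <- lev (ones n0) t k) (V (n0 + k))`_(c v)) / (mb ^+ (p * k) * (V n0)`_p).
Proof.
move=> rt cr; elim: k => [|k IH] cS.
  by rewrite /= !big_nil big_seq1 cr addn0 muln0 expr0 !mul1r divff// gt_eqF// V_gt0.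
have cS' j u : (j < k)%N -> u \in lev (ones n0) t j -> c u = (\sum_(v <- children t u) c v)%N.
  by move=> jk; apply: cS; exact: ltnW.
have sumk := sum_lev cS'.
rewrite /= !big_cat/= (IH cS') (@prod_rho_generation (n0 + k)); last first.
  move=> u uk; split; [by rewrite (size_lev uk) size_ones | | exact: cS uk].
  by rewrite -cr -sumk (big_rem u)//= leq_addr.
rewrite sumk cr -addnS mulnS exprD.
set A := \prod_(i <- upto _ _ _) _; set B := \prod_(i <- lev _ _ _) qb _.
set C := \prod_(v <- flatten _) _; set D := \prod_(v <- lev _ _ _) _.
have D0 : D != 0.
  rewrite prodf_seq_neq0; apply/allP => u uk /=; rewrite gt_eqF// V_gt0//.
  by rewrite -cr -sumk (big_rem u)//= leq_addr.
have m0 : mb != 0 by rewrite gt_eqF.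
have v0 : (V n0)`_p != 0 by rewrite gt_eqF// V_gt0.
by field; rewrite ?D0 ?v0 ?expf_neq0.
Qed.

Hypothesis mtau : measurable_fun setT tau.
Hypothesis mtyp : forall u, measurable_fun setT (fun w => typ w u).
Hypothesis law : forall (h : nat) (t : set word) (c : word -> nat),
  (n0 < h)%N -> rooted_tree (ones n0) t -> (forall u, t u -> (size u <= h)%N) ->
  Pr [set w | restr h (tau w) = t /\ forall u, t u -> typ w u = c u] =
  ((c (ones n0) == p)%:R *
   \big[*%R/1]_(u \in restr h.-1 t)
     rho (size u) (c u) [seq c (rcons u i) | i <- iota 1 (nkids t u)])%:E.
Hypothesis rooted_tau : forall w, rooted_tree (ones n0) (tau w).
Hypothesis typ_root : forall w, typ w (ones n0) = p.
Hypothesis typ_sum : forall w u, nodes (tau w) u -> typ w u = (\sum_(v <- children (tau w) u) typ w v)%N.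

(** The types of the last generation determine all the others, so [prod_rho] is to
    be summed over the types of the last generation, of total [p]: by
    [coef_exp_ffun] this is a coefficient of a power of [V]. *)
Lemma tau_atom (x0 : tree) k : rooted_tree (ones n0) x0 ->
  Pr (tau @^-1` atom (n0 + k) x0) =
  ((\prod_(u <- upto (ones n0) x0 k) qb (nkids x0 u)) *
   (V (n0 + k) ^+ size (lev (ones n0) x0 k))`_p / (mb ^+ (p * k) * (V n0)`_p))%:E.
Proof.
move=> rx0; have [->|k0] := posnP k.
  rewrite (_ : tau @^-1` _ = setT).
    rewrite probability_setT /= big_nil expr1 addn0 muln0 expr0 !mul1r divff// gt_eqF//.
    exact: V_gt0.
  apply/seteqP; split => // w _; rewrite /preimage/= /atom/= addn0.
  have e x : rooted_tree (ones n0) x -> restr n0 x = [set` [:: ones n0]].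
    by move=> rx; have := restr_upto rx 0; rewrite size_ones addn0.
  by rewrite !e.
set h := (n0 + k)%N; have n0h : (n0 < h)%N by rewrite -addn1 leq_add2l.
pose t := restr h x0; pose L := lev (ones n0) t k; pose u0 : word := [::].
have rt : rooted_tree (ones n0) t by apply: rooted_restr => //; rewrite size_ones ltnW.
have th u : t u -> (size u <= h)%N by case.
have tt : restr h t = restr h x0 by rewrite restr_restr.
have memL u : u \in L <-> t u /\ size u = h by rewrite (mem_lev rt) size_ones.
pose dw (s : {ffun 'I_(size L) -> 'I_p.+1}) (u : word) : nat :=
  nth 0%N [seq val (s i) | i <- enum 'I_(size L)] (index u L).
have dwE s (i : 'I_(size L)) : dw s (nth u0 L i) = s i.
  by rewrite /dw index_uniq ?lev_uniq// (nth_map i) ?size_enum_ord// nth_ord_enum.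
pose c s := type_from_leaves t h (dw s).
have cS s u : t u -> (size u < h)%N -> c s u = (\sum_(v <- children t u) c s v)%N.
  by move=> _; exact: type_from_leavesS.
have c_leaf s (i : 'I_(size L)) : c s (nth u0 L i) = s i.
  by rewrite /c type_from_leaves_leaf ?dwE//; apply: (proj2 (proj1 (memL _) _)); exact: mem_nth.
have lev_t j u : (j < k)%N -> u \in lev (ones n0) t j -> t u /\ (size u < h)%N.
  by move=> jk /(mem_lev rt)[tu ->]; rewrite size_ones ltn_add2l.
have c_root s : c s (ones n0) = (\sum_r s r)%N.
  rewrite -(@sum_lev _ t (c s) k).
    by rewrite (big_nth u0) big_mkord; apply: eq_bigr => i _; exact: c_leaf.
  by move=> j u jk /(lev_t _ _ jk)[tu uh]; exact: cS.
pose E s := [set w | restr h (tau w) = t /\ forall u, t u -> typ w u = c s u].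
pose D := [pred s : {ffun 'I_(size L) -> 'I_p.+1} | (\sum_r s r == p)%N].
have atomE : tau @^-1` atom h x0 = [set w | restr h (tau w) = t] by [].
have -> : tau @^-1` atom h x0 = \bigcup_(s in [set` enum D]) E s.
  rewrite atomE; apply/seteqP; split => w; last by move=> [s _ []].
  move=> /= tauE.
  have typS u : t u -> (size u < h)%N -> typ w u = (\sum_(v <- children t u) typ w v)%N.
    by rewrite -tauE => -[tu _] uh; rewrite nkids_restr//; exact: typ_sum.
  have typ_lev : (\sum_(v <- L) typ w v = p)%N.
    rewrite -(typ_root w); apply: sum_lev => j u jk /(lev_t _ _ jk)[tu uh]; exact: typS.
  pose s := [ffun i : 'I_(size L) => inord (typ w (nth u0 L i)) : 'I_p.+1].
  have sE i : s i = typ w (nth u0 L i) :> nat.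
    rewrite ffunE inordK// ltnS -typ_lev (big_rem (nth u0 L i)) ?mem_nth//=.
    exact: leq_addr.
  have typE u : t u -> typ w u = c s u.
    move=> tu; apply: (eq_types rt typS (cS s)) (th _ tu) => // v tv vh.
    have vL : (index v L < size L)%N by rewrite index_mem; apply/memL.
    have -> : v = nth u0 L (Ordinal vL) by rewrite /= nth_index -?index_mem.
    by rewrite c_leaf sE.
  exists s => //=; rewrite mem_enum inE -c_root -typE ?typ_root//.
  exact: rooted_root rt.
have mE s : measurable (E s).
  rewrite (_ : E s = (tau @^-1` atom h x0) `&` [set w | forall u : seq nat, t u -> typ w u = c s u])//.
  apply: measurableI.
    by rewrite -[X in measurable X]setTI; apply: mtau => //; exact: measurable_atom.
  apply: (@measurable_forall _ Om (seq nat) (fun u => [set w | t u -> typ w u = c s u])) => u.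
  have [tu|ntu] := pselect (t u).
    rewrite (_ : [set w | _] = (fun w => typ w u) @^-1` [set c s u]).
      by rewrite -[X in measurable X]setTI; exact: mtyp.
    by apply/seteqP; split => w /=; [apply|].
  by rewrite (_ : [set w | _] = setT)//; apply/seteqP; split => // w _ /ntu.
rewrite measure_fin_bigcup; last 3 first.
- exact: finite_seq.
- move=> s s' _ _ [w [[_ ws] [_ ws']]]; apply/ffunP => i; apply: val_inj => /=.
  have tL : t (nth u0 L i) by apply: (proj1 (proj1 (memL _) _)); exact: mem_nth.
  by rewrite -!c_leaf -ws// -ws'.
- by move=> s _; exact: mE.
have prE s : s \in D -> Pr (E s) = ((\prod_(u <- upto (ones n0) x0 k) qb (nkids x0 u)) *
    (\prod_r (V h)`_(s r)) / (mb ^+ (p * k) * (V n0)`_p))%:E.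
  rewrite inE => /eqP sp; rewrite law// c_root sp eqxx mul1r.
  have -> : restr h.-1 t = [set` upto (ones n0) t k].
    have hP := prednK (leq_ltn_trans (leq0n n0) n0h).
    apply/seteqP; split => u /=; have := mem_upto rt k u; rewrite size_ones -/h.
      by move=> uk [tu uh]; apply/uk; rewrite -hP.
    by move=> uk /uk[tu uh]; split => //; rewrite -ltnS hP.
  rewrite -fsbig_seq ?upto_uniq// prod_rho//; last 2 first.
  - by rewrite c_root.
  - by move=> j u jk /(lev_t _ _ jk)[tu uh]; exact: cS.
  rewrite -(eq_upto (s := t) (t := x0) (n := h))//; last by rewrite size_ones.
  congr (_%:E); congr (_ * _ / _).
    apply: eq_big_seq => u /(mem_upto rt)[_]; rewrite size_ones => uh.
    by rewrite -(eq_nkids tt uh).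
  by rewrite (big_nth u0) big_mkord; apply: eq_bigr => i _; rewrite c_leaf.
rewrite -fsbig_seq ?enum_uniq// big_enum/=.
transitivity (\sum_(s in D) ((\prod_(u <- upto (ones n0) x0 k) qb (nkids x0 u)) *
    (\prod_r (V h)`_(s r)) / (mb ^+ (p * k) * (V n0)`_p))%:E)%E.
  by apply: eq_bigr => s; exact: prE.
rewrite sumEFin; congr (_%:E).
rewrite -mulr_suml -mulr_sumr; congr (_ * _ / _).
rewrite -(eq_lev (s := t) (t := x0) (n := h))//; last by rewrite size_ones.
by rewrite (coef_exp_ffun _ _ (leqnn p)).
Qed.

End Density.

(** The probabilities of the atoms come with the existence because they are
    computed on the particular construction, where types add up everywhere and
    not just almost surely. *)
Lemma multitype_GW_exists (R : realType) (rho : nat -> nat -> seq nat -> R) (n0 p : nat)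
    (qb : nat -> R) (mb : R) (V : nat -> {poly R}) :
  (forall n l, (l <= p)%N -> is_distribution (coded (rho n l))) ->
  (forall n l s, rho n l s != 0 -> sumn s = l) -> 0 < mb ->
  (forall n l, (l <= p)%N -> 0 < (V n)`_l) ->
  (forall n l s, (l <= p)%N -> sumn s = l ->
    rho n l s = qb (size s) * (\prod_(j <- s) (V n.+1)`_j) / (mb ^+ l * (V n)`_l)) ->
  exists Q : probability tree R, [/\ multitype_GW_law rho n0 p Q,
    forall (x0 : tree) k, rooted_tree (ones n0) x0 -> Q (atom (n0 + k) x0) =
      ((\prod_(u <- upto (ones n0) x0 k) qb (nkids x0 u)) *
       (V (n0 + k) ^+ size (lev (ones n0) x0 k))`_p / (mb ^+ (p * k) * (V n0)`_p))%:E &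
    forall (x0 : tree) n, (n0 <= n)%N -> ~ rooted_tree (ones n0) x0 -> Q (atom n x0) = 0%E].
Proof.
move=> rho_dist rho_sum mb0 V0 rhoE.
pose Pr := uniform_prob (@ltr01 R); pose xi := offspring rho p.
pose tau : measurableTypeR R -> tree := multitype_tree xi n0 p.
pose typ : measurableTypeR R -> word -> nat := node_type xi n0 p.
have mxi := discrete_measurable_offspring rho_dist.
have mtau : measurable_fun setT tau := measurable_multitype_tree n0 p mxi.
have mtyp u : measurable_fun setT (fun w => typ w u).
  exact: (discrete_measurable_fun (measurable_node_type n0 p mxi u)).
have rtau w : rooted_tree (ones n0) (tau w) by exact: is_node_rooted.
pose X : {mfun measurableTypeR R >-> tree} := HB.pack tau (isMeasurableFun.Build _ _ _ _ _ mtau).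
have law := @multitype_law R rho n0 p rho_dist rho_sum.
exists (distribution Pr X); split.
- by exists _, _, Pr, tau, typ.
- move=> x0 k rx0; apply: (tau_atom (Pr := Pr) mb0 V0 rhoE mtau mtyp law rtau) => //.
    by move=> w; exact: node_type_root.
  by move=> w u; exact: (node_type_sum rho_dist rho_sum).
- move=> x0 n n0n nr; have E : tau @^-1` atom n x0 = set0.
    apply/seteqP; split => // w /(restr_le n0n) xw; apply: nr.
    by move/filtrP: (rooted_filtr n0) => /(_ _ _ xw); apply; exact: rtau.
  exact: etrans (congr1 Pr E) (measure0 Pr).
Qed.

(** * The h-transform of the sub-critical tree at the fixed point *)

Lemma EFin_div_scale (R : realType) (k u v : R) : 0 < k ->
  ((k * u)%:E / (k * v)%:E = u%:E / v%:E)%E.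
Proof.
move=> k0; rewrite !inver mulf_eq0 gt_eqF//=; case: eqVneq => [_|v0].
  by rewrite [LHS]mulr_infty sgrM gtr0_sg// mul1r -mulr_infty.
by rewrite -!EFinM; congr EFin; field; rewrite v0 gt_eqF.
Qed.

Section FixedPointTransform.
Context {R : realType}.
Variables (q : nat -> R) (kappa : R) (p : nat).
Variables (P Pbar : probability tree R) (Wbar : tree -> R).
Hypotheses (q_dist : is_distribution q) (mean1 : (mean q < 1)%E).
Hypotheses (kappa1 : 1 < kappa) (fk : genfun q kappa = kappa%:E).
Hypothesis fDp : (genfunD q (maxn p 1) kappa < +oo)%E.
Hypotheses (hP : GW_law q 0 P) (hPbar : GW_law (qbar q kappa) 0 Pbar).
Hypothesis mWbar : measurable_fun setT Wbar.
Local Notation mubar := (fine (genfunD q 1 kappa)).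
Hypothesis hWbar : {ae Pbar, forall t : tree,
  (gen_size n t)%:R / mubar ^+ n @[n --> \oo] --> Wbar t}.

Let q0 := q_dist.1.
Let kappa0 : 0 < kappa := lt_trans ltr01 kappa1.
Let qb_dist := qbar_dist q_dist kappa1 fk.
Local Notation p1 := (maxn p 1).

Let p1_gt0 : (0 < p1)%N. Proof. by rewrite leq_max ltnSn orbT. Qed.
Let pp1 : (p <= p1)%N. Proof. by rewrite leq_max leqnn. Qed.

Lemma qbar_moments i : (i <= p1)%N ->
  (\sum_(n <oo) ('C(n, i)%:R * qbar q kappa n)%:E < +oo)%E.
Proof. exact: (qbar_moment q_dist kappa1 fk fDp). Qed.

Lemma genfunD1_fixpoint : genfunD q 1 kappa = mubar%:E.
Proof.
rewrite fineK// ge0_fin_numE; last first.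
  by apply: nneseries_ge0 => n _ _; rewrite lee_fin !mulr_ge0// exprn_ge0// ltW.
have := qbar_ffact q_dist kappa1 1; rewrite expr1 divff ?gt_eqF// mul1e => <-.
have := qbar_moments p1_gt0; rewrite (eq_eseriesr (g := fun n => ((n ^_ 1)%:R * qbar q kappa n)%:E))//.
by move=> n _; rewrite bin1 ffactn1.
Qed.

Let mb1 : 1 < mubar := qbar_mean_gt1 q_dist kappa1 fk mean1 genfunD1_fixpoint.
Let qb_mean := qbar_mean q_dist kappa1 genfunD1_fixpoint.
Let mb0 : 0 < mubar := lt_trans ltr01 mb1.

(** The limit is nonnegative almost surely; the results on moments are applied to
    a version that is nonnegative everywhere. *)
Definition Wplus (t : tree) : R := Num.max (Wbar t) 0.

Let Wplus0 t : 0 <= Wplus t. Proof. by rewrite le_max lexx orbT. Qed.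

Let mWplus : measurable_fun setT Wplus.
Proof. exact: measurable_maxr. Qed.

Let Wbar_ge0 (t : tree) : (gen_size n t)%:R / mubar ^+ n @[n --> \oo] --> Wbar t -> 0 <= Wbar t.
Proof.
move=> cv; rewrite -(cvg_lim _ cv)//; apply: limr_ge; first by apply/cvg_ex; eexists; exact: cv.
by apply: nearW => n; rewrite divr_ge0// exprn_ge0// ltW.
Qed.

Let Wplus_ae : {ae Pbar, forall t, Wplus t = Wbar t}.
Proof. by apply: ae_imp hWbar => t /Wbar_ge0 W0; rewrite /Wplus max_l. Qed.

Let Wplus_lim : {ae Pbar, forall t : tree,
  (gen_size n t)%:R / mubar ^+ n @[n --> \oo] --> Wplus t}.
Proof. by apply: ae_imp hWbar => t cv; rewrite /Wplus max_l//; exact: Wbar_ge0. Qed.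

Local Notation L := (limit_moment Pbar Wplus).
Local Notation V := (limit_jet Pbar p1 Wplus).
Local Notation phi := (laplace Pbar Wbar).

Let W_integrable l : (l <= p1)%N -> Pbar.-integrable setT (EFin \o (fun t => Wplus t ^+ l)).
Proof.
exact: (limit_integrable qb_dist hPbar p1_gt0 mb1 qbar_moments qb_mean mWplus Wplus0 Wplus_lim).
Qed.

Lemma laplace_Wplus b : phi b = laplace_moment Pbar Wplus 0 b.
Proof.
rewrite /laplace /laplace_moment unlock /Rintegral; congr fine.
apply: ae_eq_integral => //.
- apply/measurable_EFinP; apply: measurableT_comp => //.
  by apply: measurableT_comp => //; exact: measurable_funM.
- by apply/measurable_EFinP; exact: (measurable_pow_expR mWplus 0).
- by apply: ae_imp Wplus_ae => t Wt _; rewrite expr0 mul1r Wt.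
Qed.

Lemma der0n_phi l b : 0 <= b -> (l <= p1)%N ->
  der0n l phi b = (-1) ^+ l * (l`!%:R * L l b).
Proof.
move=> b0 lp; rewrite (der0n_laplace mWplus Wplus0 laplace_Wplus W_integrable)//; last by right.
by rewrite /limit_moment [_`!%:R * _]mulrC divfK// pnatr_eq0 -lt0n fact_gt0.
Qed.

Lemma Gfun_limit_jet a n n0 x : 0 <= a ->
  Gfun phi mubar a p n n0 x = (V (a / mubar ^+ n) ^+ x)`_p / L p (a / mubar ^+ n0).
Proof.
move=> a0; have am k : 0 <= a / mubar ^+ k by rewrite divr_ge0// exprn_ge0// ltW.
apply: Gfun_jet; last exact: der0n_phi.
by move=> l lp; rewrite limit_jetE ?der0n_phi// (leq_trans lp).
Qed.

(** For [1 < p] nondegeneracy comes from [limit_moment1]: the limit has mean 1. *)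
Lemma limit_moment_gt0 l b : 0 <= b -> (l <= p)%N ->
  (p = 1%N -> ~ {ae Pbar, forall t : tree, Wbar t = 0 :> R}) -> 0 < L l b.
Proof.
move=> b0 lp W_nondeg; rewrite divr_gt0 ?ltr0n ?fact_gt0//.
apply: (laplace_moment_gt0 mWplus Wplus0); last first.
  by apply: (pow_integrable_expR mWplus Wplus0) => //; apply: W_integrable; exact: leq_trans pp1.
have [l0|l0] := eqVneq l 0%N; [by left | right => W_eq0].
have p0 : p != 0%N by rewrite -lt0n (leq_trans _ lp)// lt0n.
have [pE|pn1] := eqVneq p 1%N.
  apply: W_nondeg => //; have [N [mN N0 sN]] := W_eq0.
  have [N' [mN' N'0 sN']] := Wplus_ae.
  exists (N `|` N'); split; first exact: measurableU.
    by apply: null_set_setU.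
  move=> t /= Wt; have [NWt|Wt'] := pselect (Wplus t = Wbar t).
    by left; apply: sN => /=; rewrite NWt.
  by right; apply: sN'.
have lt1p : (1 < p1)%N by rewrite leq_max; case: (p) p0 pn1 => [|[|]].
have := limit_moment1 qb_dist hPbar p1_gt0 mb1 qbar_moments qb_mean mWplus Wplus0 Wplus_lim lt1p.
rewrite /limit_moment /laplace_moment divr1.
suff -> : \int[Pbar]_x (Wplus x ^+ 1 * expR (- (0 * Wplus x))) = 0.
  by move/esym/eqP; rewrite oner_eq0.
rewrite /Rintegral (ae_eq_integral (cst 0%E))//; first by rewrite integral0.
- by apply/measurable_EFinP; exact: (measurable_pow_expR mWplus 1).
- by apply: ae_imp W_eq0 => t Wt _; rewrite Wt expr1 mul0r.
Qed.

Lemma tilted_expectation n (A : set tree) (g : nat -> R) : filtr n A ->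
  (forall z, 0 <= g z) ->
  Pbar.-integrable setT (EFin \o (fun t : tree => g (gen_size n t))) ->
  'E_P[(fun t : tree => kappa ^+ gen_size n t * g (gen_size n t) * \1_A t)%R]%E =
  (kappa * \int[Pbar]_(t in A) g (gen_size n t))%:E.
Proof.
move=> nA g0 ig; have mA := filtr_measurable nA.
have iA : Pbar.-integrable A (EFin \o (fun t : tree => g (gen_size n t))).
  exact: (integrableS measurableT mA (@subsetT _ _) ig).
rewrite -(RintegralZl _ mA iA) /Rintegral fineK; last first.
  by apply: integrable_fin_num => //; exact: (integrableZl _ _ iA).
rewrite (tilted_integral q_dist kappa1 fk hP hPbar nA (g := fun z => kappa * g z)); last first.
  by move=> z; rewrite mulr_ge0// ltW.
rewrite unlock [RHS]integral_mkcond; apply: eq_integral => t _.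
rewrite patchE indicE; case: (t \in A) => /=; last by rewrite mulr0.
by congr EFin; rewrite mulr1; field; rewrite gt_eqF.
Qed.

Lemma MfunE a n n0 z : 0 <= a -> Mfun phi mubar a kappa p n n0 z =
  kappa ^+ z / kappa *
  ((mubar ^+ (p * (n - n0)))^-1 * (L p (a / mubar ^+ n0))^-1 * (V (a / mubar ^+ n) ^+ z)`_p).
Proof. by move=> a0; rewrite /Mfun Gfun_limit_jet// (exprzB1 kappa1); ring. Qed.

Lemma Mfun_ge0 a n n0 z : 0 <= a -> 0 <= Mfun phi mubar a kappa p n n0 z.
Proof.
move=> a0; rewrite MfunE//; have V0 := limit_jet_nneg Pbar p1 Wplus0 (a / mubar ^+ n).
have VX : 0 <= (V (a / mubar ^+ n) ^+ z)`_p := poly_nnegX z V0 p.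
have L0 : 0 <= L p (a / mubar ^+ n0) := limit_moment_ge0 Pbar Wplus0 p _.
by apply: mulr_ge0; [|apply: mulr_ge0 => //; apply: mulr_ge0];
  rewrite ?divr_ge0 ?invr_ge0 ?exprn_ge0// ltW.
Qed.

(** By [tilted_integral] the factor [kappa ^ Z] turns means under [P] into means
    under [Pbar], where only the weights of [supercritical_cvg] remain. *)
Lemma fixpoint_weight_cvg a n (A : set tree) : 0 <= a ->
  (p = 1%N -> ~ {ae Pbar, forall t : tree, Wbar t = 0 :> R}) -> filtr n A ->
  let weight (k : nat) (t : tree) :=
    Hpol p (gen_size k t)%:R * kappa ^+ gen_size k t
      * expR (- (a * (gen_size k t)%:R / mubar ^+ k)) in
  ('E_P[(fun t => weight (m + n)%N t * \1_A t)%R] / 'E_P[weight (m + n)%N])%E @[m --> \oo]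
  --> ('E_P[(fun t => Mfun phi mubar a kappa p n 0 (gen_size n t) * \1_A t)%R])%E.
Proof.
move=> a0 W_nondeg nA weight; have an0 : 0 <= a / mubar ^+ n by rewrite divr_ge0// exprn_ge0// ltW.
have kn0 : kappa != 0 by rewrite gt_eqF.
pose g k z := (laplace_jet mubar a k ^+ z)`_p.
have g0 k z : 0 <= g k z := poly_nnegX z (laplace_jet_nneg mubar a k) p.
have ig k : Pbar.-integrable setT (EFin \o (fun t : tree => g k (gen_size k t))).
  exact: (laplace_jet_integrable qb_dist hPbar mb1 qbar_moments).
have weightE k (B : set tree) : filtr k B ->
    'E_P[(fun t => weight k t * \1_B t)%R]%E = (kappa * \int[Pbar]_(t in B) g k (gen_size k t))%:E.
  move=> kB; rewrite -tilted_expectation//; congr expectation; apply/funext => t.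
  by rewrite /weight /g laplace_jetE Hpol_bin; ring.
have weightTE k : 'E_P[weight k]%E = (kappa * \int[Pbar]_t g k (gen_size k t))%:E.
  rewrite -(weightE k _ (filtrT k)); congr expectation; apply/funext => t.
  by rewrite indicT mulr1.
have L_gt0 := limit_moment_gt0 a0 (leqnn p) W_nondeg.
have -> : (fun m => ('E_P[(fun t => weight (m + n)%N t * \1_A t)%R] / 'E_P[weight (m + n)%N])%E) =
    (fun m => ((\int[Pbar]_(t in A) g (m + n)%N (gen_size (m + n) t))%:E /
       (\int[Pbar]_t g (m + n)%N (gen_size (m + n) t))%:E)%E).
  apply/funext => m; rewrite weightE; last by apply: filtr_le nA; rewrite leq_addl.
  by rewrite weightTE EFin_div_scale.
have -> : 'E_P[(fun t => Mfun phi mubar a kappa p n 0 (gen_size n t) * \1_A t)%R]%E =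
    ((\int[Pbar]_(t in A) (V (a / mubar ^+ n) ^+ gen_size n t)`_p) /
      (mubar ^+ (n * p) * L p a))%:E.
  pose h z := kappa^-1 * (mubar ^+ (n * p) * L p a)^-1 * (V (a / mubar ^+ n) ^+ z)`_p.
  have iV : Pbar.-integrable setT (EFin \o (fun t : tree => (V (a / mubar ^+ n) ^+ gen_size n t)`_p)).
    exact: (limit_jet_integrable qb_dist hPbar p1_gt0 mb1 qbar_moments qb_mean mWplus Wplus0 Wplus_lim).
  have mA := filtr_measurable nA.
  have ih := integrableZl measurableT (kappa^-1 * (mubar ^+ (n * p) * L p a)^-1) iV.
  have -> : (fun t : tree => Mfun phi mubar a kappa p n 0 (gen_size n t) * \1_A t)%R =
      (fun t : tree => kappa ^+ gen_size n t * h (gen_size n t) * \1_A t).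
    apply/funext => t; rewrite MfunE// /h subn0 expr0 divr1 (invfM _ (L p a)) [(p * n)%N]mulnC.
    by ring.
  rewrite tilted_expectation//; last first.
    move=> z; have V0 := limit_jet_nneg Pbar p1 Wplus0 (a / mubar ^+ n).
    apply: mulr_ge0; last exact: (poly_nnegX z V0 p).
    by rewrite mulr_ge0 ?invr_ge0 ?(ltW kappa0)// mulr_ge0 ?exprn_ge0 ?ltW.
  rewrite RintegralZl//; last exact: (integrableS measurableT mA (@subsetT _ _) iV).
  by congr EFin; rewrite !mulrA divff// mul1r mulrC.
exact: (supercritical_cvg qb_dist hPbar p1_gt0 mb1 qbar_moments qb_mean mWplus Wplus0 Wplus_lim).
Qed.

Lemma rhobarE a n l s : 0 <= a -> (l <= p)%N -> sumn s = l ->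
  rhobar (qbar q kappa) phi mubar a n l s =
  qbar q kappa (size s) * (\prod_(j <- s) (V (a / mubar ^+ n.+1))`_j) /
    (mubar ^+ l * (V (a / mubar ^+ n))`_l).
Proof.
move=> a0 lp sl; rewrite /rhobar sl eqxx.
have am k : 0 <= a / mubar ^+ k by rewrite divr_ge0// exprn_ge0// ltW.
have fact0 (k : nat) : k`!%:R != 0 :> R by rewrite pnatr_eq0 -lt0n fact_gt0.
have lp1 := leq_trans lp pp1.
have -> : \prod_(j <- s) (der0n j phi (a / mubar ^+ n.+1) / j`!%:R) =
    (-1) ^+ l * \prod_(j <- s) (V (a / mubar ^+ n.+1))`_j.
  rewrite -{1}sl sumnE -prodrXr -big_split/=; apply: eq_big_seq => j js.
  have jl : (j <= l)%N by rewrite -sl -(nth_index 0%N js) nth_le_sumn.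
  by rewrite der0n_phi ?limit_jetE ?(leq_trans jl)// -mulrA [_%:R * _]mulrC mulfK.
rewrite der0n_phi ?limit_jetE ?lp1 ?am//; set A := \prod_(j <- s) _.
have [->|L0] := eqVneq (L l (a / mubar ^+ n)) 0; first by rewrite !(mulr0, invr0, mul0r).
have sgn0 : (-1) ^+ l != 0 :> R by rewrite expf_neq0// oppr_eq0 oner_neq0.
have mbn0 : mubar ^+ l != 0 by rewrite expf_neq0// gt_eqF.
by field; rewrite L0 sgn0 fact0 mbn0.
Qed.

(** Summed over the sequences of length [k], the weights give the coefficient of
    the [k]-th power of the limit jet, and [limit_jet_series] sums these over
    [k]. *)
Lemma rhobar_dist a n l : 0 <= a -> (l <= p)%N ->
  (p = 1%N -> ~ {ae Pbar, forall t : tree, Wbar t = 0 :> R}) ->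
  is_distribution (coded (rhobar (qbar q kappa) phi mubar a n l)).
Proof.
move=> a0 lp W_nondeg; set rho := rhobar _ _ _ _ _ _.
have an0 : 0 <= a / mubar ^+ n by rewrite divr_ge0// exprn_ge0// ltW.
have lp1 := leq_trans lp pp1.
have L_gt0 := limit_moment_gt0 an0 lp W_nondeg.
have Q0 := qbar_ge0 q_dist kappa1.
have V0 b : poly_nneg (V b) := limit_jet_nneg Pbar p1 Wplus0 b.
have rho_sum s : rho s != 0 -> sumn s = l by rewrite /rho /rhobar; case: (sumn s =P l) => // _; rewrite eqxx.
have D0 : 0 < mubar ^+ l * L l (a / mubar ^+ n) by rewrite mulr_gt0// exprn_gt0.
have rho0 s : 0 <= rho s.
  have [sl|sl] := eqVneq (sumn s) l; last by rewrite /rho /rhobar (negbTE sl).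
  rewrite /rho rhobarE// limit_jetE// divr_ge0 ?(ltW D0)// mulr_ge0//.
  by apply: prodr_ge0 => j _; exact: V0.
split; first by move=> k; rewrite /coded; case: choice.pickle_inv.
rewrite (coded_series lp rho0 rho_sum).
have -> : (\sum_(k <oo) (\sum_(f : {ffun 'I_k -> 'I_p.+1} | (\sum_i f i)%N == l) rho (ffun_seq f))%:E)%E =
    (\sum_(k <oo) ((mubar ^+ l * L l (a / mubar ^+ n))^-1%:E *
      (qbar q kappa k * (V (a / mubar ^+ n.+1) ^+ k)`_l)%:E))%E.
  apply: eq_eseriesr => k _; rewrite -EFinM; congr EFin.
  rewrite (coef_exp_ffun _ _ lp) mulrCA mulr_sumr mulr_sumr; apply: eq_bigr => f /eqP fl.
  rewrite /rho rhobarE//; last by rewrite sumnE big_ffun_seq.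
  by rewrite size_ffun_seq big_ffun_seq limit_jetE// mulrAC -mulrA mulrCA.
rewrite nneseriesZl; last by move=> k _; rewrite lee_fin mulr_ge0// poly_nnegX.
have -> : a / mubar ^+ n.+1 = a / mubar ^+ n / mubar by rewrite exprSr invfM mulrA.
rewrite -/(jet_series _ _ _).
rewrite (limit_jet_series qb_dist hPbar p1_gt0 mb1 qbar_moments qb_mean mWplus Wplus0 Wplus_lim an0 lp1).
by rewrite -EFinM mulVf// gt_eqF.
Qed.

(** On an atom both sides are explicit: [tau_atom] gives the law of the tree in
    terms of [qbar], which [prod_qbar] converts to [q], and the coefficient left
    is the one in [MfunE]. Uniqueness holds since the cylinders are stable under
    intersection. *)
Lemma multitype_density a n0 (Pn : probability tree R) : GW_law q n0 Pn -> 0 <= a ->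
  (p = 1%N -> ~ {ae Pbar, forall t : tree, Wbar t = 0 :> R}) ->
  let density (Q : probability tree R) :=
    forall n : nat, (n0 <= n)%N -> forall A : set tree, filtr n A ->
      Q A = (\int[Pn]_(t in A) (Mfun phi mubar a kappa p n n0 (gen_size n t))%:E)%E in
  exists Q : probability tree R,
    [/\ density Q,
        forall Q' : probability tree R, density Q' ->
          forall A : set tree, measurable A -> Q' A = Q A
      & multitype_GW_law (rhobar (qbar q kappa) phi mubar a) n0 p Q].
Proof.
move=> hPn a0 W_nondeg density.
have am k : 0 <= a / mubar ^+ k by rewrite divr_ge0// exprn_ge0// ltW.
have [|||||Q [Qlaw Qatom Qnr]] := @multitype_GW_exists R (rhobar (qbar q kappa) phi mubar a) n0 p
  (qbar q kappa) mubar (fun n => V (a / mubar ^+ n)).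
- by move=> n l lp; exact: rhobar_dist.
- by move=> n l s; rewrite /rhobar; case: (sumn s =P l) => // _; rewrite eqxx.
- exact: mb0.
- by move=> n l lp; rewrite limit_jetE ?(leq_trans lp)//; exact: limit_moment_gt0.
- by move=> n l s lp sl; exact: rhobarE.
have dQ : density Q.
  move=> n n0n A nA; have mA := filtr_measurable nA.
  transitivity (\int[Q]_(t in A) (cst 1%E) t)%E; first by rewrite integral_cst ?mul1e.
  apply: (eq_filtr_integral nA) => //.
  - exact: (gen_size_mfun _ (fun z => (Mfun phi mubar a kappa p n n0 z)%:E)).
  - by move=> x; rewrite lee_fin Mfun_ge0.
  move=> x0 _; rewrite !atom_integral//; last by move=> x /eq_gen_size ->.
  rewrite mul1e; have [rx0|nr] := pselect (rooted_tree (ones n0) x0); last first.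
    by rewrite Qnr// (GW_notrooted q_dist hPn)// mule0.
  rewrite -(subnKC n0n) Qatom// (GW_atom q_dist hPn (n - n0) rx0) -EFinM; congr EFin.
  have zE : gen_size (n0 + (n - n0)) x0 = size (lev (ones n0) x0 (n - n0)).
    by rewrite -{1}(size_ones n0) (gen_sizeE rx0).
  rewrite (prod_qbar q kappa1) MfunE// zE addKn limit_jetE//.
  set A' := \prod_(v <- _) _; set B := (V _ ^+ _)`_p.
  by rewrite invfM; ring.
exists Q; split => // Q' dQ' A mA.
apply: (@measure_unique _ R tree cylinders (fun=> setT)) => //.
- exact: cylindersI.
- by move=> _; exists 0%N => //; exact: filtrT.
- by rewrite bigcup_const.
- move=> B [n _ nB]; have nB' : filtr (maxn n n0) B by apply: filtr_le nB; rewrite leq_maxl.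
  exact: etrans (dQ' _ (leq_maxr _ _) _ nB') (esym (dQ _ (leq_maxr _ _) _ nB')).
- by move=> _; apply: le_lt_trans (probability_le1 _ measurableT) (ltry _).
Qed.

End FixedPointTransform.

Theorem theorem5p1 (R : realType) (p : nat) (q : nat -> R)
  (hq : is_distribution q) (hmean : (mean q < 1)%E)
  (kappa : R)
  (hkappa : unique (fun x : R => [/\ 1 < x, genfun q x = x%:E
                               & (genfunD q (maxn p 1) x < +oo)%E]) kappa)
  (P : nat -> probability tree R) (hP : forall k, GW_law q k (P k))
  (Pbar : probability tree R) (hPbar : GW_law (qbar q kappa) 0 Pbar)
  (Wbar : {RV Pbar >-> R})
  (hWbar : {ae Pbar, forall t : tree,
     (gen_size n t)%:R / fine (genfunD q 1 kappa) ^+ n @[n --> \oo]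
       --> (Wbar t : R)}) :
  let mu := fine (mean q) in
  let mubar := fine (genfunD q 1 kappa) in
  let phi := laplace Pbar Wbar in
  let Z := fun (n : nat) (t : tree) => gen_size n t in
  (forall (n : nat) (Lambda : set tree), filtr n Lambda ->
    (* For p >= 1 and s = 0 the quotient below is 0 / 0 for every m. *)
    (forall s : R, 0 <= s < kappa -> p = 0%N \/ 0 < s ->
      let weight (k : nat) (t : tree) := Hpol p (Z k t)%:R * s ^+ Z k t in
      ('E_(P 0%N)[(fun t => weight (m + n)%N t * \1_Lambda t)%R]
         / 'E_(P 0%N)[weight (m + n)%N])%E
        @[m --> \oo]
      --> (if p == 0%N then 'E_(P 0%N)[(\1_Lambda : tree -> R)]
           else 'E_(P 0%N)[(fun t => (Z n t)%:R / mu ^+ n * \1_Lambda t)%R])%E)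
    /\
    (* For p = 1, phi' is identically 0 when Wbar = 0 a.s., and M is 0 / 0;
       for p >= 2 the moment condition on kappa excludes this case. *)
    (forall a : R, 0 <= a ->
      (p = 1%N -> ~ {ae Pbar, forall t : tree, Wbar t = 0 :> R}) ->
      let weight (k : nat) (t : tree) :=
        Hpol p (Z k t)%:R * kappa ^+ Z k t
          * expR (- (a * (Z k t)%:R / mubar ^+ k)) in
      ('E_(P 0%N)[(fun t => weight (m + n)%N t * \1_Lambda t)%R]
         / 'E_(P 0%N)[weight (m + n)%N])%E
        @[m --> \oo]
      --> ('E_(P 0%N)[(fun t => Mfun phi mubar a kappa p n 0 (Z n t)
                                * \1_Lambda t)%R])%E))
  /\
  (forall a : R, 0 <= a ->
    (p = 1%N -> ~ {ae Pbar, forall t : tree, Wbar t = 0 :> R}) ->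
    forall n0 : nat,
      let density (Q : probability tree R) :=
        forall n : nat, (n0 <= n)%N -> forall A : set tree, filtr n A ->
          Q A = (\int[P n0]_(t in A)
                   (Mfun phi mubar a kappa p n n0 (Z n t))%:E)%E in
      exists Q : probability tree R,
        [/\ density Q,
            forall Q' : probability tree R, density Q' ->
              forall A : set tree, measurable A -> Q' A = Q A
          & multitype_GW_law (rhobar (qbar q kappa) phi mubar a) n0 p Q]).
Proof.
move=> mu mubar phi Z; have [[kappa1 fk fDp] _] := hkappa.
have mW : measurable_fun setT Wbar by exact: measurable_funPT.
have fD1 : (genfunD q 1 kappa < +oo)%E by rewrite (genfunD1_fixpoint hq kappa1 fk fDp) ltry.
split=> [n Lambda nL|a a0 W_nondeg n0]; last first.
  exact: (multitype_density hq hmean kappa1 fk fDp (hPbar) mW hWbar (hP n0)).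
split=> [s s0k ps|a a0 W_nondeg].
  exact: (subcritical_cvg hq (hP 0%N) hmean kappa1 fk fD1 s0k ps nL).
exact: (fixpoint_weight_cvg hq hmean kappa1 fk fDp (hP 0%N) hPbar mW hWbar a0 W_nondeg nL).
Qed.
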